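(* There exist tight $N$-point simplices in the real Grassmannian $G(m,n)$ for the following values: $(m,n)=(2,4)$, $4\le N\le 6$; $(2,5)$, $5\le N\le 10$; $(2,6)$, $5\le N\le 14$; $(3,6)$, $5\le N\le 16$; $(2,7)$, $6\le N\le 17$; $(3,7)$, $5\le N\le 22$; $(2,8)$, $6\le N\le 21$; $(3,8)$, $5\le N\le 28$; $(4,8)$, $5\le N\le 30$.
   Context: $G(m,n)$ is the space of $m$-dimensional linear subspaces of $\mathbb{R}^n$. Each subspace $U$ is identified with its orthogonal projection matrix $\Pi_U$ (an $n\times n$ real symmetric idempotent of trace $m$); the chordal distance satisfies $d_c(U,U')^2 = m - \operatorname{tr}(\Pi_U\Pi_{U'})$. A tight $N$-point simplex in $G(m,n)$ is a set of $N$ distinct subspaces with projection matrices $\Pi_1,\dots,\Pi_N$ such that $\operatorname{tr}(\Pi_i\Pi_j) = \frac{m(Nm-n)}{n(N-1)}$ for all $i\ne j$ (equivalently, all pairwise squared chordal distances equal $\frac{m(n-m)}{n}\cdot\frac{N}{N-1}$). *)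

(* Defs.v *)
From HB Require Import structures.
From mathcomp Require Import all_boot all_order all_algebra.
From mathcomp Require Import reals.
Set Implicit Arguments. Unset Strict Implicit. Unset Printing Implicit Defensive.
Import Order.TTheory GRing.Theory Num.Theory.
Local Open Scope ring_scope.

Definition orth_proj (R : numDomainType) (n : nat) (P : 'M[R]_n) : Prop :=
  P^T = P /\ P *m P = P.

(* A point of the real Grassmannian G(m,n), identified (as in the paper) with
   its orthogonal projection matrix: symmetric idempotent of trace m. *)
Definition grass_point (R : numDomainType) (m n : nat) (P : 'M[R]_n) : Prop :=
  orth_proj P /\ \tr P = m%:R.

Definition tight_simplex (R : numFieldType) (m n N : nat)
    (P : 'I_N -> 'M[R]_n) : Prop :=
  injective P /\
  (forall i, @grass_point R m n (P i)) /\
  (forall i j, i != j ->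
     \tr (P i *m P j) =
       (m%:R * (N%:R * m%:R - n%:R)) / (n%:R * (N%:R - 1))).

(* Main.v *)
Require Import Defs.
From HB Require Import structures.
From Stdlib Require Import ZArith.
From mathcomp Require Import all_boot all_order all_algebra.
From mathcomp Require Import complex cyclic separable cyclotomic.
From mathcomp Require Import boolp classical_sets reals.
From mathcomp Require Import zify ssrZ ring lra.
Set Implicit Arguments. Unset Strict Implicit. Unset Printing Implicit Defensive.
Import Order.TTheory GRing.Theory Num.Theory.

(* The N subspaces are k orbits of a cyclic group of order p, which acts on R^n
   by rotating coordinate planes, together with a few invariant subspaces. The
   trace of the product of one projection with a rotated copy of another is a
   trigonometric polynomial in the rotation, so tightness becomes a system of
   quadratic equations on Fourier coefficients of the k projections. Since the
   projections must add up to a scalar matrix, some of these equations follow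
   from the others; the remaining ones form a square system once Gram-Schmidt
   bases are used as coordinates and superfluous coordinates are frozen.

   For each triple (m,n,N), an approximate solution found numerically is turned
   into an exact one by the Newton-Kantorovich argument. Its hypotheses, bounds
   on the residual and on the slopes of the system in a small box, are checked
   by evaluation in fixed-point integer arithmetic. The system is a program over
   an abstract arithmetic, which is run on reals, on enclosures and on fractions;
   parametricity relates these runs. *)

(** * The system of equations *)

(** The equations [tr (P_i P_j) = c] cannot be given to Newton's method as they stand. For
    projections of rank m with sum S, the sum of [tr (P_i P_j) - c] over all pairs i <> j is the
    squared norm of S - (N m / n) 1. It vanishes to second order at every solution, so the
    derivative of the system is never onto. Trading some trace equations for the linear condition
    that S be scalar removes this degeneracy.

    Half planes, on which a rotation acts by a sign, make odd n possible and allow one-dimensional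
    representations of the cyclic group.

    Slopes are those of secants, not derivatives. A factorization F x - F y = S (x - y) passes
    through each arithmetic operation by pure algebra, and it is all that a contraction needs; in
    the same spirit, sines and cosines enter only as the parts of powers of a root of unity. *)

Record arith (T : Type) := Arith {
  azero : T;
  aadd : T -> T -> T;
  asub : T -> T -> T;
  amul : T -> T -> T;
  ainv : T -> T;
  afrac : Z -> Z -> T }.

Section Program.
Variables (T : Type) (o : arith T).
Local Notation "0" := (azero o).
Local Notation "x + y" := (aadd o x y).
Local Notation "x - y" := (asub o x y).
Local Notation "x * y" := (amul o x y).
Local Notation "l .[ i ]" := (nth (azero o) l i) (at level 1, left associativity, format "l .[ i ]").

Definition asum (l : seq nat) (f : nat -> T) : T :=
  foldr (fun i acc => f i + acc) 0 l.

Definition anat (k : nat) (x : T) : T := iter k (aadd o x) 0.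

(** Keeping each Gram-Schmidt vector q next to q / |q|^2 avoids square roots: the orthogonal
    projection is the sum of the matrices (q / |q|^2) q^T, a rational function of the
    coordinates. *)
Definition gs_vec (d c : nat) (B : seq (seq T * seq T)) (x : nat -> T) : seq T :=
  let cs := mkseq (fun l => asum (iota 0 d)
              (fun i => (nth ([::], [::]) B l).2.[i] * x i)) c in
  mkseq (fun i => x i - asum (iota 0 c)
              (fun l => cs.[l] * (nth ([::], [::]) B l).1.[i])) d.

Definition gs_step (d c : nat) (B : seq (seq T * seq T)) (x : nat -> T) :=
  let q := gs_vec d c B x in
  let w := ainv o (asum (iota 0 d) (fun i => q.[i] * q.[i])) in
  (mkseq (fun i => w * q.[i]) d, q, w).

(* The pairs [(q / |q|^2, q)], for the Gram-Schmidt vectors [q], and the weights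
   [1 / |q|^2]. *)
Fixpoint gram_schmidt (d m : nat) (x : nat -> nat -> T) :=
  match m with
  | O => ([::], [::])
  | c.+1 => let: (B, ws) := gram_schmidt d c x in
            let: (u, q, w) := gs_step d c B (x c) in
            (rcons B (u, q), w :: ws)
  end.

Definition proj_entry (m : nat) (B : seq (seq T * seq T)) (i j : nat) : T :=
  asum (iota 0 m) (fun l => (nth ([::], [::]) B l).1.[i] * (nth ([::], [::]) B l).2.[j]).

(** The matrix is symmetric, so a triangle suffices: [coef] reads the entry (i, j) only for i <=
    j. *)
Definition proj_table (d m : nat) B : seq (seq T) :=
  mkseq (fun j => mkseq (fun i => proj_entry m B i j) j.+1) d.

End Program.

(** Frequencies matter modulo p and up to sign. The boolean is false when the sign was reversed, in
    which case the imaginary parts of the coefficients have to be negated. *)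
Definition fold_freq (p f : nat) : nat * bool :=
  let g := (f %% p)%N in if (2 * g <= p)%N then (g, true) else ((p - g)%N, false).

Record block := Tag { ta : nat; tb : nat; tanti : bool; tfreq : nat; tsign : bool; tmult : nat }.

(* For planes a <= b, the 2x2 block of a matrix between them splits into a part
   commuting with rotations (tanti = false, frequency w_a - w_b) and an
   anti-commuting part (frequency w_a + w_b). The last [h] planes are half
   planes, for which both parts coincide. *)
Definition block_tags (p : nat) (w : seq nat) (h a b : nat) : seq block :=
  let wa := nth 0 w a in let wb := nth 0 w b in
  let: (f, s) := fold_freq p (wa + p - wb) in
  let: (f', s') := fold_freq p (wa + wb) in
  let k := if a == b then 1 else 2 in
  if b < size w - h then [:: Tag a b false f s k; Tag a b true f' s' k]
  else [:: Tag a b false f s (2 * k)].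

Definition tags p w h : seq block :=
  flatten [seq flatten [seq block_tags p w h a b | a <- iota 0 b.+1] | b <- iota 0 (size w)].

Section Program2.
Variables (T : Type) (o : arith T).
Local Notation "0" := (azero o).
Local Notation "x + y" := (aadd o x y).
Local Notation "x - y" := (asub o x y).
Local Notation "x * y" := (amul o x y).

Definition signed (b : bool) (x : T) := if b then x else 0 - x.

Definition tag0 := Tag 0 0 false 0 true 0.
(** A real 2x2 block is a map z -> alpha z + beta conj(z) of the complex plane. The result is 2
    alpha or 2 beta, conjugated if folding reversed the frequency. Rotating the two planes by x and
    y multiplies alpha by exp(i (x - y)) and beta by exp(i (x + y)). For a half plane the block is a
    single column, read as one complex number. *)
Definition coef (h t : nat) (P : nat -> nat -> T) (e : block) : T * T :=
  let i := (2 * ta e)%N in let j := (2 * tb e)%N in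
  if ta e == tb e then
    if tb e < t - h then
      if tanti e then
        (P i j - P i.+1 j.+1, signed (tsign e) (P i j.+1 + P i j.+1))
      else (P i j + P i.+1 j.+1, 0)
    else (P i j, 0)
  else
    if tb e < t - h then
      if tanti e then
        (P i j - P i.+1 j.+1, signed (tsign e) (P i.+1 j + P i j.+1))
      else (P i j + P i.+1 j.+1, signed (tsign e) (P i.+1 j - P i j.+1))
    else (P i j, signed (tsign e) (P i.+1 j)).

Definition coefs (h t : nat) (tg : seq block) (P : seq (seq T)) : seq (T * T) :=
  map (coef h t (fun i j => nth 0 (nth [::] P j) i)) tg.

Definition with_freq (tg : seq block) (f : nat) : seq nat :=
  filter (fun e => tfreq (nth tag0 tg e) == f) (iota 0 (size tg)).

Local Notation re X e := (nth (azero o, azero o) X e).1.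
Local Notation im X e := (nth (azero o, azero o) X e).2.

(** Twice the trace of one projection times the r-th rotation of another is a trigonometric
    polynomial in r; this is its coefficient of cos(2 pi f r / p), and [sin_coef] that of -sin(2 pi
    f r / p). *)
Definition cos_coef tg (X Y : seq (T * T)) f : T :=
  asum o (with_freq tg f) (fun e => anat o (tmult (nth tag0 tg e))
     (re X e * re Y e + im X e * im Y e)).
Definition sin_coef tg (X Y : seq (T * T)) f : T :=
  asum o (with_freq tg f) (fun e => anat o (tmult (nth tag0 tg e))
     (re X e * im Y e - im X e * re Y e)).

End Program2.

Inductive eqn :=
| ESelf of nat & nat | ECos of nat & nat & nat | ESin of nat & nat & nat
| EFix of nat & nat | ERe of nat | EIm of nat.

(* [weights] are the speeds at which the coordinate planes rotate; the last
   [halves] of these planes contribute only their first coordinate to R^n.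
   [fixed] lists integral bases of the invariant subspaces, [entries] the
   coordinates of the bases of the orbit representatives. *)
Record case := Case {
  period : nat;
  weights : seq nat;
  halves : nat;
  prec : nat;
  radius : Z;
  fixed : seq (seq Z);
  entries : seq Z }.

Section Equations.
Variables (p t k nf : nat) (tg : seq block).

Definition freqs lo : seq nat := filter (fun f => lo <= f) (iota 0 p./2.+1).

Definition cross_eqs a b :=
  (if 0 < a then [:: ECos a b 0] else [::]) ++
  flatten [seq ECos a b f :: (if 2 * f < p then [:: ESin a b f] else [::]) | f <- freqs 1].

(** Asked for at frequency 0 only, since the other blocks cancel in the sum over an orbit. By
    symmetry, the commuting part of a diagonal block has no imaginary part to be constrained. *)
Definition sum_eqs e :=
  let x := nth tag0 tg e in
  if (ta x == tb x) && ~~ tanti x then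
    if ta x < t.-1 then [:: ERe e] else [::]
  else [:: ERe e; EIm e].

(* The equations left out, which concern the orbit 0 or the last plane, follow
   from the others because the sum of all projections is scalar. *)
Definition equations : seq eqn :=
  flatten [seq [seq ESelf a f | f <- freqs (if a == 0 then 2 else 1)] | a <- iota 0 k] ++
  flatten [seq flatten [seq cross_eqs a b | b <- iota a.+1 (k - a.+1)] | a <- iota 0 k] ++
  flatten [seq [seq EFix a j | j <- iota 0 nf] | a <- iota 1 k.-1] ++
  flatten [seq sum_eqs e | e <- with_freq tg 0].
End Equations.

Section System.
Variables (T : Type) (o : arith T).
Variables (m n N : nat) (D : case).
Local Notation p := (period D).
Local Notation h := (halves D).
Local Notation t := (size (weights D)).
Local Notation d := (2 * size (weights D)).
Let nf := size (fixed D).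
Let k := (N - nf) %/ p.
Let tg := tags p (weights D) h.
Let zn (i : nat) : Z := Z.of_nat i.

(* c = cnum / cden is the prescribed trace of a product. *)
Local Open Scope Z_scope.
Definition cnum : Z := zn m * (zn N * zn m - zn n).
Definition cden : Z := zn n * (zn N - 1).

(** Within an orbit the trace must be m for the trivial rotation and c for the others, that is c +
    (m - c) delta(r). The function delta has cosine coefficient 2 / p, halved at the frequencies 0
    and p / 2; the trace formula brings another factor 2. *)
Definition self_target f : T :=
  afrac o ((if (2 * f)%N == p then 2 else 4) * (zn m * cden - cnum)) (zn p * cden).
Definition cross_target : T := afrac o (2 * cnum) cden.
(** All projections add up to (N m / n) 1. Summing an orbit multiplies the blocks of frequency 0 by
    p and kills the others; the equation is divided by this p. *)
Definition sum_target (e : block) : T :=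
  if (ta e == tb e) && ~~ tanti e then
    afrac o ((if (tb e < t - h)%N then 2 else 1) * (zn N * zn m)) (zn n * zn p)
  else azero o.
Definition inv_period : T := afrac o 1 (zn p).
Local Close Scope Z_scope.

Definition eval_eqn (X Q : seq (seq (T * T))) (q : eqn) : T :=
  match q with
  | ESelf a f => asub o (cos_coef o tg (nth [::] X a) (nth [::] X a) f) (self_target f)
  | ECos a b f => let c := cos_coef o tg (nth [::] X a) (nth [::] X b) f in
      if f == 0 then asub o c cross_target else c
  | ESin a b f => sin_coef o tg (nth [::] X a) (nth [::] X b) f
  | EFix a j => asub o (cos_coef o tg (nth [::] X a) (nth [::] Q j) 0) cross_target
  | ERe e => asub o
      (aadd o (asum o (iota 0 k) (fun a => (nth (azero o, azero o) (nth [::] X a) e).1))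
      (amul o inv_period (asum o (iota 0 nf) (fun j => (nth (azero o, azero o) (nth [::] Q j) e).1))))
      (sum_target (nth tag0 tg e))
  | EIm e =>
      aadd o (asum o (iota 0 k) (fun a => (nth (azero o, azero o) (nth [::] X a) e).2))
      (amul o inv_period (asum o (iota 0 nf) (fun j => (nth (azero o, azero o) (nth [::] Q j) e).2)))
  end.

Definition case_eqs := equations p t k nf tg.

Local Open Scope Z_scope.
(* Odd entries stand for the unknowns (with initial value z / 2^(prec-2)), even
   entries for the constants z / 2^8. *)
Fixpoint load (var : nat -> Z -> T) (j : nat) (zs : seq Z) : seq T :=
  match zs with
  | [::] => [::]
  | z :: zs' => if Z.odd z then var j z :: load var (S j) zs'
                else afrac o z 256 :: load var j zs'
  end.
Local Close Scope Z_scope.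

Definition orbit_gs (xs : seq T) (a : nat) :=
  gram_schmidt o d m (fun c i => nth (azero o) xs (a * (m * d) + c * d + i)).
Definition fixed_gs (j : nat) :=
  gram_schmidt o d m (fun c i => afrac o (nth Z0 (nth [::] (fixed D) j) (c * d + i)) (Zpos 1)).
Definition coefs_of (B : seq (seq T * seq T)) := coefs o h t tg (proj_table o d m B).

Definition orbit_bases (var : nat -> Z -> T) :=
  mkseq (orbit_gs (load var 0 (entries D))) k.
Definition orbit_coefs (G : seq (seq (seq T * seq T) * seq T)) := [seq coefs_of g.1 | g <- G].
Definition fixed_coefs := mkseq (fun j => coefs_of (fixed_gs j).1) nf.

Definition system (var : nat -> Z -> T) : seq T * seq T :=
  let G := orbit_bases var in
  let X := orbit_coefs G in
  let Q := fixed_coefs in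
  (map (eval_eqn X Q) case_eqs, flatten [seq g.2 | g <- G]).
End System.

(** * Fixed-point enclosures *)

Section FixedFactor.
Variables x1 x2 x3 x4 x5 x6 x7 : positive.
Fixpoint window_mul (b : positive) : positive :=
  match b with
  | xO (xO (xO p)) => xO (xO (xO (window_mul p)))
  | xI (xO (xO p)) => Pos.add x1 (xO (xO (xO (window_mul p))))
  | xO (xI (xO p)) => Pos.add x2 (xO (xO (xO (window_mul p))))
  | xI (xI (xO p)) => Pos.add x3 (xO (xO (xO (window_mul p))))
  | xO (xO (xI p)) => Pos.add x4 (xO (xO (xO (window_mul p))))
  | xI (xO (xI p)) => Pos.add x5 (xO (xO (xO (window_mul p))))
  | xO (xI (xI p)) => Pos.add x6 (xO (xO (xO (window_mul p))))
  | xI (xI (xI p)) => Pos.add x7 (xO (xO (xO (window_mul p))))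
  | xH => x1 | xO xH => x2 | xI xH => x3
  | xO (xO xH) => x4 | xI (xO xH) => x5 | xO (xI xH) => x6 | xI (xI xH) => x7
  end.
End FixedFactor.

(* [scale x] is multiplication by [x], with the small multiples of [x] shared
   between all applications: the cost of kernel reduction is dominated by
   multiplications of a whole list by the same number. *)
Definition scale (x : Z) : Z -> Z :=
  let pmul q :=
    let x2 := xO q in let x3 := Pos.add q x2 in let x4 := xO x2 in
    let x5 := Pos.add q x4 in let x6 := xO x3 in let x7 := Pos.add q x6 in
    window_mul q x2 x3 x4 x5 x6 x7 in
  match x with
  | Z0 => fun => Z0
  | Zpos q => let f := pmul q in fun b =>
      match b with Z0 => Z0 | Zpos p => Zpos (f p) | Zneg p => Zneg (f p) end
  | Zneg q => let f := pmul q in fun b =>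
      match b with Z0 => Z0 | Zpos p => Zneg (f p) | Zneg p => Zpos (f p) end
  end.

Fixpoint pos_shr (k : nat) (p : positive) : Z :=
  match k, p with
  | O, _ => Zpos p
  | S k', xO q | S k', xI q => pos_shr k' q
  | S _, xH => Z0
  end.

(* Unlike [Z.shiftr], rounds towards zero. *)
Definition shr (k : nat) (z : Z) : Z :=
  match z with Z0 => Z0 | Zpos p => pos_shr k p | Zneg p => Z.opp (pos_shr k p) end.

Section Enclosures.
Local Open Scope Z_scope.

(* A number at scale 2^s: [mid] with error [err], together with the slopes
   [slo] with respect to the unknowns, each with error [serr]. *)
Record encl := Encl { eok : bool; mid : Z; err : Z; slo : seq Z; serr : Z }.

Fixpoint zmap2 (f : Z -> Z -> Z) (l1 l2 : seq Z) : seq Z :=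
  match l1, l2 with
  | [::], _ => map (f 0) l2
  | _, [::] => map (fun x => f x 0) l1
  | x :: l1', y :: l2' => f x y :: zmap2 f l1' l2'
  end.

Fixpoint zmaxabs (l : seq Z) : Z :=
  match l with [::] => 0 | x :: l' => Z.max (Z.abs x) (zmaxabs l') end.

Definition ezero := Encl true 0 0 [::] 0.

(** Frozen coordinates make exact zeros frequent. Recognizing them saves work on slopes and the two
    units of error that [mul_err] adds to every product. *)
Definition is_ezero x :=
  [&& eok x, mid x =? 0, err x =? 0, nilp (slo x) & serr x =? 0].

Definition eadd x y :=
  Encl (eok x && eok y) (mid x + mid y) (err x + err y)
    (zmap2 Z.add (slo x) (slo y)) (serr x + serr y).
Definition esub x y :=
  Encl (eok x && eok y) (mid x - mid y) (err x + err y)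
    (zmap2 Z.sub (slo x) (slo y)) (serr x + serr y).

Variable s : Z.

Definition mul_err m1 r1 m2 r2 :=
  Z.shiftr (Z.abs m1 * r2 + Z.abs m2 * r1 + r1 * r2) s + 2.

(** Since [zmaxabs l + q] bounds all the slopes of an operand, one error serves the whole list. If
    no operand depends on the unknowns, the slopes are exact and no rounding is charged. *)
Definition comb_serr m1 r1 (l1 : seq Z) q1 m2 r2 (l2 : seq Z) q2 :=
  let b1 := zmaxabs l1 + q1 in let b2 := zmaxabs l2 + q2 in
  if (b1 =? 0) && (b2 =? 0) then 0
  else Z.shiftr (Z.abs m1 * q1 + Z.abs m2 * q2 + r1 * b1 + r2 * b2) s + 2.

Definition emul x y :=
  if is_ezero x || is_ezero y then ezero else
  let mx := mid x in let my := mid y in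
  Encl (eok x && eok y) (Z.shiftr (mx * my) s) (mul_err mx (err x) my (err y))
    (let k := Z.to_nat s in let fx := scale mx in let fy := scale my in
     zmap2 (fun a b => shr k (fy a + fx b)) (slo x) (slo y))
    (comb_serr my (err y) (slo x) (serr x) mx (err x) (slo y) (serr y)).

Definition einv x :=
  let m := mid x in let r := err x in
  if eok x && (r <? m) then
    let im := Z.div (Z.shiftl 1 (2 * s)) m in
    let ir := Z.div ((im + 1) * r) (m - r) + 2 in
    let g := Z.shiftr (im * im) s in
    let gr := mul_err im ir im ir in
    Encl true im ir (let k := Z.to_nat s in let f := scale (- g) in map (fun a => shr k (f a)) (slo x))
      (comb_serr (- g) gr (slo x) (serr x) 0 0 [::] 0)
  else Encl false 0 0 [::] 0.

Definition efrac a b :=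
  if 0 <? b then
    let: (q, r) := Z.div_eucl (Z.shiftl a s) b in
    Encl true q (if r =? 0 then 0 else 1) [::] 0
  else Encl false 0 0 [::] 0.

Definition earith : arith encl := Arith ezero eadd esub emul einv efrac.

Definition evar (e rad : Z) (slopes : bool) (j : nat) (z : Z) : encl :=
  Encl true (Z.shiftl z e) (Z.shiftl rad e)
    (if slopes then ncons j 0 [:: Z.shiftl 1 s] else [::]) 0.

End Enclosures.

(** * Approximate inversion and the contraction test *)

Section Newton.
Local Open Scope Z_scope.

Fixpoint axpy (f : Z -> Z) (l acc : seq Z) : seq Z :=
  match l, acc with
  | [::], _ => acc
  | x :: l', [::] => f x :: axpy f l' [::]
  | x :: l', y :: acc' => f x + y :: axpy f l' acc'
  end.

Definition zdot (l1 l2 : seq Z) :=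
  foldr (fun xy acc => xy.1 * xy.2 + acc) 0 (zip l1 l2).

(* In-place Gauss-Jordan elimination in fixed-point arithmetic; the result is
   only a candidate for an approximate inverse. A row carries its index, its
   entries in the columns still to be treated, and then its entries in the
   columns of the inverse that belong to the pivot rows treated so far. *)
Definition round_shr (k : nat) (half : positive) (z : Z) : Z :=
  match z with
  | Z0 => 0
  | Zpos p => pos_shr k (Pos.add half p)
  | Zneg p => - pos_shr k (Pos.add half p)
  end.

Definition reduce_row (k : nat) half (pv : seq Z) (r : nat * seq Z) : nat * seq Z :=
  let x := head 0 r.2 in
  (r.1, if x =? 0 then rcons (behead r.2) 0
        else let f := scale (- x) in
             zmap2 (fun a b => a + round_shr k half (f b)) (behead r.2) pv).

Fixpoint pick_pivot (best : nat * seq Z) (acc rows : seq (nat * seq Z)) :=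
  match rows with
  | [::] => (best, acc)
  | r :: rows' =>
      if Z.abs (head 0 best.2) <? Z.abs (head 0 r.2) then pick_pivot r (best :: acc) rows'
      else pick_pivot best (r :: acc) rows'
  end.

Fixpoint gauss_jordan (g : Z) (k : nat) half (fuel : nat) (don rem : seq (nat * seq Z)) :=
  match fuel, rem with
  | S fuel', r :: rem' =>
      let: (pv, rest) := pick_pivot r [::] rem' in
      let inv := Z.div (Z.shiftl 1 (2 * g)) (head 0 pv.2) in
      let f := scale inv in
      let pv' := rcons (map (fun x => round_shr k half (f x)) (behead pv.2)) inv in
      gauss_jordan g k half fuel' (rcons (map (reduce_row k half pv') don) (pv.1, pv'))
        (map (reduce_row k half pv') rest)
  | _, _ => don
  end.

(** Columns are eliminated in their order, so the r-th pivot row yields row r of the inverse; its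
    entries come in the order in which pivots were chosen, and [idx] undoes that permutation. Four
    guard bits are carried along and dropped at the end. *)
Definition approx_inverse (sa tb : Z) (rows : seq (seq Z)) : seq (seq Z) :=
  let E := size rows in let k := 4%N in let g := sa + Z.of_nat k in
  let res := gauss_jordan g (Z.to_nat g) (Z.to_pos (Z.shiftl 1 (g - 1))) E [::] (mkseq (fun i =>
    (i, mkseq (fun j => Z.shiftl (nth 0 (nth [::] rows i) j) (g - tb)) E)) E) in
  let piv := map fst res in
  let idx := mkseq (fun i => index i piv) E in
  [seq [seq shr k (nth 0 r.2 i) | i <- idx] | r <- res].

(** The first inequality bounds the absolute row sums of 1 - A S by 1/2 for all slope matrices S
    compatible with the enclosures; a row error applies to each of its E entries, whence the factor
    E. The second bounds A F(center) by half the radius. Truncating slopes to [tb] bits and A to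
    [sa] bits keeps the matrix product cheap. *)
Definition newton_check (s e sa tb rad : Z) (box pt : seq encl) : bool :=
  let E := size box in
  let rows := [seq map (fun x => Z.shiftr x (s - tb)) (slo b) | b <- box] in
  let errs := [seq Z.shiftr (serr b) (s - tb) + 2 | b <- box] in
  let A := approx_inverse sa tb rows in
  let one := Z.shiftl 1 (sa + tb) in
  [&& all eok box, all eok pt &
  all (fun i =>
    let a := nth [::] A i in
    let v := foldr (fun xy acc => axpy (scale xy.1) xy.2 acc) [::] (zip a rows) in
    let aa := map Z.abs a in
    (2 * (foldr (fun j acc => Z.abs ((if i == j then one else 0) - nth 0 v j) + acc)
           (Z.of_nat E * zdot aa errs) (iota 0 E)) <=? one) &&
    (2 * (Z.abs (zdot a (map mid pt)) + zdot aa (map err pt)) <=?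
      Z.shiftl rad (sa + e)))
  (iota 0 E)].

End Newton.

Section Rational.
Local Open Scope Z_scope.
(* Exact fractions, without normalization. *)
Definition radd (x y : Z * Z) :=
  if x.2 =? y.2 then (x.1 + y.1, x.2) else (x.1 * y.2 + y.1 * x.2, x.2 * y.2).
Definition rsub (x y : Z * Z) :=
  if x.2 =? y.2 then (x.1 - y.1, x.2) else (x.1 * y.2 - y.1 * x.2, x.2 * y.2).
Definition rarith : arith (Z * Z) :=
  Arith (0, 1) radd rsub (fun x y => (x.1 * y.1, x.2 * y.2))
    (fun x => if x.1 =? 0 then (0, 1) else (x.2, x.1))
    (fun a b => if b =? 0 then (0, 1) else (a, b)).
End Rational.

(* The second coordinate of each half plane is dead. *)
Definition dead_coord (w : seq nat) (h i : nat) : bool := odd i && (size w - h <= i./2).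

Definition case_unknowns (D : case) : seq Z := filter Z.odd (entries D).

(** * The complete test of one case *)

Section Check.
Variables (m n N : nat) (D : case).
Let p := period D.
Let h := halves D.
Let t := size (weights D).
Let d := 2 * t.
Let nf := size (fixed D).
Let k := (N - nf) %/ p.
Let tg := tags p (weights D) h.

Definition dead_zero (l : seq Z) (c : nat) : bool :=
  all (fun i => dead_coord (weights D) h i ==> all (fun j => Z.eqb (nth Z0 l (j * d + i)) Z0) (iota 0 c)) (iota 0 d).

Definition shape_check : bool :=
  [&& (1 < p), N == k * p + nf, 0 < k, (n + h == d) && (h <= t), (0 < m) && (m < n),
      all (fun w => w < p) (weights D),
      all (fun w => (2 * w) %% p == 0) (drop (t - h) (weights D)),
      dead_zero (entries D) (k * m) & all (fun l => dead_zero l m) (fixed D)].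

(** These are equalities between constants, which no motion of the unknowns could repair, so they
    are decided exactly. Invariance under the rotations means that all coefficients of nonzero
    frequency vanish. *)
Definition fixed_check : bool :=
  let G := mkseq (fixed_gs rarith m D) nf in
  let Q := fixed_coefs rarith m D in
  [&& all (fun g => all (fun w => ~~ Z.eqb w.1 Z0) g.2) G,
      all (fun X => all (fun e => (tfreq (nth tag0 tg e) == 0) ||
         let x := nth ((Z0, Zpos 1), (Z0, Zpos 1)) X e in Z.eqb x.1.1 Z0 && Z.eqb x.2.1 Z0)
         (iota 0 (size tg))) Q &
      all (fun j => all (fun i => 
         Z.eqb (rsub (cos_coef rarith tg (nth [::] Q i) (nth [::] Q j) 0)
           (cross_target rarith m n N)).1 Z0) (iota 0 j)) (iota 0 nf)].

Local Open Scope Z_scope.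
(** The box measures only a few units at scale 2^s, so rounding at that scale could drown the
    residual. The center is therefore evaluated with 12 more bits, and its shift is 14 = 2 + 12. The
    bound 10 on s keeps [sa] and [tb] positive. *)
Definition system_check : bool :=
  let s := Z.of_nat (prec D) in
  let E := size (case_unknowns D) in
  let box := system (earith s) m n N D (evar s 2 (radius D) true) in
  let pt := system (earith (s + 12)) m n N D (evar (s + 12) 14 0 false) in
  [&& (E == size (case_eqs N D))%N, 10 <=? s,
      all (fun w => eok w && (err w <? mid w)) box.2 &
      newton_check s 14 (Z.min 10 (s - 4)) (Z.min 18 (s - 6)) (radius D) box.1 pt.1].
Local Close Scope Z_scope.

Definition case_check : bool := [&& shape_check, fixed_check & system_check].
End Check.

(** * Parametricity *)

Arguments gs_step : simpl never.

Section Parametricity.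
Variables (T1 T2 T3 : Type) (o1 : arith T1) (o2 : arith T2) (o3 : arith T3).
(** Three runs are related because an enclosure of secant slopes speaks of two real runs at once,
    one for each end of the secant. *)
Variable r : T1 -> T2 -> T3 -> Prop.
Hypothesis r0 : r (azero o1) (azero o2) (azero o3).
Hypothesis rD : forall a1 a2 a3 b1 b2 b3, r a1 a2 a3 -> r b1 b2 b3 ->
  r (aadd o1 a1 b1) (aadd o2 a2 b2) (aadd o3 a3 b3).
Hypothesis rB : forall a1 a2 a3 b1 b2 b3, r a1 a2 a3 -> r b1 b2 b3 ->
  r (asub o1 a1 b1) (asub o2 a2 b2) (asub o3 a3 b3).
Hypothesis rM : forall a1 a2 a3 b1 b2 b3, r a1 a2 a3 -> r b1 b2 b3 ->
  r (amul o1 a1 b1) (amul o2 a2 b2) (amul o3 a3 b3).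
Hypothesis rV : forall a1 a2 a3, r a1 a2 a3 -> r (ainv o1 a1) (ainv o2 a2) (ainv o3 a3).
Hypothesis rQ : forall a b, r (afrac o1 a b) (afrac o2 a b) (afrac o3 a b).

Definition rnth l1 l2 l3 :=
  forall i, r (nth (azero o1) l1 i) (nth (azero o2) l2 i) (nth (azero o3) l3 i).
Definition rseq l1 l2 l3 := [/\ size l1 = size l3, size l2 = size l3 & rnth l1 l2 l3].

Lemma asum_par l f1 f2 f3 : (forall i, i \in l -> r (f1 i) (f2 i) (f3 i)) ->
  r (asum o1 l f1) (asum o2 l f2) (asum o3 l f3).
Proof.
elim: l => //= x l IH H; apply: rD; first by apply: H; rewrite mem_head.
by apply: IH => i il; apply: H; rewrite inE il orbT.
Qed.

Lemma anat_par k a1 a2 a3 : r a1 a2 a3 ->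
  r (anat o1 k a1) (anat o2 k a2) (anat o3 k a3).
Proof. by move=> H; elim: k => //= k IH; apply: rD. Qed.

Lemma mkseq_par f1 f2 f3 n : (forall i, i < n -> r (f1 i) (f2 i) (f3 i)) ->
  rnth (mkseq f1 n) (mkseq f2 n) (mkseq f3 n).
Proof.
move=> H i; case: (ltnP i n) => Hi; first by rewrite !nth_mkseq //; apply: H.
by rewrite !nth_default ?size_mkseq.
Qed.

Local Notation pnil T := (@nil T, @nil T).
Definition rbasis (B1 : seq (seq T1 * seq T1)) (B2 : seq (seq T2 * seq T2))
    (B3 : seq (seq T3 * seq T3)) := forall l,
  rnth (nth (pnil _) B1 l).1 (nth (pnil _) B2 l).1 (nth (pnil _) B3 l).1 /\
  rnth (nth (pnil _) B1 l).2 (nth (pnil _) B2 l).2 (nth (pnil _) B3 l).2.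

Lemma gs_step_par d c B1 B2 B3 x1 x2 x3 : rbasis B1 B2 B3 ->
  (forall i, r (x1 i) (x2 i) (x3 i)) ->
  let g1 := gs_step o1 d c B1 x1 in let g2 := gs_step o2 d c B2 x2 in
  let g3 := gs_step o3 d c B3 x3 in
  [/\ rnth g1.1.1 g2.1.1 g3.1.1, rnth g1.1.2 g2.1.2 g3.1.2 & r g1.2 g2.2 g3.2].
Proof.
move=> HB Hx; rewrite /gs_step /=.
have Hq : rnth (gs_vec o1 d c B1 x1) (gs_vec o2 d c B2 x2) (gs_vec o3 d c B3 x3).
  apply: mkseq_par => i _; apply: rB => //; apply: asum_par => j _; apply: rM.
    apply: mkseq_par => {}i _; apply: asum_par => {}j _; apply: rM => //.
    by case: (HB i) => _; apply.
  by case: (HB j) => + _; apply.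
set w1 := ainv o1 _; set w2 := ainv o2 _; set w3 := ainv o3 _.
have Hw : r w1 w2 w3 by apply: rV; apply: asum_par => i _; apply: rM.
by split => //; apply: mkseq_par => i _; apply: rM.
Qed.

Lemma gram_schmidt_par d m x1 x2 x3 : (forall c i, r (x1 c i) (x2 c i) (x3 c i)) ->
  let g1 := gram_schmidt o1 d m x1 in let g2 := gram_schmidt o2 d m x2 in
  let g3 := gram_schmidt o3 d m x3 in
  [/\ size g1.1 = m, size g2.1 = m, size g3.1 = m, rbasis g1.1 g2.1 g3.1 &
      rseq g1.2 g2.2 g3.2].
Proof.
move=> Hx; elim: m => [|c] /=.
  by split=> //; split=> // i; rewrite !nth_nil.
case: (gram_schmidt o1 d c x1) => B1 ws1; case: (gram_schmidt o2 d c x2) => B2 ws2.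
case: (gram_schmidt o3 d c x3) => B3 ws3 /= [s1 s2 s3 HB [h1 h2 Hw]].
have [Hu Hq Hw'] := gs_step_par d c HB (Hx c).
split; rewrite ?size_rcons ?s1 ?s2 ?s3 //.
  move=> l; rewrite !nth_rcons s1 s2 s3; case: ltnP => _ //; case: eqP => _ //; by split=> i; rewrite /= !nth_nil.
by split=> /=; [rewrite h1|rewrite h2|case].
Qed.

Lemma proj_entry_par m B1 B2 B3 i j : rbasis B1 B2 B3 ->
  r (proj_entry o1 m B1 i j) (proj_entry o2 m B2 i j) (proj_entry o3 m B3 i j).
Proof.
move=> HB; apply: asum_par => l _; apply: rM; first by case: (HB l) => + _; apply.
by case: (HB l) => _; apply.
Qed.

Definition rmat P1 P2 P3 := forall i j : nat, r (P1 i j) (P2 i j) (P3 i j).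

Lemma proj_table_par d m B1 B2 B3 : rbasis B1 B2 B3 ->
  rmat (fun i j => nth (azero o1) (nth [::] (proj_table o1 d m B1) j) i)
       (fun i j => nth (azero o2) (nth [::] (proj_table o2 d m B2) j) i)
       (fun i j => nth (azero o3) (nth [::] (proj_table o3 d m B3) j) i).
Proof.
move=> HB i j; rewrite /proj_table; case: (ltnP j d) => Hj.
  by rewrite ![nth [::] _ j]nth_mkseq //; apply: mkseq_par => i' _; apply: proj_entry_par.
by rewrite ![nth [::] _ j]nth_default ?size_mkseq // !nth_nil.
Qed.

Lemma signed_par b a1 a2 a3 : r a1 a2 a3 ->
  r (signed o1 b a1) (signed o2 b a2) (signed o3 b a3).
Proof. by case: b => //= H; apply: rB. Qed.

Lemma coef_par h t P1 P2 P3 e : rmat P1 P2 P3 ->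
  r (coef o1 h t P1 e).1 (coef o2 h t P2 e).1 (coef o3 h t P3 e).1 /\
  r (coef o1 h t P1 e).2 (coef o2 h t P2 e).2 (coef o3 h t P3 e).2.
Proof.
move=> HP; rewrite /coef.
case: eqP => _; case: ltnP => _; rewrite /=; try case: (tanti e) => /=;
  split; repeat first [exact: r0 | exact: HP | apply: signed_par | apply: rD | apply: rB].
Qed.

Definition rcoefs X1 X2 X3 := forall e : nat,
  r (nth (azero o1, azero o1) X1 e).1 (nth (azero o2, azero o2) X2 e).1
    (nth (azero o3, azero o3) X3 e).1 /\
  r (nth (azero o1, azero o1) X1 e).2 (nth (azero o2, azero o2) X2 e).2
    (nth (azero o3, azero o3) X3 e).2.

Lemma coefs_of_par m D B1 B2 B3 : rbasis B1 B2 B3 ->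
  rcoefs (coefs_of o1 m D B1) (coefs_of o2 m D B2) (coefs_of o3 m D B3).
Proof.
move=> HB e; rewrite /coefs_of /coefs.
set tg := tags _ _ _; case: (ltnP e (size tg)) => He.
  rewrite !(nth_map tag0) //; apply: coef_par; exact: proj_table_par.
by rewrite !nth_default ?size_map.
Qed.

Lemma cos_coef_par tg X1 X2 X3 Y1 Y2 Y3 f : rcoefs X1 X2 X3 -> rcoefs Y1 Y2 Y3 ->
  r (cos_coef o1 tg X1 Y1 f) (cos_coef o2 tg X2 Y2 f) (cos_coef o3 tg X3 Y3 f).
Proof.
move=> HX HY; apply: asum_par => e _; apply: anat_par.
by case: (HX e) => ? ?; case: (HY e) => ? ?; apply: rD; apply: rM.
Qed.

Lemma sin_coef_par tg X1 X2 X3 Y1 Y2 Y3 f : rcoefs X1 X2 X3 -> rcoefs Y1 Y2 Y3 ->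
  r (sin_coef o1 tg X1 Y1 f) (sin_coef o2 tg X2 Y2 f) (sin_coef o3 tg X3 Y3 f).
Proof.
move=> HX HY; apply: asum_par => e _; apply: anat_par.
by case: (HX e) => ? ?; case: (HY e) => ? ?; apply: rB; apply: rM.
Qed.

Definition rfam X1 X2 X3 := forall a : nat,
  rcoefs (nth [::] X1 a) (nth [::] X2 a) (nth [::] X3 a).

Lemma eval_eqn_par m n N D X1 X2 X3 Q1 Q2 Q3 q : rfam X1 X2 X3 -> rfam Q1 Q2 Q3 ->
  r (eval_eqn o1 m n N D X1 Q1 q) (eval_eqn o2 m n N D X2 Q2 q)
    (eval_eqn o3 m n N D X3 Q3 q).
Proof.
move=> HX HQ; case: q => [a f|a b f|a b f|a j|e|e] /=.
- by apply: rB; [apply: cos_coef_par|apply: rQ].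
- case: eqP => _; last exact: cos_coef_par.
  by apply: rB; [apply: cos_coef_par|apply: rQ].
- exact: sin_coef_par.
- by apply: rB; [apply: cos_coef_par|apply: rQ].
- apply: rB; last by rewrite /sum_target; case: ifP.
  apply: rD; first by apply: asum_par => a _; case: (HX a e).
  by apply: rM; [apply: rQ|apply: asum_par => a _; case: (HQ a e)].
- apply: rD; first by apply: asum_par => a _; case: (HX a e).
  by apply: rM; [apply: rQ|apply: asum_par => a _; case: (HQ a e)].
Qed.

Lemma load_par v1 v2 v3 j zs :
  (forall i, i < size (filter Z.odd zs) -> let z := nth Z0 (filter Z.odd zs) i in
     r (v1 (j + i) z) (v2 (j + i) z) (v3 (j + i) z)) ->
  rnth (load o1 v1 j zs) (load o2 v2 j zs) (load o3 v3 j zs).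
Proof.
elim: zs j => [|z zs IH] j /= H; first by move=> i; rewrite !nth_nil.
move: H; case: ifP => Hz H.
  have H0 := H 0 isT; rewrite addn0 /= in H0.
  case=> [|i] //=; apply: IH => i' Hi'; have := H i'.+1 Hi'; by rewrite addnS -addSn.
by case=> [|i] //=; apply: IH.
Qed.

Lemma rseq_cat l1 l2 l3 m1 m2 m3 : rseq l1 l2 l3 -> rseq m1 m2 m3 ->
  rseq (l1 ++ m1) (l2 ++ m2) (l3 ++ m3).
Proof.
case=> a b H [c d H']; split; rewrite ?size_cat ?a ?b ?c ?d // => i.
by rewrite !nth_cat a b; case: ifP.
Qed.

Lemma rseq_flatten (l : seq nat) f1 f2 f3 :
  (forall i, rseq (f1 i) (f2 i) (f3 i)) ->
  rseq (flatten (map f1 l)) (flatten (map f2 l)) (flatten (map f3 l)).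
Proof.
move=> H; elim: l => [|x l IH] /=; last exact: rseq_cat.
by split=> // i; rewrite !nth_nil.
Qed.

Lemma fixed_par m D j : let g1 := fixed_gs o1 m D j in let g2 := fixed_gs o2 m D j in
  let g3 := fixed_gs o3 m D j in rbasis g1.1 g2.1 g3.1 /\ rseq g1.2 g2.2 g3.2.
Proof.
by have [] := gram_schmidt_par (2 * size (weights D)) m (fun c i => rQ (nth Z0 (nth [::] (fixed D) j) (c * (2 * size (weights D)) + i)) (Zpos 1)).
Qed.

Lemma fixed_coefs_par m D :
  rfam (fixed_coefs o1 m D) (fixed_coefs o2 m D) (fixed_coefs o3 m D).
Proof.
move=> a; rewrite /fixed_coefs; case: (ltnP a (size (fixed D))) => Ha.
  by rewrite !nth_mkseq //; apply: coefs_of_par; case: (fixed_par m D a).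
by rewrite ![nth [::] _ a]nth_default ?size_map ?size_iota // => e; rewrite !nth_nil.
Qed.

Lemma system_par m n N D v1 v2 v3 :
  (forall i, i < size (case_unknowns D) -> let z := nth Z0 (case_unknowns D) i in
     r (v1 i z) (v2 i z) (v3 i z)) ->
  rseq (system o1 m n N D v1).1 (system o2 m n N D v2).1 (system o3 m n N D v3).1 /\
  rseq (system o1 m n N D v1).2 (system o2 m n N D v2).2 (system o3 m n N D v3).2.
Proof.
move=> H; have Hl : rnth (load o1 v1 0 (entries D)) (load o2 v2 0 (entries D))
   (load o3 v3 0 (entries D)) by apply: load_par.
rewrite /system /=.
have HG a : let g1 := orbit_gs o1 m D (load o1 v1 0 (entries D)) a in
   let g2 := orbit_gs o2 m D (load o2 v2 0 (entries D)) a in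
   let g3 := orbit_gs o3 m D (load o3 v3 0 (entries D)) a in
   rbasis g1.1 g2.1 g3.1 /\ rseq g1.2 g2.2 g3.2.
  by have [] := gram_schmidt_par (2 * size (weights D)) m (fun c i => Hl (a * (m * (2 * size (weights D))) + c * (2 * size (weights D)) + i)).
have HX : rfam (orbit_coefs o1 m D (orbit_bases o1 m N D v1))
    (orbit_coefs o2 m D (orbit_bases o2 m N D v2))
    (orbit_coefs o3 m D (orbit_bases o3 m N D v3)).
  move=> a; rewrite /orbit_coefs /orbit_bases /mkseq -!map_comp.
  case: (ltnP a ((N - size (fixed D)) %/ period D)) => Ha.
    by rewrite !(nth_map 0) ?size_iota //=; apply: coefs_of_par; case: (HG (nth 0 (iota 0 ((N - size (fixed D)) %/ period D)) a)).
  by rewrite ![nth [::] _ a]nth_default ?size_map ?size_iota // => e; rewrite !nth_nil.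
split.
  split; rewrite ?size_map // => i.
  case: (ltnP i (size (case_eqs N D))) => Hi; last by rewrite !nth_default ?size_map.
  by rewrite !(nth_map (ERe 0)) //; apply: eval_eqn_par => //; apply: fixed_coefs_par.
rewrite /orbit_bases /mkseq -!map_comp; apply: rseq_flatten => i; by case: (HG i).
Qed.

End Parametricity.

(** * Soundness of the enclosures *)

Local Open Scope ring_scope.
Delimit Scope Z_scope with Z.

Lemma window_mulE q b :
  window_mul q (xO q) (Pos.add q (xO q)) (xO (xO q)) (Pos.add q (xO (xO q)))
    (xO (Pos.add q (xO q))) (Pos.add q (xO (Pos.add q (xO q)))) b = Pos.mul q b.
(* The recursion consumes three bits at a time, which the structural induction principle of
   [positive] does not provide. *)
Proof. by move: b; fix IH 1; case=> [[[p|p|]|[p|p|]|]|[[p|p|]|[p|p|]|]|] /=; rewrite ?IH; lia. Qed.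

Lemma scaleE x b : scale x b = Z.mul x b.
Proof. by case: x b => [|q|q] [|p|p] //=; rewrite window_mulE. Qed.

Lemma pos_shr_bounds k p :
  (0 <= pos_shr k p /\ pos_shr k p * 2 ^ Z.of_nat k <= Zpos p < (pos_shr k p + 1) * 2 ^ Z.of_nat k)%Z.
Proof.
elim: k p => [|k IH] p; first by case: p => [p|p|] /=; lia.
rewrite Nat2Z.inj_succ Z.pow_succ_r; last lia.
have P : (0 < 2 ^ Z.of_nat k)%Z by apply: Z.pow_pos_nonneg; lia.
move: (2 ^ Z.of_nat k)%Z P IH => X P IH.
by case: p => [p|p|]; rewrite [pos_shr _ _]/=; [have := IH p; nia|have := IH p; nia|lia].
Qed.

Lemma shr_bounds k z : (Z.abs (z - shr k z * 2 ^ Z.of_nat k) <= 2 ^ Z.of_nat k)%Z.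
Proof.
have P : (0 < 2 ^ Z.of_nat k)%Z by apply: Z.pow_pos_nonneg; lia.
have H := pos_shr_bounds k; move: (2 ^ Z.of_nat k)%Z P H => X P H.
by case: z => [|p|p]; rewrite [shr _ _]/=; [lia|have := H p; nia|have := H p; nia].
Qed.

Section ZR.
Variable R : realFieldType.
Definition zr (z : Z) : R := (int_of_Z z)%:~R.

Lemma zr0 : zr Z0 = 0. Proof. by []. Qed.
Lemma zr1 : zr (Zpos xH) = 1. Proof. by []. Qed.
Lemma zrD (a b : Z) : zr (Z.add a b) = zr a + zr b.
Proof. by rewrite /zr -intrD; congr (_%:~R); lia. Qed.
Lemma zrN a : zr (Z.opp a) = - zr a.
Proof. by rewrite /zr -intrN; congr (_%:~R); lia. Qed.
Lemma zrB (a b : Z) : zr (Z.sub a b) = zr a - zr b.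
Proof. by rewrite /zr -[RHS]intrB; congr (_%:~R); lia. Qed.
Lemma zrM (a b : Z) : zr (Z.mul a b) = zr a * zr b.
Proof. by rewrite /zr -intrM; congr (_%:~R); lia. Qed.
Lemma zr_le (a b : Z) : (zr a <= zr b) = (a <=? b)%Z.
Proof. by rewrite /zr ler_int; lia. Qed.
Lemma zr_lt (a b : Z) : (zr a < zr b) = (a <? b)%Z.
Proof. by rewrite /zr ltr_int; lia. Qed.
Lemma zr_eq0 a : (zr a == 0) = (a =? 0)%Z.
Proof. by rewrite /zr intr_eq0; lia. Qed.
Lemma zr_abs a : zr (Z.abs a) = `|zr a|.
Proof. by rewrite /zr -intr_norm; congr (_%:~R); lia. Qed.
Lemma zr_nat k : zr (Z.of_nat k) = k%:R.
Proof. by rewrite /zr -[k%:R]/((k : int)%:~R); congr (_%:~R); lia. Qed.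

Lemma zr_div a b : (0 < b)%Z ->
  zr (Z.div a b) * zr b <= zr a < zr (Z.div a b) * zr b + zr b.
Proof.
move=> b0; rewrite -zrM -zrD zr_le zr_lt.
have [h1 h2] := Z.mod_pos_bound a b b0.
have h3 : a = (b * (a / b) + a mod b)%Z by apply: Z.div_mod; lia.
by lia.
Qed.

Definition unit_at (s : Z) : R := zr (Z.pow 2 s).

Lemma unit_atD a b : (0 <=? a)%Z -> (0 <=? b)%Z ->
  unit_at (a + b)%Z = unit_at a * unit_at b.
Proof. by move=> ha hb; rewrite /unit_at Z.pow_add_r ?zrM //; lia. Qed.

Variable s : Z.
Hypothesis s_ge0 : (0 <=? s)%Z.
Local Notation U := (unit_at s).

Lemma unit_at_gt0 : 0 < U.
Proof. by rewrite -zr0 zr_lt; apply/Z.ltb_lt; apply: Z.pow_pos_nonneg; lia. Qed.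

Lemma zr_shiftl a : zr (Z.shiftl a s) = zr a * U.
Proof. by rewrite Z.shiftl_mul_pow2 ?zrM //; lia. Qed.

Lemma zr_shiftr a : zr (Z.shiftr a s) * U <= zr a < zr (Z.shiftr a s) * U + U.
Proof.
rewrite Z.shiftr_div_pow2; last lia.
have P : (0 < 2 ^ s)%Z by apply: Z.pow_pos_nonneg; lia.
by have := zr_div a P.
Qed.

Lemma shiftr_near v : `|zr v - zr (Z.shiftr v s) * U| <= U.
Proof. by have /andP[a1 a2] := zr_shiftr v; have U0 := unit_at_gt0; rewrite ler_norml; apply/andP; split; lra. Qed.

Lemma shr_near v : `|zr v - zr (shr (Z.to_nat s) v) * U| <= U.
Proof.
rewrite /unit_at -zrM -zrB -zr_abs zr_le; have := @shr_bounds (Z.to_nat s) v.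
by rewrite Z2Nat.id; lia.
Qed.

(** An error K at scale U * U is K / U at scale U. Of the two extra units, one pays for the floor of
    this quotient and one for rounding v. *)
Lemma round_close (x : R) v q K : `|x * U - zr v| <= zr K -> `|zr v - zr q * U| <= U ->
  `|x - zr q| <= zr (Z.shiftr K s + 2)%Z.
Proof.
move=> H H'; have U0 := unit_at_gt0; have /andP[b1 b2] := zr_shiftr K.
rewrite -(ler_pM2r U0) -{1}(gtr0_norm U0) -normrM zrD.
rewrite (_ : zr 2%Z = 1 + 1); last by rewrite -zr1 -zrD.
move: H H'; rewrite !ler_norml => /andP[c1 c2] /andP[d1 d2]; apply/andP; split; lra.
Qed.

Definition close (a : R) m r := `|a * U - zr m| <= zr r.

Lemma close_mul a m1 r1 b m2 r2 : close a m1 r1 -> close b m2 r2 ->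
  close (a * b) (Z.shiftr (m1 * m2) s) (mul_err s m1 r1 m2 r2).
Proof.
rewrite /close => Ha Hb; apply: round_close (shiftr_near _).
rewrite !zrD !zrM !zr_abs.
set e1 := a * U - zr m1 in Ha; set e2 := b * U - zr m2 in Hb.
have -> : a * b * U * U - zr m1 * zr m2 = zr m1 * e2 + zr m2 * e1 + e1 * e2.
  by rewrite /e1 /e2; ring.
apply: le_trans (ler_normD _ _) _; apply: lerD; last by rewrite normrM ler_pM.
by apply: le_trans (ler_normD _ _) _; apply: lerD; rewrite normrM ler_wpM2l.
Qed.

Lemma zmaxabs_ge l j : `|zr (nth Z0 l j)| <= zr (zmaxabs l).
Proof.
rewrite -zr_abs zr_le; elim: l j => [|x l IH] [|j] //=; first lia.
by have := IH j; lia.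
Qed.

(** The slope of a product: a, b are values and x, y slopes. Each term splits as a x U U - m1 u = m1
    (x U - u) + (a U - m1) (x U), where x U is bounded through the largest slope. *)
Lemma close_comb a m1 r1 b m2 r2 x l1 q1 y l2 q2 j :
  close a m1 r1 -> close b m2 r2 ->
  close x (nth Z0 l1 j) q1 -> close y (nth Z0 l2 j) q2 ->
  close (a * x + b * y)
    (shr (Z.to_nat s) (m1 * nth Z0 l1 j + m2 * nth Z0 l2 j))
    (comb_serr s m1 r1 l1 q1 m2 r2 l2 q2).
Proof.
rewrite /close => Ha Hb Hx Hy.
set u := nth Z0 l1 j in Hx *; set v := nth Z0 l2 j in Hy *.
have Mu : `|zr u| <= zr (zmaxabs l1) by apply: zmaxabs_ge.
have Mv : `|zr v| <= zr (zmaxabs l2) by apply: zmaxabs_ge.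
have B1 : `|x * U| <= zr (zmaxabs l1 + q1)%Z.
  rewrite zrD; have -> : x * U = zr u + (x * U - zr u) by ring.
  by apply: le_trans (ler_normD _ _) _; apply: lerD.
have B2 : `|y * U| <= zr (zmaxabs l2 + q2)%Z.
  rewrite zrD; have -> : y * U = zr v + (y * U - zr v) by ring.
  by apply: le_trans (ler_normD _ _) _; apply: lerD.
(* Zero bounds force the slopes themselves to be 0, so that the result is exact. *)
rewrite /comb_serr; case: ifP => [/andP[]|_].
  rewrite -!zr_eq0 !zrD => /eqP z1 /eqP z2.
  have U0 := unit_at_gt0.
  have q1p := le_trans (normr_ge0 _) Hx; have q2p := le_trans (normr_ge0 _) Hy.
  have M1p := le_trans (normr_ge0 _) Mu; have M2p := le_trans (normr_ge0 _) Mv.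
  have u0 : u = Z0.
    by apply/Z.eqb_eq; rewrite -zr_eq0 -normr_eq0 eq_le normr_ge0 andbT; lra.
  have v0 : v = Z0.
    by apply/Z.eqb_eq; rewrite -zr_eq0 -normr_eq0 eq_le normr_ge0 andbT; lra.
  move: B1 B2; rewrite !zrD z1 z2 !normr_le0 !mulf_eq0 (gt_eqF U0) !orbF.
  move=> /eqP -> /eqP ->; rewrite u0 v0 !Z.mul_0_r Z.add_0_r /=.
  by rewrite !mulr0 addr0 mul0r zr0 subrr.
apply: round_close (shr_near _); rewrite zrD !zrM.
have -> : (a * x + b * y) * U * U - (zr m1 * zr u + zr m2 * zr v) =
  (zr m1 * (x * U - zr u) + zr m2 * (y * U - zr v)) +
  (a * U - zr m1) * (x * U) + (b * U - zr m2) * (y * U) by ring.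
rewrite !(zrD (Z.add _ _)) !zrM (zrD (Z.mul _ _)) !zrM !zr_abs.
apply: le_trans (ler_normD _ _) _; apply: lerD; last by rewrite normrM ler_pM.
apply: le_trans (ler_normD _ _) _; apply: lerD; last by rewrite normrM ler_pM.
by apply: le_trans (ler_normD _ _) _; apply: lerD; rewrite normrM ler_wpM2l.
Qed.

Definition arithR : arith R :=
  Arith 0 +%R (fun a b => a - b) *%R GRing.inv (fun a b => zr a / zr b).

Variables (E : nat) (x y : nat -> R).

(* The slopes are those of the secant from [y] to [x]. *)
Definition encloses (a b : R) (v : encl) := eok v ->
  [/\ close a (mid v) (err v), close b (mid v) (err v) &
   exists2 sg : nat -> R, a - b = \sum_(j < E) sg j * (x j - y j) &
     forall j, (j < E)%N -> close (sg j) (nth Z0 (slo v) j) (serr v)].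

Lemma nth_zmap2 f l1 l2 j : f Z0 Z0 = Z0 ->
  nth Z0 (zmap2 f l1 l2) j = f (nth Z0 l1 j) (nth Z0 l2 j).
Proof.
move=> f0; elim: l1 l2 j => [|u l1 IH] [|v l2] [|j] //=; rewrite ?nth_nil //.
- by case: (ltnP j (size l2)) => H; [rewrite (nth_map Z0)|rewrite !nth_default ?size_map].
- by case: (ltnP j (size l1)) => H; [rewrite (nth_map Z0)|rewrite !nth_default ?size_map].
Qed.

Lemma encloses0 : encloses 0 0 ezero.
Proof.
move=> _; split; rewrite /close /= ?mul0r ?zr0 ?subrr ?normr0 //.
exists (fun=> 0); first by rewrite ?subrr big1 // => j _; rewrite mul0r.
by move=> j _; rewrite /close nth_nil mul0r zr0 subrr normr0.
Qed.

Lemma closeD a m r b m' r' : close a m r -> close b m' r' ->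
  close (a + b) (m + m')%Z (r + r')%Z.
Proof.
rewrite /close !zrD => Ha Hb.
have -> : (a + b) * U - (zr m + zr m') = (a * U - zr m) + (b * U - zr m') by ring.
by apply: le_trans (ler_normD _ _) _; apply: lerD.
Qed.

Lemma closeB a m r b m' r' : close a m r -> close b m' r' ->
  close (a - b) (m - m')%Z (r + r')%Z.
Proof.
rewrite /close zrD zrB => Ha Hb.
have -> : (a - b) * U - (zr m - zr m') = (a * U - zr m) - (b * U - zr m') by ring.
by apply: le_trans (ler_normB _ _) _; apply: lerD.
Qed.

Lemma enclosesD a1 a2 v b1 b2 w : encloses a1 a2 v -> encloses b1 b2 w ->
  encloses (a1 + b1) (a2 + b2) (eadd v w).
Proof.
move=> Ha Hb /= /andP[/Ha[c1 c2 [sg h1 h2]] /Hb[d1 d2 [tau k1 k2]]].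
split; [exact: closeD|exact: closeD|exists (fun j => sg j + tau j)].
  rewrite opprD addrACA h1 k1 -big_split; apply: eq_bigr => j _ /=; ring.
by move=> j Hj; rewrite nth_zmap2 //; apply: closeD; [apply: h2|apply: k2].
Qed.

Lemma enclosesB a1 a2 v b1 b2 w : encloses a1 a2 v -> encloses b1 b2 w ->
  encloses (a1 - b1) (a2 - b2) (esub v w).
Proof.
move=> Ha Hb /= /andP[/Ha[c1 c2 [sg h1 h2]] /Hb[d1 d2 [tau k1 k2]]].
split; [exact: closeB|exact: closeB|exists (fun j => sg j - tau j)].
  rewrite (_ : a1 - b1 - (a2 - b2) = a1 - a2 - (b1 - b2)); last by ring.
  by rewrite h1 k1 -sumrB; apply: eq_bigr => j _ /=; ring.
by move=> j Hj; rewrite nth_zmap2 //; apply: closeB; [apply: h2|apply: k2].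
Qed.

Lemma is_ezeroP a b v : is_ezero v -> encloses a b v -> a = 0 /\ b = 0.
Proof.
case/and5P => ok /Z.eqb_eq m0 /Z.eqb_eq e0 _ _ /(_ ok) [].
rewrite /close m0 e0 !subr0 !normr_le0 !mulf_eq0 !(gt_eqF unit_at_gt0) !orbF.
by move=> /eqP -> /eqP ->.
Qed.

Lemma enclosesM a1 a2 v b1 b2 w : encloses a1 a2 v -> encloses b1 b2 w ->
  encloses (a1 * b1) (a2 * b2) (emul s v w).
Proof.
rewrite /emul => Ha Hb; case: ifP => [/orP[/is_ezeroP|/is_ezeroP]|_].
- by case/(_ _ _ Ha) => -> ->; rewrite !mul0r; apply: encloses0.
- by case/(_ _ _ Hb) => -> ->; rewrite !mulr0; apply: encloses0.
move=> /= /andP[/Ha[c1 c2 [sg h1 h2]] /Hb[d1 d2 [tau k1 k2]]].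
(* The Leibniz rule for secants takes one factor at each end: b at the second point, a at the first.
   Both are enclosed by the same midpoints. *)
split; [exact: close_mul|exact: close_mul|exists (fun j => b2 * sg j + a1 * tau j)].
  rewrite (_ : a1 * b1 - a2 * b2 = b2 * (a1 - a2) + a1 * (b1 - b2)); last by ring.
  rewrite h1 k1 !big_distrr -big_split; apply: eq_bigr => j _ /=; ring.
move=> j Hj; rewrite nth_zmap2; last by rewrite !scaleE !Z.mul_0_r.
by rewrite !scaleE; apply: close_comb => //; [apply: h2|apply: k2].
Qed.

Lemma shiftl_double : zr (Z.shiftl 1 (2 * s)) = U * U.
Proof.
rewrite -unit_atD // Z.shiftl_mul_pow2 ?Z.mul_1_l; last lia.
by rewrite Z.add_diag.
Qed.

(** Multiplied by a U, the error of the inverse becomes (U U - im m) - im (a U - m), which is at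
    most m + im r. Dividing by a U >= m - r gives the bound. *)
Lemma close_inv a m r : (r <? m)%Z -> close a m r ->
  let im := Z.div (Z.shiftl 1 (2 * s)) m in
  a != 0 /\ close a^-1 im (Z.div ((im + 1) * r) (m - r) + 2)%Z.
Proof.
move=> rm Ha im; have U0 := unit_at_gt0.
have r0 : 0 <= zr r := le_trans (normr_ge0 _) Ha.
have rm' : zr r < zr m by rewrite zr_lt.
have m0 : 0 < zr m by lra.
move: (Ha); rewrite /close ler_norml => /andP[h1 h2].
have aU : 0 < a * U by lra.
have a0 : 0 < a by rewrite -(pmulr_lgt0 _ U0).
split; first by rewrite gt_eqF.
have mz : (0 < m)%Z by move: m0; rewrite -zr0 zr_lt; lia.
have UU : zr (Z.shiftl 1 (2 * s)) = U * U.
  exact: shiftl_double.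
have /andP[i1 i2] : zr im * zr m <= U * U < zr im * zr m + zr m.
  by rewrite -UU; apply: zr_div.
set ir := Z.div _ _.
have mr : (0 < m - r)%Z by apply/Z.lt_0_sub/Z.ltb_lt.
have /andP[_] := zr_div ((im + 1) * r) mr; rewrite -/ir zrM zrD zrB zr1 => j2.
rewrite /close zrD (_ : zr 2%Z = 1 + 1); last by rewrite -zr1 -zrD.
have aU' : zr m - zr r <= a * U by lra.
have im0 : 0 <= zr im.
  rewrite -zr0 zr_le; apply/Z.leb_le/Z.div_pos => //.
  by apply/Z.shiftl_nonneg.
have k1 : `|a^-1 * U - zr im| * (a * U) <= zr im * zr r + zr m.
  rewrite -[X in _ * X <= _](gtr0_norm aU) -normrM.
  have -> : (a^-1 * U - zr im) * (a * U) = (U * U - zr im * zr m) - zr im * (a * U - zr m).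
    by field; rewrite gt_eqF.
  apply: le_trans (ler_normB _ _) _; rewrite addrC; apply: lerD; last first.
    by rewrite ger0_norm; lra.
  by rewrite normrM (ger0_norm im0) ler_wpM2l.
rewrite -(ler_pM2r aU); apply: le_trans k1 _.
have irp : 0 <= zr ir.
  rewrite -zr0 zr_le; apply/Z.leb_le/Z.div_pos => //.
  move: im0 r0; rewrite -zr0 !zr_le => /Z.leb_le im0 /Z.leb_le r0.
  by apply: Z.mul_nonneg_nonneg => //; apply: Z.add_nonneg_nonneg.
have k2 : (zr ir + 1) * (zr m - zr r) <= (zr ir + 1) * (a * U).
  by rewrite ler_wpM2l //; lra.
by lra.
Qed.

Lemma enclosesV a b v : encloses a b v -> encloses a^-1 b^-1 (einv s v).
Proof.
rewrite /einv => H; case: ifP => // /andP[/H[c1 c2 [sg h1 h2]] rm] _ /=.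
have [a0 ia] := close_inv rm c1; have [b0 ib] := close_inv rm c2.
(* The secant slope of the inverse is -1 / (a b). The summand [0 * 0] gives it the shape of
   [close_comb] with an empty second list. *)
split => //; exists (fun j => - (a^-1 * b^-1) * sg j + 0 * 0).
  rewrite (_ : a^-1 - b^-1 = - (a^-1 * b^-1) * (a - b)); last by field; rewrite a0 b0.
  by rewrite h1 big_distrr; apply: eq_bigr => j _ /=; ring.
move=> j Hj.
set im := Z.div _ _ in ia ib *; set ir := (Z.add (Z.div _ _) _) in ia ib *.
set g := Z.shiftr (im * im) s.
have Hg : close (- (a^-1 * b^-1)) (- g) (mul_err s im ir im ir).
  have := close_mul ia ib; rewrite /close zrN -/g.
  have -> : - (a^-1 * b^-1) * U - - zr g = - (a^-1 * b^-1 * U - zr g) by ring.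
  by rewrite normrN.
have Z0c : close 0 Z0 Z0 by rewrite /close mul0r zr0 subrr normr0.
have := close_comb (j := j) (l2 := [::]) (q2 := Z0) (y := 0) Hg Z0c (h2 j Hj).
rewrite nth_nil => /(_ Z0c); rewrite Z.mul_0_r Z.add_0_r.
case: (ltnP j (size (slo v))) => Hs; first by rewrite (nth_map Z0) // scaleE.
by rewrite !(nth_default Z0) ?size_map // Z.mul_0_r.
Qed.

Lemma encloses_frac p q : encloses (zr p / zr q) (zr p / zr q) (efrac s p q).
Proof.
rewrite /efrac; case: ifP => // q0; case E' : (Z.div_eucl _ _) => [u v] _ /=.
have q0' : (0 < q)%Z by lia.
have H : close (zr p / zr q) u (if (v =? 0)%Z then Z0 else 1%Z).
  have := Z_div_mod (Z.shiftl p s) q (Z.lt_gt _ _ q0'); rewrite E' => -[e1 e2].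
  have Q : 0 < zr q by rewrite -zr0 zr_lt.
  have -> : zr p / zr q = (zr q * zr u + zr v) / (zr q * U).
    rewrite -zrM -zrD -e1 zr_shiftl; field.
    by rewrite !gt_eqF // unit_at_gt0.
  rewrite /close -(ler_pM2r Q) -[X in _ * X <= _](gtr0_norm Q) -normrM.
  have -> : ((zr q * zr u + zr v) / (zr q * U) * U - zr u) * zr q = zr v.
    by field; rewrite !gt_eqF // unit_at_gt0.
  rewrite -zr_abs -zrM zr_le; case: ifP; lia.
split=> //; exists (fun=> 0); first by rewrite subrr big1 // => j _; rewrite mul0r.
by move=> j _; rewrite /close nth_nil mul0r zr0 subrr normr0.
Qed.
End ZR.

(** * The Newton-Kantorovich argument *)

Section NewtonKantorovich.
Variables (R : realType) (E : nat).
Implicit Types (x y v : 'cV[R]_E) (M : 'M[R]_E).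

Lemma mulmx_le M v (a b : R) : (forall i, \sum_j `|M i j| <= a) ->
  (forall j, `|v j 0| <= b) -> forall i, `|(M *m v) i 0| <= a * b.
Proof.
move=> HM Hv i; rewrite mxE; apply: le_trans (ler_norm_sum _ _ _) _.
have b0 : 0 <= b := le_trans (normr_ge0 _) (Hv i).
apply: (@le_trans _ _ (\sum_j `|M i j| * b)).
  by apply: ler_sum => j _; rewrite normrM ler_wpM2l.
by rewrite -mulr_suml ler_wpM2r.
Qed.

Lemma half_pow_le (a b : R) : (forall k, `|a| <= b / 2 ^+ k) -> a = 0.
Proof.
move=> H; apply/eqP; rewrite -normr_le0 leNgt; apply/negP => a0.
have b0 : 0 <= b by have := le_trans (normr_ge0 _) (H 0%N); rewrite expr0 divr1.
have [k _ Hk] : exists2 k : nat, true & b / `|a| < k%:R.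
  exists (Num.Def.archi_bound (b / `|a|)) => //.
  by apply: archi_boundP; rewrite divr_ge0.
have := H k; rewrite ler_pdivlMr ?exprn_gt0 // leNgt => /negP; apply.
rewrite ltr_pdivrMr // in Hk; apply: lt_le_trans Hk _.
rewrite mulrC ler_wpM2l // -natrX ler_nat; exact/ltnW/ltn_expl.
Qed.

(** A vector u in the kernel of M satisfies u = (1 - M) u, so any bound on its entries can be halved
    indefinitely. *)
Lemma near_identity_unit M : (forall i, \sum_j `|(1%:M - M) i j| <= 2^-1) -> M \in unitmx.
Proof.
move=> H; rewrite -unitmx_tr -row_free_unit; apply/inj_row_free => u Hu.
have {}Hu : M *m u^T = 0 by rewrite -[M]trmxK -trmx_mul Hu trmx0.
have Hfix : u^T = (1%:M - M) *m u^T by rewrite mulmxBl mul1mx Hu subr0.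
have step (b : R) : (forall j, `|u^T j 0| <= b) -> forall j, `|u^T j 0| <= b / 2.
  by move=> Hb j; rewrite Hfix mulrC; apply: mulmx_le.
have bnd k : forall j, `|u^T j 0| <= (\sum_i `|u^T i 0|) / 2 ^+ k.
  elim: k => [|k IH] j; last by rewrite exprSr invfM mulrA; apply: step.
  by rewrite expr0 divr1 (bigD1 j) //= lerDl sumr_ge0.
apply/rowP => j; rewrite mxE; have := @half_pow_le (u^T j 0) _ (fun k => bnd k j).
by rewrite mxE.
Qed.

Variables (F : 'cV[R]_E -> 'cV[R]_E) (A : 'M[R]_E) (x0 : 'cV[R]_E) (rho : R).
Definition in_box x := forall i, `|x i 0 - x0 i 0| <= rho.

Hypothesis rho0 : 0 <= rho.
Hypothesis slope : forall x y, in_box x -> in_box y -> exists2 S,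
  F x - F y = S *m (x - y) & forall i, \sum_j `|(1%:M - A *m S) i j| <= 2^-1.
Hypothesis resid : forall i, `|(A *m F x0) i 0| <= rho / 2.

Let T x := x - A *m F x.

Lemma T_contract x y (b : R) : in_box x -> in_box y ->
  (forall i, `|(x - y) i 0| <= b) -> forall i, `|(T x - T y) i 0| <= b / 2.
Proof.
move=> Hx Hy Hb i; have [S HS HA] := slope Hx Hy.
have -> : T x - T y = (1%:M - A *m S) *m (x - y).
  rewrite mulmxBl mul1mx -mulmxA -HS mulmxBr /T; apply/matrixP => k l.
  by rewrite !mxE; ring.
by rewrite mulrC; apply: mulmx_le.
Qed.

Let xs k := iter k T x0.

(** The quantity rho - rho / 2^k is the sum of the bounds on the first k steps. The iterates thus
    stay in the box, outside of which nothing is known about slopes. *)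
Lemma xs_box k :
  (forall i, `|(xs k - x0) i 0| <= rho - rho / 2 ^+ k) /\
  forall i, `|(xs k.+1 - xs k) i 0| <= rho / 2 ^+ k.+1.
Proof.
have p0 j : 0 <= rho / 2 ^+ j by rewrite divr_ge0 ?exprn_ge0.
have half j : rho / 2 ^+ j.+1 = rho / 2 ^+ j / 2 by rewrite exprSr invfM mulrA.
have box j : (forall i, `|(xs j - x0) i 0| <= rho - rho / 2 ^+ j) -> in_box (xs j).
  by move=> H i; have := H i; rewrite mxE [X in _ + X]mxE; have := p0 j; lra.
elim: k => [|k [IH1 IH2]].
  split=> i; first by rewrite subrr mxE normr0 expr0 divr1 subrr.
  rewrite (_ : xs 1 - xs 0 = - (A *m F x0)); last by rewrite /xs /= /T addrC addKr.
  by rewrite mxE normrN expr1.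
have H1 i : `|(xs k.+1 - x0) i 0| <= rho - rho / 2 ^+ k.+1.
  have -> : xs k.+1 - x0 = (xs k.+1 - xs k) + (xs k - x0) by rewrite addrA subrK.
  rewrite mxE; apply: le_trans (ler_normD _ _) _.
  have := IH1 i; have := IH2 i; rewrite half; lra.
split=> // i; rewrite half.
by apply: (@T_contract (xs k.+1) (xs k)) => //; apply: box.
Qed.

(** The intervals of radius rho / 2^k around the iterates are nested, and the supremum of their left
    ends belongs to all of them. *)
Definition limit i := sup [set xs k i 0 - rho / 2 ^+ k | k in [set: nat]]%classic.

Lemma limit_near k i : `|xs k i 0 - limit i| <= rho / 2 ^+ k.
Proof.
have p0 j : 0 <= rho / 2 ^+ j by rewrite divr_ge0 ?exprn_ge0.
have half j : rho / 2 ^+ j.+1 = rho / 2 ^+ j / 2 by rewrite exprSr invfM mulrA.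
pose lo j := xs j i 0 - rho / 2 ^+ j; pose up j := xs j i 0 + rho / 2 ^+ j.
have st j : lo j <= lo j.+1 /\ up j.+1 <= up j.
  case: (xs_box j) => _ /(_ i); rewrite mxE [X in _ + X]mxE ler_norml half /lo /up half.
  by move=> /andP[]; have := p0 j; split; lra.
have mlo j l : lo j <= lo (j + l)%N.
  by elim: l => [|l IH]; rewrite ?addn0 // addnS (le_trans IH) //; case: (st (j + l)%N).
have mup j l : up (j + l)%N <= up j.
  by elim: l => [|l IH]; rewrite ?addn0 // addnS (le_trans _ IH) //; case: (st (j + l)%N).
have lu j l : lo j <= up l.
  have /orP[h|h] := leq_total j l.
    rewrite -(subnKC h); apply: le_trans (mlo j (l - j)%N) _.
    by rewrite /lo /up; have := p0 (j + (l - j))%N; lra.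
  rewrite -(subnKC h); apply: le_trans _ (mup l (j - l)%N).
  by rewrite /lo /up; have := p0 (l + (j - l))%N; lra.
have ub j : ubound [set lo k | k in [set: nat]]%classic (up j).
  by move=> _ [l _ <-]; apply: lu.
have L1 : lo k <= limit i.
  by apply: ub_le_sup; [exists (up 0%N); apply: ub|exists k].
have L2 : limit i <= up k by apply: ge_sup => //; exists (lo 0%N); exists 0%N.
by move: L1 L2; rewrite /lo /up ler_norml; lra.
Qed.

Theorem newton_kantorovich : exists2 x, in_box x & F x = 0.
Proof.
have p0 j : 0 <= rho / 2 ^+ j by rewrite divr_ge0 ?exprn_ge0.
have half j : rho / 2 ^+ j.+1 = rho / 2 ^+ j / 2 by rewrite exprSr invfM mulrA.
pose x := \col_i limit i.
have xE k i : `|(x - xs k) i 0| <= rho / 2 ^+ k by rewrite !mxE distrC limit_near.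
have xb : in_box x by move=> i; have := xE 0%N i; rewrite !mxE expr0 divr1.
have xsb k : in_box (xs k).
  by move=> i; case: (xs_box k) => /(_ i) + _; rewrite mxE [X in _ + X]mxE; have := p0 k; lra.
exists x => //.
have Tx : T x - x = 0.
  apply/colP => i; rewrite [RHS]mxE; apply: (@half_pow_le _ (2 * rho)) => k.
  have -> : T x - x = (T x - T (xs k)) + (xs k.+1 - x) by rewrite addrA subrK.
  rewrite mxE; apply: le_trans (ler_normD _ _) _.
  have := T_contract xb (xsb k) (xE k) i.
  have := xE k.+1 i; rewrite half -[x - xs k.+1]opprB [X in `|X| <= _ -> _]mxE normrN => a b.
  have -> : 2 * rho / 2 ^+ k = rho / 2 ^+ k + rho / 2 ^+ k by ring.
  by have := p0 k; lra.
(* The degenerate secant from x to x still yields a matrix S with A S close to 1. Hence A is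
   invertible, and a fixed point of T is a zero of F itself. *)
have [S _ HS] := slope xb xb.
have := near_identity_unit HS; rewrite unitmx_mul => /andP[Au _].
have AF : A *m F x = 0.
  by move: Tx; rewrite /T addrAC subrr add0r => /eqP; rewrite oppr_eq0 => /eqP.
by rewrite -[F x](mulKmx Au) AF mulmx0.
Qed.
End NewtonKantorovich.

(** * Soundness of the Newton check *)

Section Solve.
Variable R : realType.
Local Notation zr := (zr R).
Local Notation unit_at := (unit_at R).
Local Notation arithR := (arithR R).

Lemma zr_zdot l1 l2 k : size l2 = k ->
  zr (zdot l1 l2) = \sum_(e < k) zr (nth Z0 l1 e) * zr (nth Z0 l2 e).
Proof.
rewrite /zdot; elim: l2 l1 k => [|y l2 IH] l1 [|k] //=.
  by rewrite big_ord0; case: l1.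
case=> Hk; rewrite big_ord_recl; case: l1 => [|x l1] /=.
  by rewrite big1 => [|e _]; rewrite ?nth_nil ?zr0 mul0r ?addr0.
by rewrite zrD zrM (IH _ _ Hk).
Qed.

Lemma nth_axpy a l acc j : nth Z0 (axpy (scale a) l acc) j = (a * nth Z0 l j + nth Z0 acc j)%Z.
Proof.
elim: l acc j => [|x l IH] [|y acc] [|j] //=; rewrite ?scaleE ?IH ?nth_nil //; lia.
Qed.

Lemma zr_nth_comb a (rows : seq (seq Z)) k j : size rows = k ->
  zr (nth Z0 (foldr (fun xy acc => axpy (scale xy.1) xy.2 acc) [::] (zip a rows)) j) =
  \sum_(e < k) zr (nth Z0 a e) * zr (nth Z0 (nth [::] rows e) j).
Proof.
elim: rows a k => [|y rows IH] a [|k] //=.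
  by rewrite big_ord0; case: a => *; rewrite nth_nil.
case=> Hk; rewrite big_ord_recl; case: a => [|x a] /=.
  by rewrite nth_nil big1 => [|e _]; rewrite ?nth_nil ?zr0 mul0r ?addr0.
by rewrite nth_axpy zrD zrM (IH _ _ Hk).
Qed.

Lemma zr_foldr_sum (f : nat -> Z) z0 l :
  zr (foldr (fun j acc => (f j + acc)%Z) z0 l) = \sum_(j <- l) zr (f j) + zr z0.
Proof. by elim: l => [|x l IH] /=; rewrite ?big_nil ?add0r // zrD IH big_cons addrA. Qed.

Variables (m n N : nat) (D : case).
Hypothesis chk : system_check m n N D.
Let s := Z.of_nat (prec D).
Let E := size (case_unknowns D).
Let box := system (earith s) m n N D (evar s 2 (radius D) true).
Let pt := system (earith (s + 12)) m n N D (evar (s + 12) 14 0 false).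
Let U := unit_at s.

Let z j := nth Z0 (case_unknowns D) j.
Definition cvn (v : 'cV[R]_E) (j : nat) : R := oapp (fun i => v i 0) 0 (insub j).
Lemma cvnE v (i : 'I_E) : cvn v i = v i 0.
Proof. by rewrite /cvn valK. Qed.

Definition sysR (v : 'cV[R]_E) := system arithR m n N D (fun j _ => cvn v j).
Definition Fsys v : 'cV[R]_E := \col_i nth 0 (sysR v).1 i.
Definition x0 : 'cV[R]_E := \col_i (zr (Z.shiftl (z i) 2) / U).
Definition rho : R := zr (Z.shiftl (radius D) 2) / U.

Lemma s_big : (10 <=? s)%Z.
Proof. by case/and4P: chk. Qed.
Lemma s_ge0 : (0 <=? s)%Z. Proof. by have := s_big; lia. Qed.
Lemma s12_ge0 : (0 <=? s + 12)%Z. Proof. by have := s_big; lia. Qed.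

Lemma U_gt0 : 0 < U. Proof. exact: unit_at_gt0 s_ge0. Qed.

Lemma sizeE : E = size (case_eqs N D).
Proof. by case/and4P: chk => /eqP. Qed.

Lemma size_box : size box.1 = E. Proof. by rewrite sizeE size_map. Qed.
Lemma size_pt : size pt.1 = E. Proof. by rewrite sizeE size_map. Qed.

Lemma box_encl x y : in_box x0 rho x -> in_box x0 rho y ->
  rseq arithR arithR (earith s) (encloses s E (cvn x) (cvn y)) (sysR x).1 (sysR y).1 box.1 /\
  rseq arithR arithR (earith s) (encloses s E (cvn x) (cvn y)) (sysR x).2 (sysR y).2 box.2.
Proof.
move=> Hx Hy.
apply: system_par.
- exact: encloses0.
- by move=> *; apply: enclosesD.
- by move=> *; apply: enclosesB.
- by move=> *; apply: (enclosesM s_ge0).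
- by move=> *; apply: (enclosesV s_ge0).
- by move=> *; apply: (encloses_frac s_ge0).
move=> i Hi /= _; rewrite -/(z i).
have U0 := U_gt0.
have cl v : in_box x0 rho v -> close s (cvn v i) (Z.shiftl (z i) 2) (Z.shiftl (radius D) 2).
  move=> /(_ (Ordinal Hi)); rewrite mxE -cvnE /= /rho /close -/U.
  rewrite -(ler_pM2r U0) divfK ?gt_eqF // -[X in _ * X <= _](gtr0_norm U0) -normrM.
  by rewrite mulrBl divfK ?gt_eqF.
split; [exact: cl|exact: cl|].
exists (fun j => (j == i)%:R).
  rewrite (bigD1 (Ordinal Hi)) //= eqxx mul1r big1 ?addr0 // => j.
  by rewrite -val_eqE /= => /negPf ->; rewrite mul0r.
move=> j Hj; rewrite /close -/U nth_ncons zr0 normr_le0 subr_eq0.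
case: ltngtP => h /=; rewrite ?mul0r ?mul1r //.
  by have -> : nth Z0 [:: Z.shiftl 1 s] (j - i) = Z0 by rewrite nth_default // /= subn_gt0.
by rewrite h subnn /= (zr_shiftl _ s_ge0) zr1 mul1r.
Qed.

(** Only values count here, so both ends of the secant are the center and the unknowns carry no
    slopes. *)
Lemma pt_encl : rseq arithR arithR (earith (s + 12))
   (encloses (s + 12)%Z E (cvn x0) (cvn x0)) (sysR x0).1 (sysR x0).1 pt.1.
Proof.
apply: (proj1 (@system_par _ _ _ arithR arithR (earith (s + 12)) _ _ _ _ _ _ _ m n N D _ _ _ _)).
- exact: encloses0.
- by move=> *; apply: enclosesD.
- by move=> *; apply: enclosesB.
- by move=> *; apply: (enclosesM s12_ge0).
- by move=> *; apply: (enclosesV s12_ge0).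
- by move=> *; apply: (encloses_frac s12_ge0).
move=> i Hi zi; rewrite /zi -/(z i).
have cl : close (s + 12)%Z (cvn x0 i) (Z.shiftl (z i) 14) (Z.shiftl 0 14).
  rewrite -[ i]/(val (Ordinal Hi)) cvnE mxE /close Z.shiftl_0_l zr0 normr_le0 subr_eq0.
  rewrite unit_atD //; last exact: s_ge0.
  rewrite mulrA divfK; last by rewrite gt_eqF ?U_gt0.
  by rewrite /(unit_at _) -zrM; apply/eqP; congr zr; rewrite !Z.shiftl_mul_pow2 // -Z.mul_assoc.
split => //; exists (fun=> 0); first by rewrite subrr big1 // => j _; rewrite mul0r.
by move=> j _; rewrite /close nth_nil mul0r zr0 subrr normr0.
Qed.

Let sa := Z.min 10 (s - 4).
Let tb := Z.min 18 (s - 6).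
Let rows := [seq map (fun x => Z.shiftr x (s - tb)) (slo b) | b <- box.1].
Let errs := [seq (Z.shiftr (serr b) (s - tb) + 2)%Z | b <- box.1].
Let Az := approx_inverse sa tb rows.
Let Amx : 'M[R]_E := \matrix_(i, e) (zr (nth Z0 (nth [::] Az i) e) / unit_at sa).

Lemma newton_chk : newton_check s 14 sa tb (radius D) box.1 pt.1.
Proof. by case/and4P: chk. Qed.

Lemma tb_ge0 : (0 <=? tb)%Z. Proof. by have := s_big; rewrite /tb; lia. Qed.
Lemma sa_ge0 : (0 <=? sa)%Z. Proof. by have := s_big; rewrite /sa; lia. Qed.

Lemma row_check (i : 'I_E) : let a := nth [::] Az i in
  (2 * (foldr (fun j acc => Z.abs ((if (i : nat) == j then Z.shiftl 1 (sa + tb) else 0) -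
     nth Z0 (foldr (fun xy acc => axpy (scale xy.1) xy.2 acc) [::] (zip a rows)) j) + acc)
           (Z.of_nat E * zdot (map Z.abs a) errs) (iota 0 E)) <=? Z.shiftl 1 (sa + tb))%Z /\
  (2 * (Z.abs (zdot a (map mid pt.1)) + zdot (map Z.abs a) (map err pt.1)) <=?
      Z.shiftl (radius D) (sa + 14))%Z.
Proof.
have := newton_chk; rewrite /newton_check size_box => /and3P[_ _ /allP /(_ i)].
by rewrite mem_iota ltn_ord => /(_ isT) /andP[].
Qed.

Lemma nth_abs (a : seq Z) e : zr (nth Z0 (map Z.abs a) e) = `|zr (nth Z0 a e)|.
Proof.
case: (ltnP e (size a)) => H; first by rewrite (nth_map Z0) // zr_abs.
by rewrite !nth_default ?size_map // zr0 normr0.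
Qed.

(** Cutting the slopes from s to [tb] bits is one more rounding, governed by [round_close]; this is
    where the entries of [errs] come from. *)
Lemma slope_row x y (e : 'I_E) : in_box x0 rho x -> in_box x0 rho y ->
  exists2 sg : 'I_E -> R, (Fsys x - Fsys y) e 0 = \sum_j sg j * (x - y) j 0 &
    forall j : 'I_E, `|sg j * unit_at tb - zr (nth Z0 (nth [::] rows e) j)| <= zr (nth Z0 errs e).
Proof.
move=> Hx Hy; have [[_ _ H] _] := box_encl Hx Hy.
have ok : eok (nth ezero box.1 e).
  have := newton_chk => /and3P[/all_nthP + _ _]; apply; by rewrite size_box.
have [_ _ [sg h1 h2]] := H e ok.
exists (fun j : 'I_E => sg j).
  rewrite !mxE h1; apply: eq_bigr => j _; by rewrite !mxE !cvnE.
move=> j; have := h2 j (ltn_ord j); rewrite /close.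
have st : (0 <=? s - tb)%Z by rewrite /tb; lia.
have -> : unit_at s = unit_at tb * unit_at (s - tb).
  rewrite -unit_atD //; [congr (unit_at _); rewrite /tb; lia|exact: tb_ge0].
rewrite mulrA => /(round_close st) /(_ (shiftr_near _ st _)).
rewrite (nth_map ezero) ?size_box // (nth_map ezero) ?size_box //.
congr (`|_ - zr _| <= _).
case: (ltnP j (size (slo (nth ezero box.1 e)))) => Hs; first by rewrite (nth_map Z0).
by rewrite !(nth_default Z0) ?size_map // Z.shiftr_0_l.
Qed.

Lemma slope_ok x y : in_box x0 rho x -> in_box x0 rho y -> exists2 S : 'M[R]_E,
  Fsys x - Fsys y = S *m (x - y) & forall i, \sum_j `|(1%:M - Amx *m S) i j| <= 2^-1.
Proof.
move=> Hx Hy.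
have /fin_all_exists2[sg h1 h2] : forall e : 'I_E, exists2 sg : 'I_E -> R, (Fsys x - Fsys y) e 0 = \sum_j sg j * (x - y) j 0 & forall j : 'I_E, `|sg j * unit_at tb - zr (nth Z0 (nth [::] rows e) j)| <= zr (nth Z0 errs e).
  by move=> e; apply: slope_row.
exists (\matrix_(e, j) sg e j).
  by apply/colP => e; rewrite h1 mxE; apply: eq_bigr => j _; rewrite !mxE.
move=> i; have [+ _] := row_check i; set a := nth [::] Az i.
have A0 : 0 < unit_at sa by apply: unit_at_gt0 sa_ge0.
have T0 : 0 < unit_at tb by apply: unit_at_gt0 tb_ge0.
have AT : unit_at (sa + tb) = unit_at sa * unit_at tb.
  by apply: unit_atD; [exact: sa_ge0|exact: tb_ge0].
have AT0 : 0 < unit_at sa * unit_at tb by rewrite mulr_gt0.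
have sat : (0 <=? sa + tb)%Z by have := sa_ge0; have := tb_ge0; lia.
have sr : size rows = E by rewrite size_map size_box.
have se : size errs = E by rewrite size_map size_box.
rewrite -(zr_le R) zrM (zr_shiftl _ sat) zr1 mul1r AT zr_foldr_sum zrM zr_nat.
rewrite (zr_zdot _ se) => H.
have le : (\sum_j `|(1%:M - Amx *m (\matrix_(e, j) sg e j)) i j|) * (unit_at sa * unit_at tb) <=
  \sum_(j <- iota 0 E) zr (Z.abs ((if (i : nat) == j then Z.shiftl 1 (sa + tb) else 0) -
     nth Z0 (foldr (fun xy acc => axpy (scale xy.1) xy.2 acc) [::] (zip a rows)) j)) +
  E%:R * \sum_(e < E) zr (nth Z0 (map Z.abs a) e) * zr (nth Z0 errs e).
  rewrite mulr_suml.
  have -> : E%:R * \sum_(e < E) zr (nth Z0 (map Z.abs a) e) * zr (nth Z0 errs e) =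
      \sum_(j < E) \sum_(e < E) zr (nth Z0 (map Z.abs a) e) * zr (nth Z0 errs e).
    by rewrite sumr_const card_ord mulr_natl.
  have -> : iota 0 E = index_iota 0 E by rewrite /index_iota subn0.
  rewrite big_mkord -big_split.
  apply: ler_sum => j _ /=.
  rewrite -[X in `|_| * X](gtr0_norm AT0) -normrM zr_abs zrB (zr_nth_comb _ _ sr).
  have -> : zr (if (i : nat) == j then Z.shiftl 1 (sa + tb) else 0) =
     (i == j)%:R * (unit_at sa * unit_at tb).
    rewrite -val_eqE; case: eqP => _; last by rewrite mul0r.
    by rewrite (zr_shiftl _ sat) AT zr1.
  (* The first difference is the quantity computed by the check; the second is the effect of the
     errors of the slopes. *)
  have -> : (1%:M - Amx *m (\matrix_(e, j) sg e j)) i j * (unit_at sa * unit_at tb) =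
     ((i == j)%:R * (unit_at sa * unit_at tb) - \sum_(e < E) zr (nth Z0 a e) * zr (nth Z0 (nth [::] rows e) j))
     - \sum_(e < E) zr (nth Z0 a e) * (sg e j * unit_at tb - zr (nth Z0 (nth [::] rows e) j)).
    rewrite !mxE mulrBl -addrA; congr (_ + _); rewrite -opprD; congr (- _).
    rewrite -big_split mulr_suml; apply: eq_bigr => e _; rewrite !mxE /=.
    by rewrite -/a; field; rewrite gt_eqF.
  apply: le_trans (ler_normB _ _) _; apply: lerD => //.
  apply: le_trans (ler_norm_sum _ _ _) _; apply: ler_sum => e _.
  by rewrite nth_abs normrM ler_wpM2l.
rewrite -(ler_pM2r AT0); apply: le_trans le _.
by move: H; rewrite (_ : zr 2%Z = 2%:R); [lra|exact: (zr_nat R 2)].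
Qed.

(** The change of scales in [resid_ok], with the powers of two replaced by variables. *)
Lemma scaled_residual (X r a u v w w' b : R) : v = u * w -> w' = 4 * w -> r * u = b * 4 ->
  2 * X <= b * (a * w') -> X <= r / 2 * (a * v).
Proof.
move=> -> -> e H; have -> : r / 2 * (a * (u * w)) = r * u * (a * w) / 2 by ring.
rewrite e; have -> : b * 4 * (a * w) / 2 = b * (a * (4 * w)) / 2 by ring.
by lra.
Qed.

Lemma resid_ok i : `|(Amx *m Fsys x0) i 0| <= rho / 2.
Proof.
have [_ +] := row_check i; set a := nth [::] Az i.
have A0 : 0 < unit_at sa by apply: unit_at_gt0 sa_ge0.
have P0 : 0 < unit_at (s + 12) by apply: unit_at_gt0 s12_ge0.
have U0 := U_gt0.
have AP0 : 0 < unit_at sa * unit_at (s + 12) by rewrite mulr_gt0.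
have sm : size (map mid pt.1) = E by rewrite size_map size_pt.
have se : size (map err pt.1) = E by rewrite size_map size_pt.
have sa14 : (0 <=? sa + 14)%Z by have := s_big; rewrite /sa; lia.
rewrite -(zr_le R) zrM (zr_shiftl _ sa14) zrD zr_abs (zr_zdot _ sm) (zr_zdot _ se) => H.
have [_ _ enc] := pt_encl.
have ok e : (e < E)%N -> eok (nth ezero pt.1 e).
  by move=> He; have := newton_chk => /and3P[_ /all_nthP + _]; apply; rewrite size_pt.
have le : `|(Amx *m Fsys x0) i 0| * (unit_at sa * unit_at (s + 12)) <=
   `|\sum_(e < E) zr (nth Z0 a e) * zr (nth Z0 (map mid pt.1) e)| +
   \sum_(e < E) zr (nth Z0 (map Z.abs a) e) * zr (nth Z0 (map err pt.1) e).
  rewrite -[X in `|_| * X](gtr0_norm AP0) -normrM.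
  have -> : (Amx *m Fsys x0) i 0 * (unit_at sa * unit_at (s + 12)) =
    \sum_(e < E) zr (nth Z0 a e) * zr (nth Z0 (map mid pt.1) e) +
    \sum_(e < E) zr (nth Z0 a e) * (Fsys x0 e 0 * unit_at (s + 12) - zr (nth Z0 (map mid pt.1) e)).
    rewrite mxE mulr_suml -big_split; apply: eq_bigr => e _; rewrite !mxE /= -/a.
    by field; rewrite gt_eqF.
  apply: le_trans (ler_normD _ _) _; apply: lerD => //.
  apply: le_trans (ler_norm_sum _ _ _) _; apply: ler_sum => e _.
  rewrite nth_abs normrM ler_wpM2l // mxE.
  have [+ _ _] := enc e (ok e (ltn_ord e)); rewrite /close.
  by rewrite !(nth_map ezero) ?size_pt.
rewrite -(ler_pM2r AP0); apply: le_trans le _.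
have e1 : unit_at (sa + 14) = unit_at sa * unit_at 14 by apply: unit_atD => //; exact: sa_ge0.
have e2 : unit_at (s + 12) = U * unit_at 12 by apply: unit_atD => //; exact: s_ge0.
have e3 : unit_at 14 = 4 * unit_at 12.
  have -> : unit_at 14 = unit_at 2 * unit_at 12 by apply: (@unit_atD R 2 12).
  congr (_ * _); exact: (zr_nat R 4).
have e4 : rho * U = zr (radius D) * 4.
  rewrite /rho divfK ?gt_eqF // (@zr_shiftl R 2%Z) //; congr (_ * _).
apply: (scaled_residual e2 e3 e4); rewrite -e1 -[2](zr_nat R 2); exact: H.
Qed.

Theorem system_check_sound : exists v : nat -> R,
  let S := system arithR m n N D (fun j _ => v j) in
  (forall i, nth 0 S.1 i = 0) /\ (forall w, w \in S.2 -> w != 0).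
Proof.
(* The bound on the residual gives rho >= 0 as soon as there is an unknown; the absolute value
   covers the system without unknowns. *)
have [v vb Fv] : exists2 v, in_box x0 (`|rho|) v & Fsys v = 0.
  have [e|] := eqVneq E 0%N.
    by exists x0; [move=> i; rewrite subrr normr0|apply/colP => -[i Hi]; exfalso; move: Hi; rewrite e].
  rewrite -lt0n => E0; pose i0 := Ordinal E0.
  have r0 : 0 <= rho by have := le_trans (normr_ge0 _) (resid_ok i0); lra.
  by rewrite ger0_norm //; apply: newton_kantorovich => //; [exact: slope_ok|exact: resid_ok].
have vb' : in_box x0 rho v.
  move=> i; have r0 : 0 <= rho by have := le_trans (normr_ge0 _) (resid_ok i); lra.
  by have := vb i; rewrite (ger0_norm r0).
have [[sz1 _ _] [sz _ H]] := box_encl vb' vb'.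
exists (cvn v) => /=; split=> [i|w].
  case: (ltnP i E) => Hi; last by rewrite nth_default // sz1 size_box.
  by have := congr1 (fun u : 'cV_E => u (Ordinal Hi) 0) Fv; rewrite !mxE.
case/(nthP 0) => i; rewrite sz => Hi <-.
case/and4P: chk => _ _ /(all_nthP ezero) /(_ i Hi) /andP[ok lt] _.
have [C _ _] := H i ok; apply/eqP => w0; move: C.
(* An enclosure whose error is smaller than its midpoint cannot contain 0. *)
rewrite /close w0 mul0r sub0r normrN leNgt => /negP; apply.
move: lt; rewrite -(zr_lt R) => lt; apply: lt_le_trans lt (ler_norm _).
Qed.
End Solve.

(** * Rotations and traces *)

Section Roots.
Variable R : rcfType.

(** The algebraic properties of the cosine and sine of 2 pi i / p that the argument uses, the last
    one being orthogonality of characters. The real and imaginary parts of the powers of any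
    primitive p-th root of unity have them. *)
Record rotation (p : nat) (co si : nat -> R) : Prop := Rotation {
  rot_co0 : co 0 = 1;
  rot_si0 : si 0 = 0;
  rot_coD : forall i j, co (i + j) = co i * co j - si i * si j;
  rot_siD : forall i j, si (i + j) = si i * co j + co i * si j;
  rot_norm : forall i, co i ^+ 2 + si i ^+ 2 = 1;
  rot_cop : co p = 1;
  rot_sip : si p = 0;
  rot_sum : forall k, ~~ (p %| k)%N -> \sum_(f < p) co (f * k)%N = 0 }.

(** In characteristic 0 the polynomial X^n - 1 is separable, hence has n distinct roots, and a group
    of n roots of unity contains a primitive one. *)
Lemma prim_root_exists (C : closedFieldType) n :
  (0 < n)%N -> [pchar C] =i pred0 -> exists z : C, n.-primitive_root z.
Proof.
move=> n0 ch; pose q : {poly C} := 'X^n - 1.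
have szq : size q = n.+1 by rewrite size_XnsubC.
have [r Dr] := closed_field_poly_normal q.
have lq : lead_coef q = 1 by rewrite lead_coefXnsubC.
rewrite lq scale1r in Dr.
have rootq y : root q y = (y \in r) by rewrite Dr root_prod_XsubC.
have rn : all n.-unity_root r.
  by apply/allP => y; rewrite -rootq.
have sr : size r = n by apply/eqP; rewrite -eqSS -szq Dr size_prod_XsubC.
have ur : uniq r.
  rewrite -separable_prod_XsubC -Dr separable_Xn_sub_1 //.
  by have /pcharf0P -> := ch; rewrite -lt0n.
have := has_prim_root n0 rn ur; rewrite sr leqnn => /(_ isT) /hasP[z _ Hz].
by exists z.
Qed.
Lemma Re_sum (I : Type) (r : seq I) (P : pred I) (f : I -> R[i]) :
  complex.Re (\sum_(i <- r | P i) f i) = \sum_(i <- r | P i) complex.Re (f i).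
Proof. by apply: (big_morph (@complex.Re R)) => // -[a b] [a' b']. Qed.

Lemma rotation_exists p : (1 < p)%N -> exists co si, rotation p co si.
Proof.
move=> p1; have p0 : (0 < p)%N by apply: ltnW.
have ch0 : [pchar R[i]] =i pred0 by apply: Num.Theory.pchar_num.
have [z Hz] := prim_root_exists (C := R[i]) p0 ch0.
pose co k := complex.Re (z ^+ k); pose si k := complex.Im (z ^+ k).
have zE k : z ^+ k = (co k +i* si k)%C by rewrite /co /si; case: (z ^+ k).
have coD i j : co (i + j)%N = co i * co j - si i * si j.
  by rewrite {1}/co exprD !zE.
have siD i j : si (i + j)%N = si i * co j + co i * si j.
  by rewrite {1}/si exprD !zE /=; ring.
have zp : z ^+ p = 1 by apply: prim_expr_order.
have norm i : co i ^+ 2 + si i ^+ 2 = 1.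
  have n1 : `|z| = 1.
    apply/eqP; rewrite -(@pexpr_eq1 _ _ p) // ?normr_ge0 //.
    by rewrite -normrX zp normr1.
  have : `|z ^+ i| = 1 by rewrite normrX n1 expr1n.
  rewrite normc_def => /(congr1 (@complex.Re R)) /= h.
  by rewrite -[LHS]sqr_sqrtr ?addr_ge0 ?sqr_ge0 // h expr1n.
exists co, si; split => //.
- by rewrite /co zp.
- by rewrite /si zp.
- move=> k kp; have zk : z ^+ k != 1 by rewrite -(prim_order_dvd Hz) in kp *.
  have : \sum_(f < p) z ^+ (f * k) = 0.
    have H : (z ^+ k - 1) * \sum_(f < p) z ^+ (f * k) = 0.
      rewrite (eq_bigr (fun f : 'I_p => (z ^+ k) ^+ f)); last first.
        by move=> f _; rewrite mulnC exprM.
      by rewrite -subrX1 -exprM mulnC exprM zp expr1n subrr.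
    by apply/eqP; move/eqP: H; rewrite mulf_eq0 subr_eq0 (negPf zk).
  by move/(congr1 (@complex.Re R)); rewrite Re_sum.
Qed.
End Roots.

Section TraceFormula.
Variables (R : rcfType) (p : nat) (co si : nat -> R).
Hypothesis rot : rotation p co si.
Hypothesis p_gt0 : (0 < p)%N.

(** The subtraction formulas, phrased so that no natural number is subtracted. *)
Lemma rot_sub u v : co u = co (u + v)%N * co v + si (u + v)%N * si v /\
  si u = si (u + v)%N * co v - co (u + v)%N * si v.
Proof.
have n := rot_norm rot v; rewrite (rot_coD rot) (rot_siD rot).
split; [rewrite -[LHS]mulr1|rewrite -[LHS]mulr1]; rewrite -n; ring.
Qed.

Lemma rot_period k : co (p * k)%N = 1 /\ si (p * k)%N = 0.
Proof.
elim: k => [|k [IH1 IH2]]; first by rewrite muln0 (rot_co0 rot) (rot_si0 rot).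
rewrite mulnS (rot_coD rot) (rot_siD rot) IH1 IH2 (rot_cop rot) (rot_sip rot).
by rewrite !mulr0 !mul0r mulr1 subr0 addr0.
Qed.

Lemma rot_addp u k : co (u + p * k)%N = co u /\ si (u + p * k)%N = si u.
Proof.
have [c s] := rot_period k; rewrite (rot_coD rot) (rot_siD rot) c s.
by rewrite !mulr0 !mulr1 subr0 addr0.
Qed.

Lemma rot_mod g k : co ((g %% p) * k)%N = co (g * k)%N /\ si ((g %% p) * k)%N = si (g * k)%N.
Proof.
have [h1 h2] := rot_addp ((g %% p) * k)%N (g %/ p * k)%N.
by rewrite -h1 -h2 mulnA -mulnDl [(p * _)%N]mulnC addnC -divn_eq.
Qed.

Lemma rot_opp g k : (g <= p)%N ->
  co ((p - g) * k)%N = co (g * k)%N /\ si ((p - g) * k)%N = - si (g * k)%N.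
Proof.
move=> gp; have [-> ->] := rot_sub ((p - g) * k)%N (g * k)%N.
rewrite -mulnDl subnK //; have [-> ->] := rot_period k.
by rewrite mul0r addr0 mul1r mul0r sub0r mul1r.
Qed.

Lemma fold_freqP g k : let: (f, s) := fold_freq p g in
  [/\ co (f * k)%N = co (g * k)%N, si (f * k)%N = (if s then 1 else -1) * si (g * k)%N
    & (2 * f <= p)%N].
Proof.
rewrite /fold_freq; have [<- <-] := rot_mod g k; have := ltn_pmod g p_gt0.
set r := (g %% p)%N => rp; case: leqP => h; first by rewrite mul1r.
have [-> ->] := rot_opp k (ltnW rp); rewrite mulN1r; split=> //; lia.
Qed.

(** Reversing the frequency while conjugating both coefficients leaves the term unchanged. *)
Lemma term_fold g k re x re' x' : let: (f, s) := fold_freq p g in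
  (re * re' + signed (arithR R) s x * signed (arithR R) s x') * co (f * k)%N -
  (re * signed (arithR R) s x' - signed (arithR R) s x * re') * si (f * k)%N =
  (re * re' + x * x') * co (g * k)%N - (re * x' - x * re') * si (g * k)%N.
Proof.
have := fold_freqP g k; case: (fold_freq p g) => f [] [-> -> _] /=; ring.
Qed.

Variables (w : seq nat) (h : nat).
Local Notation t := (size w).
Local Notation d := (2 * size w)%N.
Hypothesis w_lt : all (fun x => (x < p)%N) w.
Hypothesis w_half : all (fun x => (2 * x) %% p == 0)%N (drop (t - h) w).

Lemma nth_w_lt a : (nth 0 w a < p)%N.
Proof.
case: (ltnP a t) => H; last by rewrite nth_default.
exact: (allP w_lt _ (mem_nth 0%N H)).
Qed.

Let cw (k a : nat) : R := co (nth 0%N w a * k)%N.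
Let sw (k a : nat) : R := si (nth 0%N w a * k)%N.

(** Twice the weight of a half plane is divisible by p, so the double angle has cosine 1 and the
    sine is 0: the rotation acts as a sign and preserves the first coordinate line. *)
Lemma half_si k b : (t - h <= b < t)%N -> sw k b = 0.
Proof.
case/andP => h1 h2; rewrite /sw; set v := nth _ _ _.
have v2 : ((2 * v) %% p == 0)%N.
  apply: (allP w_half); apply/(nthP 0%N); exists (b - (t - h))%N.
    by rewrite size_drop ltn_sub2r // (leq_ltn_trans h1).
  by rewrite nth_drop subnKC.
have [e1 e2] := rot_mod (2 * v)%N k; move: e1 e2; rewrite (eqP v2) mul0n.
rewrite (rot_co0 rot) -mulnA mul2n -addnn (rot_coD rot) => e1 _.
have n := rot_norm rot (v * k)%N.
have : si (v * k)%N ^+ 2 = 0 by move: n e1; rewrite !expr2; lra.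
by move/eqP; rewrite expf_eq0 /= => /eqP.
Qed.

Definition rotf (k i j : nat) : R :=
  if j == i then cw k i./2 else if j./2 == i./2 then
    (if odd i then sw k i./2 else - sw k i./2) else 0.

Lemma sum_planes (F : nat -> R) s :
  \sum_(i < 2 * s) F i = \sum_(a < s) (F (2 * a)%N + F (2 * a).+1).
Proof.
elim: s => [|s IH]; first by rewrite muln0 !big_ord0.
by rewrite mulnS add2n !big_ord_recr /= IH addrA.
Qed.

Lemma plane_half a : [/\ (2 * a)./2 = a, (2 * a).+1./2 = a, odd (2 * a) = false & odd (2 * a).+1].
Proof. by clear; split; lia. Qed.

Lemma rot_even k a (g : nat -> R) : (a < t)%N ->
  \sum_(l < d) rotf k (2 * a) l * g l = cw k a * g (2 * a)%N - sw k a * g (2 * a).+1.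
Proof.
move=> Ha; clear -Ha; rewrite (sum_planes (fun l => rotf k (2 * a) l * g l)).
have [e1 e2 e3 e4] := plane_half a.
rewrite (bigD1 (Ordinal Ha)) // big1 => [|b ab].
  rewrite Monoid.mulm1 /rotf -[nat_of_ord (Ordinal Ha)]/a eqxx e1 e2 e3 eqxx.
  by rewrite (_ : ((2 * a).+1 == (2 * a)%N) = false) ?mulNr //; lia.
have {}ab : (nat_of_ord b == a) = false by apply: negbTE; rewrite -val_eqE in ab.
have [f1 f2 f3 f4] := plane_half b.
rewrite /rotf e1 e3 f1 f2 ab.
have -> : (2 * b == 2 * a)%N = false by lia.
have -> : ((2 * b).+1 == 2 * a)%N = false by lia.
by rewrite !mul0r addr0.
Qed.

Lemma rot_odd k a (g : nat -> R) : (a < t)%N ->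
  \sum_(l < d) rotf k (2 * a).+1 l * g l = sw k a * g (2 * a)%N + cw k a * g (2 * a).+1.
Proof.
move=> Ha; clear -Ha; rewrite (sum_planes (fun l => rotf k (2 * a).+1 l * g l)).
have [e1 e2 e3 e4] := plane_half a.
rewrite (bigD1 (Ordinal Ha)) // big1 => [|b ab].
  rewrite Monoid.mulm1 /rotf -[nat_of_ord (Ordinal Ha)]/a eqxx e1 e2 e4 eqxx.
  by rewrite (_ : ((2 * a)%N == (2 * a).+1) = false) //; lia.
have {}ab : (nat_of_ord b == a) = false by apply: negbTE; rewrite -val_eqE in ab.
have [f1 f2 f3 f4] := plane_half b.
rewrite /rotf e2 f1 f2 ab.
have -> : ((2 * b)%N == (2 * a).+1) = false by lia.
have -> : ((2 * b).+1 == (2 * a).+1) = false by lia.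
by rewrite !mul0r addr0.
Qed.

Definition rotm k : 'M[R]_d := \matrix_(i, j) rotf k i j.
Definition mxof (P : nat -> nat -> R) : 'M[R]_d := \matrix_(i, j) P i j.

Section Pair.
Variables (P P' : nat -> nat -> R).
Hypothesis symP : forall i j, (i < d)%N -> (j < d)%N -> P i j = P j i.
Hypothesis symP' : forall i j, (i < d)%N -> (j < d)%N -> P' i j = P' j i.
Hypothesis deadP : forall i b, (i < d)%N -> (t - h <= b < t)%N -> P i (2 * b).+1 = 0.
Hypothesis deadP' : forall i b, (i < d)%N -> (t - h <= b < t)%N -> P' i (2 * b).+1 = 0.

Let rb (k i j : nat) : R := \sum_(l' < d) rotf k j l' * (\sum_(l < d) rotf k i l * P' l l').

Let blk (k a b : nat) : R :=
  P (2 * a) (2 * b) * rb k (2 * a) (2 * b) + P (2 * a) (2 * b).+1 * rb k (2 * a) (2 * b).+1 +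
  (P (2 * a).+1 (2 * b) * rb k (2 * a).+1 (2 * b) +
   P (2 * a).+1 (2 * b).+1 * rb k (2 * a).+1 (2 * b).+1).

Lemma trace_blk k : \tr (mxof P *m (rotm k *m mxof P' *m (rotm k)^T)) =
  \sum_(a < t) \sum_(b < t) blk k a b.
Proof.
have -> : \tr (mxof P *m (rotm k *m mxof P' *m (rotm k)^T)) =
    \sum_(i < d) \sum_(j < d) P i j * rb k i j.
  rewrite exchange_big; apply: eq_bigr => i _; rewrite mxE; apply: eq_bigr => j _.
  rewrite mxE symP //; congr (_ * _); rewrite mxE; apply: eq_bigr => l' _.
  by rewrite !mxE mulrC; congr (_ * _); apply: eq_bigr => l _; rewrite !mxE.
rewrite (sum_planes (fun i => \sum_(j < d) P i j * rb k i j)); apply: eq_bigr => a _.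
rewrite (sum_planes (fun j => P (2 * a)%N j * rb k (2 * a) j)).
rewrite (sum_planes (fun j => P (2 * a).+1 j * rb k (2 * a).+1 j)).
by rewrite -big_split.
Qed.

Lemma plane_lt a : (a < t)%N -> ((2 * a)%N < d)%N /\ ((2 * a).+1 < d)%N.
Proof. by move=> ?; split; lia. Qed.

Lemma rbE k a b : (a < t)%N -> (b < t)%N ->
  let p00 := P' (2 * a)%N (2 * b)%N in let p01 := P' (2 * a)%N (2 * b).+1 in
  let p10 := P' (2 * a).+1 (2 * b)%N in let p11 := P' (2 * a).+1 (2 * b).+1 in
  let ca := cw k a in let sa := sw k a in let cb := cw k b in let sb := sw k b in
  [/\ rb k (2 * a) (2 * b) = cb * (ca * p00 - sa * p10) - sb * (ca * p01 - sa * p11),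
      rb k (2 * a) (2 * b).+1 = sb * (ca * p00 - sa * p10) + cb * (ca * p01 - sa * p11),
      rb k (2 * a).+1 (2 * b) = cb * (sa * p00 + ca * p10) - sb * (sa * p01 + ca * p11) &
      rb k (2 * a).+1 (2 * b).+1 = sb * (sa * p00 + ca * p10) + cb * (sa * p01 + ca * p11)].
Proof.
move=> Ha Hb; rewrite /= /rb; split.
- rewrite (rot_even k (fun l' => \sum_(l < d) rotf k (2 * a) l * P' l l') Hb).
  by rewrite (rot_even k (fun l => P' l (2 * b)%N) Ha) (rot_even k (fun l => P' l (2 * b).+1) Ha).
- rewrite (rot_odd k (fun l' => \sum_(l < d) rotf k (2 * a) l * P' l l') Hb).
  by rewrite (rot_even k (fun l => P' l (2 * b)%N) Ha) (rot_even k (fun l => P' l (2 * b).+1) Ha).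
- rewrite (rot_even k (fun l' => \sum_(l < d) rotf k (2 * a).+1 l * P' l l') Hb).
  by rewrite (rot_odd k (fun l => P' l (2 * b)%N) Ha) (rot_odd k (fun l => P' l (2 * b).+1) Ha).
- rewrite (rot_odd k (fun l' => \sum_(l < d) rotf k (2 * a).+1 l * P' l l') Hb).
  by rewrite (rot_odd k (fun l => P' l (2 * b)%N) Ha) (rot_odd k (fun l => P' l (2 * b).+1) Ha).
Qed.

Lemma blk_sym k a b : (a < t)%N -> (b < t)%N -> blk k a b = blk k b a.
Proof.
move=> Ha Hb; have [a0 a1] := plane_lt Ha; have [b0 b1] := plane_lt Hb.
rewrite /blk; have [-> -> -> ->] := rbE k Ha Hb; have [-> -> -> ->] := rbE k Hb Ha.
rewrite (symP b0 a0) (symP b0 a1) (symP b1 a0) (symP b1 a1).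
by rewrite (symP' b0 a0) (symP' b0 a1) (symP' b1 a0) (symP' b1 a1); ring.
Qed.

Definition term k (e : block) : R :=
  let x := coef (arithR R) h t P e in let y := coef (arithR R) h t P' e in
  (tmult e)%:R * ((x.1 * y.1 + x.2 * y.2) * co (tfreq e * k)%N
                - (x.1 * y.2 - x.2 * y.1) * si (tfreq e * k)%N).

Lemma co_diff k a b : co ((nth 0 w a + p - nth 0 w b) * k)%N = cw k a * cw k b + sw k a * sw k b /\
  si ((nth 0 w a + p - nth 0 w b) * k)%N = sw k a * cw k b - cw k a * sw k b.
Proof.
have [-> ->] := rot_sub ((nth 0 w a + p - nth 0 w b) * k)%N (nth 0 w b * k)%N.
have := nth_w_lt b; rewrite -mulnDl => hb; rewrite subnK; last by lia.
by rewrite mulnDl; have [-> ->] := rot_addp (nth 0 w a * k)%N k.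
Qed.

Lemma co_sum k a b : co ((nth 0 w a + nth 0 w b) * k)%N = cw k a * cw k b - sw k a * sw k b /\
  si ((nth 0 w a + nth 0 w b) * k)%N = sw k a * cw k b + cw k a * sw k b.
Proof. by rewrite mulnDl (rot_coD rot) (rot_siD rot). Qed.

(** As [coef] returns 2 alpha and 2 beta, products of coefficients of full planes amount to twice
    the entrywise product of the blocks. The multiplicity 2 counts the mirror block (b, a); for half
    planes, where a single tag is left, it is doubled again. *)
Lemma block_off k a b : (a < b < t)%N ->
  \sum_(e <- block_tags p w h a b) term k e = 4 * blk k a b.
Proof.
case/andP => ab Hb; have Ha : (a < t)%N by lia.
have [a0 a1] := plane_lt Ha; have [b0 b1] := plane_lt Hb.
rewrite /block_tags (ltn_eqF ab).
have T1 := term_fold (nth 0 w a + p - nth 0 w b)%N k; have T2 := term_fold (nth 0 w a + nth 0 w b)%N k.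
case: (fold_freq p (_ + p - _)) T1 => f s T1.
case: (fold_freq p (_ + _)) T2 => f' s' T2.
have [d1 d2] := co_diff k a b; have [s1 s2] := co_sum k a b.
case: ltnP => hb.
  rewrite !big_cons big_nil /term /coef /= (ltn_eqF ab) hb /= T1 T2 d1 d2 s1 s2.
  by rewrite /blk; have [-> -> -> ->] := rbE k Ha Hb; ring.
have hbt : (t - h <= b < t)%N by rewrite hb Hb.
rewrite big_cons big_nil /term /coef /= (ltn_eqF ab) ltnNge hb /= T1 d1 d2 (half_si k hbt).
rewrite /blk; have [-> -> -> ->] := rbE k Ha Hb; rewrite (half_si k hbt).
by rewrite !(deadP _ hbt) // !(deadP' _ hbt) //; ring.
Qed.

Lemma block_diag k b : (b < t)%N ->
  \sum_(e <- block_tags p w h b b) term k e = 2 * blk k b b.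
Proof.
move=> Hb; have [b0 b1] := plane_lt Hb.
rewrite /block_tags eqxx.
have T1 := term_fold (nth 0 w b + p - nth 0 w b)%N k; have T2 := term_fold (nth 0 w b + nth 0 w b)%N k.
case: (fold_freq p (_ + p - _)) T1 => f s T1.
case: (fold_freq p (_ + _)) T2 => f' s' T2.
have [d1 d2] := co_diff k b b; have [s1 s2] := co_sum k b b.
have nn : cw k b * cw k b + sw k b * sw k b = 1 by rewrite -!expr2; apply: (rot_norm rot).
have S01 : P (2 * b).+1 (2 * b)%N = P (2 * b)%N (2 * b).+1 by apply: symP.
have S01' : P' (2 * b).+1 (2 * b)%N = P' (2 * b)%N (2 * b).+1 by apply: symP'.
(* In a commuting diagonal block [coef] returns a plain 0, whereas [term_fold] expects a signed
   imaginary part. *)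
have Z0 (x : R) : signed (arithR R) s 0 = 0 by case: (s) => //=; rewrite subrr.
case: ltnP => hb.
  rewrite !big_cons big_nil /term /coef /= eqxx hb /=.
  have := T1 (P (2 * b)%N (2 * b)%N + P (2 * b).+1 (2 * b).+1) 0
     (P' (2 * b)%N (2 * b)%N + P' (2 * b).+1 (2 * b).+1) 0.
  rewrite !(Z0 0) => ->; rewrite T2 d1 d2 s1 s2.
  by rewrite /blk; have [-> -> -> ->] := rbE k Hb Hb; rewrite S01 S01'; ring.
have hbt : (t - h <= b < t)%N by rewrite hb Hb.
rewrite big_cons big_nil /term /coef /= eqxx ltnNge hb /=.
have := T1 (P (2 * b)%N (2 * b)%N) 0 (P' (2 * b)%N (2 * b)%N) 0.
rewrite !(Z0 0) => ->; rewrite d1 d2 (half_si k hbt).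
rewrite /blk; have [-> -> -> ->] := rbE k Hb Hb; rewrite (half_si k hbt) S01 S01'.
by rewrite !(deadP _ hbt) // !(deadP' _ hbt) //; ring.
Qed.

Lemma sum_sym_pairs (G : nat -> nat -> R) s : (forall a b, (a < s)%N -> (b < s)%N -> G a b = G b a) ->
  \sum_(a < s) \sum_(b < s) G a b = \sum_(b < s) (\sum_(a < b) 2 * G a b + G b b).
Proof.
elim: s => [|s IH] H; first by rewrite !big_ord0.
rewrite !big_ord_recr /= -IH; last by move=> a b ha hb; apply: H; lia.
under eq_bigr => a _ do rewrite big_ord_recr /=.
rewrite big_split /= -addrA; congr (_ + _).
have -> : \sum_(i < s) G s i = \sum_(i < s) G i s.
  by apply: eq_bigr => i _; apply: H => //; have := ltn_ord i; lia.
by rewrite addrA; congr (_ + _); rewrite -mulr_sumr mulr_natl mulr2n.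
Qed.

Theorem trace_tags k :
  2 * \tr (mxof P *m (rotm k *m mxof P' *m (rotm k)^T)) = \sum_(e <- tags p w h) term k e.
Proof.
rewrite trace_blk sum_sym_pairs => [|a b]; last exact: blk_sym.
have iotaE s : iota 0 s = index_iota 0 s by rewrite /index_iota subn0.
rewrite /tags big_flatten big_map iotaE big_mkord mulr_sumr; apply: eq_bigr => b _.
rewrite big_flatten big_map iotaE big_mkord.
rewrite big_ord_recr /= block_diag // mulrDr mulr_sumr; congr (_ + _).
apply: eq_bigr => a _; rewrite block_off; last by rewrite !ltn_ord.
by rewrite mulrA -natrM.
Qed.

End Pair.
End TraceFormula.

(** * Gram-Schmidt projections *)

Section GramSchmidtProjection.
Variables (R : realFieldType) (d : nat).
Local Notation arithR := (arithR R).
Implicit Types (B : seq (seq R * seq R)) (x : nat -> R).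

Lemma asumE (l : seq nat) (f : nat -> R) : asum arithR l f = \sum_(i <- l) f i.
Proof. by elim: l => [|x l IH] /=; rewrite ?big_nil ?big_cons ?IH. Qed.

Lemma asum_iota n (f : nat -> R) : asum arithR (iota 0 n) f = \sum_(i < n) f i.
Proof. by rewrite asumE -[iota 0 n](_ : index_iota 0 n = _) ?big_mkord // /index_iota subn0. Qed.

Lemma proj_entryE c B i j : proj_entry arithR c B i j =
  \sum_(l < c) (nth ([::], [::]) B l).1`_i * (nth ([::], [::]) B l).2`_j.
Proof. exact: asum_iota. Qed.

Lemma proj_entry_rcons c B u q i j : size B = c ->
  proj_entry arithR c.+1 (rcons B (u, q)) i j = proj_entry arithR c B i j + u`_i * q`_j.
Proof.
move=> sB; rewrite !proj_entryE big_ord_recr /= nth_rcons sB ltnn eqxx; congr (_ + _).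
by apply: eq_bigr => l _; rewrite nth_rcons sB ltn_ord.
Qed.

Lemma gs_vecE c B x i : (i < d)%N ->
  (gs_vec arithR d c B x)`_i = x i - \sum_(j < d) proj_entry arithR c B i j * x j.
Proof.
move=> Hi; rewrite /gs_vec nth_mkseq //= asum_iota; congr (_ - _).
under [RHS]eq_bigr => j _ do rewrite proj_entryE mulr_suml.
rewrite exchange_big; apply: eq_bigr => l _ /=.
rewrite nth_mkseq // asum_iota mulr_suml; apply: eq_bigr => j _ /=; ring.
Qed.

Definition pmx c B : 'M[R]_d := \matrix_(i, j) proj_entry arithR c B i j.

(** As the inverse of 0 is 0, nonzero weights mean nonzero Gram-Schmidt vectors. A new vector v = (1
    - M) x is orthogonal to the range of M, so adding v v^T / |v|^2 keeps M an orthogonal projection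
    and raises the trace by 1. *)
Lemma gram_schmidtP m (x : nat -> nat -> R) : let g := gram_schmidt arithR d m x in
  (forall w, w \in g.2 -> w != 0) ->
  [/\ size g.1 = m, (pmx m g.1)^T = pmx m g.1, pmx m g.1 *m pmx m g.1 = pmx m g.1,
      \tr (pmx m g.1) = m%:R &
      forall i j, (i < d)%N -> (j < d)%N -> (forall c, (c < m)%N -> x c j = 0) ->
        proj_entry arithR m g.1 i j = 0].
Proof.
elim: m => [|m IH] /= H.
  have e0 : pmx 0 [::] = 0 by apply/matrixP => i j; rewrite !mxE proj_entryE big_ord0.
  by rewrite e0 trmx0 mulmx0 mxtrace0; split=> // i j _ _ _; rewrite proj_entryE big_ord0.
move: IH H; case: (gram_schmidt _ _ _ _) => B ws /= IH H.
have {}IH := IH _; case: IH => [w Hw|sB sy ide tr dz].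
  by apply: H; move: Hw; rewrite /gs_step inE => ->; rewrite orbT.
set q := gs_vec arithR d m B (x m) in H *; pose M := pmx m B.
rewrite -/M in sy ide tr.
pose v : 'cV[R]_d := \col_i q`_i.
have vE : v = (1%:M - M) *m (\col_i x m i).
  apply/colP => i; rewrite mulmxBl mul1mx !mxE gs_vecE //; congr (_ - _).
  by apply: eq_bigr => j _; rewrite !mxE.
set w := (asum _ _ _)^-1 in H *.
have w0 : w != 0 by apply: H; rewrite inE eqxx.
have wE : w = (\sum_(i < d) q`_i * q`_i)^-1 by rewrite /w asum_iota.
have vv : v^T *m v = (w^-1)%:M.
  by rewrite [LHS]mx11_scalar; congr (_%:M); rewrite wE invrK mxE; apply: eq_bigr => i _; rewrite !mxE.
have Mv : M *m v = 0 by rewrite vE mulmxA mulmxBr mulmx1 ide subrr mul0mx.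
have vM : v^T *m M = 0 by apply: trmx_inj; rewrite trmx_mul trmxK sy Mv trmx0.
have u_q i : (i < d)%N -> (mkseq (fun i => w * q`_i) d)`_i = w * q`_i by move=> Hi; rewrite nth_mkseq.
set B' := rcons _ _.
have e : pmx m.+1 B' = M + w *: (v *m v^T).
  apply/matrixP => i j; rewrite !mxE proj_entry_rcons // u_q // big_ord1 !mxE; ring.
rewrite e; split.
- by rewrite size_rcons sB.
- by rewrite linearD /= sy linearZ /= trmx_mul trmxK.
- have vvv : v *m v^T *m (v *m v^T) = w^-1 *: (v *m v^T).
    by rewrite -mulmxA (mulmxA v^T) vv mul_scalar_mx -scalemxAr.
  rewrite mulmxDl !mulmxDr ide -!scalemxAr -!scalemxAl -(mulmxA v v^T M) vM mulmx0 scaler0 add0r.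
  by rewrite mulmxA Mv mul0mx scaler0 addr0 vvv !scalerA mulfK.
- rewrite mxtraceD tr mxtraceZ mxtrace_mulC vv mxtrace_scalar mulr1n mulfV // -natr1 //.
move=> i j Hi Hj Hx; rewrite proj_entry_rcons // dz // => [|c Hc]; last by apply: Hx; rewrite ltnS ltnW.
rewrite gs_vecE // Hx // big1 ?subrr ?mulr0 ?addr0 // => l _.
(* The induction hypothesis is about column j, the goal about row j. *)
have -> : proj_entry arithR m B j l = proj_entry arithR m B l j.
  have := congr1 (fun A : 'M_d => A (Ordinal Hj) l) sy; by rewrite !mxE.
rewrite dz ?mul0r // => c Hc; apply: Hx; rewrite ltnS ltnW //.
Qed.
End GramSchmidtProjection.

(** * Fourier coefficients *)

Arguments signed : simpl never.

Section Fold.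
Variables (R : rcfType) (p : nat).
Hypothesis p_gt1 : (1 < p)%N.
(** The number of residues modulo p that fold to the frequency f. *)
Definition wt f : R := if (f == 0)%N || (2 * f == p)%N then 1 else 2.

Lemma sum_fold (g : nat -> R) : (forall f, (f <= p)%N -> g (p - f)%N = g f) ->
  \sum_(f < p./2.+1) wt f * g f = \sum_(f < p) g f.
Proof.
move=> Hg; pose q := p./2.+1.
have qp : (q <= p)%N by rewrite /q; lia.
rewrite -(big_mkord xpredT g) (big_cat_nat (n := q)) //=.
have -> : \sum_(q <= f < p) g f = \sum_(j < p - q) g j.+1.
  rewrite big_nat_rev -{1}[q]add0n big_addn big_mkord; apply: eq_bigr => j _.
  rewrite -[RHS]Hg; last by have := ltn_ord j; lia.
  by congr g; have := ltn_ord j; rewrite /q; lia.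
rewrite big_mkord !big_ord_recl /wt /= mul1r -addrA; congr (_ + _).
(* For even p the frequency p / 2 is its own mirror image and must be split off; for odd p all
   nonzero frequencies come in pairs. *)
have [e|o] := boolP (odd p).
  have -> : (p - q = p./2)%N by rewrite /q; lia.
  rewrite -big_split; apply: eq_bigr => j _ /=.
  rewrite ifF ?mulr_natl ?mulr2n //; rewrite /bump /=; lia.
have [r Hr] : exists r, p./2 = r.+1 by exists (p./2).-1; lia.
have -> : (p - q = r)%N by rewrite /q; lia.
rewrite Hr !big_ord_recr /= addrAC -big_split; congr (_ + _).
  apply: eq_bigr => j _ /=; rewrite ifF ?mulr_natl ?mulr2n //; have := ltn_ord j; rewrite /bump /=; lia.
by rewrite ifT ?mul1r //; rewrite /bump /=; lia.
Qed.
End Fold.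

Section CoefficientSums.
Variables (R : rcfType) (p : nat) (w : seq nat) (h : nat).
Local Notation t := (size w).
Local Notation d := (2 * size w)%N.
Local Notation tg := (tags p w h).
Implicit Types P Q : nat -> nat -> R.

Definition cf P (e : block) : R * R := coef (arithR R) h t P e.
Definition cosC P Q f : R := \sum_(e <- tg | tfreq e == f)
  (tmult e)%:R * ((cf P e).1 * (cf Q e).1 + (cf P e).2 * (cf Q e).2).
Definition sinC P Q f : R := \sum_(e <- tg | tfreq e == f)
  (tmult e)%:R * ((cf P e).1 * (cf Q e).2 - (cf P e).2 * (cf Q e).1).

Lemma anatE n (x : R) : anat (arithR R) n x = n%:R * x.
Proof. by elim: n => [|n IH] /=; rewrite ?mul0r // IH mulrS mulrDl mul1r. Qed.

Lemma sum_with_freq (F : nat -> R) f :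
  \sum_(e <- with_freq tg f) F e = \sum_(0 <= e < size tg | tfreq (nth tag0 tg e) == f) F e.
Proof. by rewrite /with_freq big_filter /index_iota subn0. Qed.

Lemma cos_coefE X Y P Q f : 
  (forall e, (e < size tg)%N -> nth (0, 0) X e = cf P (nth tag0 tg e)) ->
  (forall e, (e < size tg)%N -> nth (0, 0) Y e = cf Q (nth tag0 tg e)) ->
  cos_coef (arithR R) tg X Y f = cosC P Q f.
Proof.
move=> HX HY; rewrite /cos_coef asumE sum_with_freq /cosC (big_nth tag0).
rewrite [LHS]big_nat_cond [RHS]big_nat_cond; apply: eq_bigr => e /andP[/andP[_ He] _].
by rewrite anatE HX // HY.
Qed.

Lemma sin_coefE X Y P Q f : 
  (forall e, (e < size tg)%N -> nth (0, 0) X e = cf P (nth tag0 tg e)) ->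
  (forall e, (e < size tg)%N -> nth (0, 0) Y e = cf Q (nth tag0 tg e)) ->
  sin_coef (arithR R) tg X Y f = sinC P Q f.
Proof.
move=> HX HY; rewrite /sin_coef asumE sum_with_freq /sinC (big_nth tag0).
rewrite [LHS]big_nat_cond [RHS]big_nat_cond; apply: eq_bigr => e /andP[/andP[_ He] _].
by rewrite anatE HX // HY.
Qed.

Lemma all_flatten_map (S T : Type) (a : pred T) (f : S -> seq T) s :
  all a (flatten (map f s)) = all (fun x => all a (f x)) s.
Proof. by elim: s => //= x s IH; rewrite all_cat IH. Qed.

Lemma all_tags : (0 < p)%N ->
  all (fun x => [&& ta x <= tb x, tb x < t, 2 * tfreq x <= p,
    (ta x == tb x) && ~~ tanti x ==> (tfreq x == 0) & tanti x ==> (tb x < t - h)])%N tg.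
Proof.
move=> p0; rewrite /tags all_flatten_map; apply/allP => b.
rewrite mem_iota => /andP[_ Hb]; rewrite all_flatten_map; apply/allP => a.
rewrite mem_iota => /andP[_ Ha]; rewrite add0n in Ha Hb.
have ff g : (2 * (fold_freq p g).1 <= p)%N.
  rewrite /fold_freq; have := ltn_pmod g p0; move: (g %% p)%N => r rp.
  by case: (leqP (2 * r) p) => h1 /=; lia.
have f0 : (a == b) ==> ((fold_freq p (nth 0 w a + p - nth 0 w b)).1 == 0)%N.
  by apply/implyP => /eqP ->; rewrite addKn /fold_freq modnn.
rewrite /block_tags; have := ff (nth 0 w a + nth 0 w b)%N.
move: f0 (ff (nth 0 w a + p - nth 0 w b)%N).
case: (fold_freq p (nth 0 w a + nth 0 w b)%N) => f2 s2.
case: (fold_freq p (nth 0 w a + p - nth 0 w b)%N) => f1 s1 /= f0 h1 h2.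
by case: ifP => hb /=; rewrite h1 ?h2 Hb -ltnS Ha ?andbT ?andbF f0 ?hb.
Qed.

Lemma tag_ok e : (0 < p)%N -> (e < size tg)%N -> let x := nth tag0 tg e in
  [/\ (ta x <= tb x)%N, (tb x < t)%N, (2 * tfreq x <= p)%N,
    ta x = tb x -> ~~ tanti x -> tfreq x = 0%N & tanti x -> (tb x < t - h)%N].
Proof.
move=> p0 He; have /(all_nthP tag0)/(_ e He)/and5P[h1 h2 h3 /implyP h4 /implyP h5] := all_tags p0.
by split=> // h6 h7; apply/eqP/h4; rewrite h6 eqxx h7.
Qed.

Lemma diag_tag b : (b < t)%N -> exists2 e, (e < size tg)%N &
  let x := nth tag0 tg e in [/\ ta x = b, tb x = b & ~~ tanti x].
Proof.
move=> Hb; have hf (S T : Type) (q : pred T) (f : S -> seq T) s :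
    has q (flatten (map f s)) = has (fun x => has q (f x)) s.
  by elim: s => //= x s IH; rewrite has_cat IH.
have /(has_nthP tag0)[e He /and3P[/eqP h1 /eqP h2 h3]] :
    has (fun x => [&& ta x == b, tb x == b & ~~ tanti x]) tg; last by exists e.
rewrite /tags hf; apply/hasP; exists b; rewrite ?mem_iota // hf; apply/hasP; exists b.
  by rewrite mem_iota add0n leqnn.
rewrite /block_tags; case: (fold_freq p (nth 0 w b + nth 0 w b)%N) => f2 s2.
case: (fold_freq p (nth 0 w b + p - nth 0 w b)%N) => f1 s1 /=.
by case: ifP => _ /=; rewrite !eqxx.
Qed.

Lemma cf_lin (I : Type) (r : seq I) (c : I -> R) (F : I -> nat -> nat -> R) e :
  cf (fun i j => \sum_(x <- r) c x * F x i j) e =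
  (\sum_(x <- r) c x * (cf (F x) e).1, \sum_(x <- r) c x * (cf (F x) e).2).
Proof.
have E (u v u' v' : R) : u = u' -> v = v' -> (u, v) = (u', v') by move=> -> ->.
have sg b (x : R) : signed (arithR R) b x = (if b then 1 else -1) * x.
  by case: b; rewrite /signed /= ?mul1r // mulN1r sub0r.
rewrite /cf /coef; case: eqP => _; case: ltnP => _; try case: (tanti e);
  rewrite /= ?sg; apply: E; rewrite -?big_split -?sumrB ?mulr_sumr /=;
  (try by rewrite big1 // => x _; rewrite mulr0);
  apply: eq_bigr => x _; rewrite /= ?sg; case: (tsign e); ring.
Qed.

Lemma cosC_sym P Q f : cosC P Q f = cosC Q P f.
Proof. by apply: eq_bigr => e _; congr (_ * _); ring. Qed.

Lemma cosC_lin (I : Type) (r : seq I) (c : I -> R) (F : I -> nat -> nat -> R) Q f :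
  cosC (fun i j => \sum_(x <- r) c x * F x i j) Q f = \sum_(x <- r) c x * cosC (F x) Q f.
Proof.
rewrite /cosC; under [RHS]eq_bigr => x _ do rewrite mulr_sumr.
rewrite exchange_big; apply: eq_bigr => e _; rewrite cf_lin /= !mulr_suml -big_split mulr_sumr.
by apply: eq_bigr => x _ /=; ring.
Qed.

Variables (co si : nat -> R).
Hypothesis rot : rotation p co si.
Hypothesis p_gt1 : (1 < p)%N.
Hypothesis w_lt : all (fun x => (x < p)%N) w.
Hypothesis w_half : all (fun x => (2 * x) %% p == 0)%N (drop (t - h) w).

Definition good P := [/\ forall i j, (i < d)%N -> (j < d)%N -> P i j = P j i &
  forall i b, (i < d)%N -> (t - h <= b < t)%N -> P i (2 * b).+1 = 0].

Local Notation rotm := (rotm co si w).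
Local Notation mxof := (mxof w).
Definition rtrace P Q k : R := \tr (mxof P *m (rotm k *m mxof Q *m (rotm k)^T)).

(** Collecting the blocks by frequency turns all the traces between two orbits into one
    trigonometric polynomial, so that finitely many coefficients control every rotation. *)
Lemma rtraceE P Q k : good P -> good Q -> 2 * rtrace P Q k =
  \sum_(f < p./2.+1) (cosC P Q f * co (f * k)%N - sinC P Q f * si (f * k)%N).
Proof.
move=> [sP dP] [sQ dQ]; have p0 : (0 < p)%N by lia.
rewrite /rtrace (trace_tags rot p0 w_lt w_half sP sQ dP dQ) (big_nth tag0) big_mkord.
under eq_bigr => e _.
  have [_ _ fe _ _] := tag_ok p0 (ltn_ord e).
  have fe' : (tfreq (nth tag0 tg e) < p./2.+1)%N by lia.
  rewrite (_ : term _ _ _ _ _ _ _ _ = \sum_(f < p./2.+1 | tfreq (nth tag0 tg e) == f)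
     term co si w h P Q k (nth tag0 tg e)); last first.
    by rewrite (big_pred1 (Ordinal fe')) // => f; rewrite -val_eqE eq_sym.
  over.
rewrite /= (exchange_big_dep xpredT) //=; apply: eq_bigr => f _.
rewrite /cosC /sinC !mulr_suml -sumrB !(big_nth tag0) !big_mkord.
by apply: eq_bigr => e /eqP fe; rewrite /term fe /cf; ring.
Qed.
End CoefficientSums.

(** * The invariant subspaces *)

Section FixedPart.
Variable R : realFieldType.
Local Notation zr := (zr R).
Local Notation arithR := (arithR R).

(** The third argument repeats the first, to match the ternary relations of the parametricity
    lemmas. *)
Definition represents (a : R) (q : Z * Z) (b : R) :=
  [/\ a = zr q.1 / zr q.2, zr q.2 != 0 & b = a].

Lemma represents0 a q b : represents a q b -> (a == 0) = Z.eqb q.1 Z0.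
Proof. by case=> -> h _; rewrite mulf_eq0 invr_eq0 (negbTE h) orbF zr_eq0. Qed.

Lemma representsD a1 a2 a3 b1 b2 b3 : represents a1 a2 a3 -> represents b1 b2 b3 ->
  represents (a1 + b1) (radd a2 b2) (a3 + b3).
Proof.
move=> [-> a0 ->] [-> b0 ->]; rewrite /radd; case: Z.eqb_spec => [e|_]; split=> //=.
- by rewrite zrD e mulrDl.
- by rewrite zrD !zrM; field; rewrite a0 b0.
- by rewrite zrM mulf_neq0.
Qed.

Lemma representsB a1 a2 a3 b1 b2 b3 : represents a1 a2 a3 -> represents b1 b2 b3 ->
  represents (a1 - b1) (rsub a2 b2) (a3 - b3).
Proof.
move=> [-> a0 ->] [-> b0 ->]; rewrite /rsub; case: Z.eqb_spec => [e|_]; split=> //=.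
- by rewrite zrB e mulrBl.
- by rewrite zrB !zrM; field; rewrite a0 b0.
- by rewrite zrM mulf_neq0.
Qed.

Lemma representsM a1 a2 a3 b1 b2 b3 : represents a1 a2 a3 -> represents b1 b2 b3 ->
  represents (a1 * b1) (amul rarith a2 b2) (a3 * b3).
Proof.
move=> [-> a0 ->] [-> b0 ->]; split=> //=; rewrite !zrM ?mulf_neq0 //.
by field; rewrite a0 b0.
Qed.

Lemma representsV a1 a2 a3 : represents a1 a2 a3 ->
  represents a1^-1 (ainv rarith a2) a3^-1.
Proof.
case: a2 => x y [-> /= y0 ->] /=; case: Z.eqb_spec => [->|h]; split=> //=.
- by rewrite zr0 mul0r invr0 mul0r.
- by rewrite zr1 oner_neq0.
- by rewrite invf_div.
- by rewrite zr_eq0; apply/negP => /Z.eqb_eq.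
Qed.

Lemma represents_frac a b : represents (zr a / zr b) (afrac rarith a b) (zr a / zr b).
Proof.
rewrite /=; case: Z.eqb_spec => [->|h]; split=> //=.
- by rewrite zr0 invr0 mulr0 mul0r.
- by rewrite zr1 oner_neq0.
- by rewrite zr_eq0; apply/negP => /Z.eqb_eq.
Qed.

Variables (m n N : nat) (D : case).
Local Notation tg := (tags (period D) (weights D) (halves D)).
Local Notation nf := (size (fixed D)).
Local Notation Q := (fixed_coefs arithR m D).

Lemma fixed_checkP : fixed_check m n N D ->
  [/\ forall j, (j < nf)%N -> forall w, w \in (fixed_gs arithR m D j).2 -> w != 0,
      forall j e, (j < nf)%N -> (e < size tg)%N -> tfreq (nth tag0 tg e) != 0%N ->
        nth (0, 0) (nth [::] Q j) e = (0, 0) &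
      forall i j, (i < j < nf)%N ->
        cos_coef arithR tg (nth [::] Q i) (nth [::] Q j) 0 = zr (2 * cnum m n N)%Z / zr (cden n N)].
Proof.
have Z0' : represents 0 (azero rarith) 0 by split; rewrite ?mul0r ?zr1 ?oner_neq0.
have fp := fixed_par (o1 := arithR) (o2 := rarith) (o3 := arithR) (r := represents) Z0' representsD representsB representsM representsV represents_frac m D.
have cp := fixed_coefs_par (o1 := arithR) (o2 := rarith) (o3 := arithR) (r := represents) Z0' representsD representsB representsM representsV represents_frac m D.
case/and3P => /allP H1 /allP H2 /allP H3; split.
- move=> j Hj w Hw; have [_ [s1 s2 H]] := fp j.
  case/(nthP 0): Hw => i Hi <-; rewrite (represents0 (H i)).
  have /H1/allP : fixed_gs rarith m D j \in mkseq (fixed_gs rarith m D) nf.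
    by apply/mapP; exists j; rewrite // mem_iota.
  by apply; apply: mem_nth; rewrite s2.
- move=> j e Hj He fe; have [h1 h2] := cp j e.
  have /H2/allP/(_ e) : nth [::] (fixed_coefs rarith m D) j \in fixed_coefs rarith m D.
    by apply: mem_nth; rewrite size_mkseq.
  rewrite mem_iota /= He => /(_ isT); rewrite (negbTE fe) /= -(represents0 h1) -(represents0 h2).
  by case: (nth _ _ e) => a b /= /andP[/eqP -> /eqP ->].
move=> i j /andP[ij Hj].
have /H3/allP/(_ i) : j \in iota 0 nf by rewrite mem_iota.
rewrite mem_iota ij => /(_ isT).
have C := cos_coef_par (o1 := arithR) (o2 := rarith) (o3 := arithR) (r := represents) Z0' representsD representsM tg 0%N (cp i) (cp j).
by rewrite -(represents0 (representsB C (represents_frac _ _))) subr_eq0 => /eqP.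
Qed.
End FixedPart.

(** * Rotation matrices *)

Section RotationMatrices.
Variables (R : rcfType) (p : nat) (co si : nat -> R).
Hypothesis rot : rotation p co si.
Variables (w : seq nat) (h : nat).
Local Notation t := (size w).
Local Notation d := (2 * size w)%N.
Local Notation rotf := (rotf co si w).
Local Notation rotm := (rotm co si w).
Local Notation cw k a := (co (nth 0%N w a * k)%N).
Local Notation sw k a := (si (nth 0%N w a * k)%N).

Lemma rotf_even k a j : rotf k (2 * a) j =
  if j == (2 * a)%N then cw k a else if j == (2 * a).+1 then - sw k a else 0.
Proof.
have [e1 e2 e3 e4] := plane_half a; rewrite /rotf e1 e3; case: eqP => // h1.
by have -> : (j./2 == a) = (j == (2 * a).+1) by lia.
Qed.

Lemma rotf_odd k a j : rotf k (2 * a).+1 j =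
  if j == (2 * a).+1 then cw k a else if j == (2 * a)%N then sw k a else 0.
Proof.
have [e1 e2 e3 e4] := plane_half a; rewrite /rotf e2 e4; case: eqP => // h1.
by have -> : (j./2 == a) = (j == (2 * a)%N) by lia.
Qed.

Lemma plane_of (i : nat) : (i < d)%N -> exists2 a, (a < t)%N & i = (2 * a)%N \/ i = (2 * a).+1.
Proof. by move=> Hi; exists i./2; [lia|case: (boolP (odd i)) => o; [right|left]; lia]. Qed.

Lemma rotmM r s : rotm r *m rotm s = rotm (r + s).
Proof.
apply/matrixP => i j; rewrite !mxE; under eq_bigr => l _ do rewrite !mxE.
have [a Ha [->|->]] := plane_of (ltn_ord i).
  rewrite (rot_even co si r (fun l => rotf s l j) Ha) rotf_even rotf_odd rotf_even.
  rewrite mulnDr (rot_coD rot) (rot_siD rot).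
  case: eqP => [->|_]; first by rewrite ifF; [|lia].
  by case: eqP => _; ring.
rewrite (rot_odd co si r (fun l => rotf s l j) Ha) rotf_even rotf_odd rotf_odd.
rewrite mulnDr (rot_coD rot) (rot_siD rot).
case: (nat_of_ord j =P (2 * a).+1) => [->|_]; first by rewrite ifF; [ring|lia].
by case: eqP => _; ring.
Qed.

Lemma rotm_period k : rotm (p * k) = 1%:M.
Proof.
apply/matrixP => i j; rewrite !mxE.
have cs a : cw (p * k) a = 1 /\ sw (p * k) a = 0.
  by rewrite mulnCA; apply: rot_period rot _.
have [a Ha [e|e]] := plane_of (ltn_ord i); have [c1 s1] := cs a.
  rewrite e rotf_even c1 s1 -val_eqE /= e eq_sym; case: eqP => // _.
  by rewrite oppr0 if_same.
rewrite e rotf_odd c1 s1 -val_eqE /= e eq_sym; case: eqP => // _.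
by rewrite if_same.
Qed.

Lemma rotm0 : rotm 0 = 1%:M.
Proof. by have := rotm_period 0; rewrite muln0. Qed.

(** The inverse rotation, written with a natural exponent. *)
Lemma rotm_tr r : (r <= p)%N -> (rotm r)^T = rotm (p - r).
Proof.
move=> rp; apply/matrixP => i j; rewrite !mxE.
have cs a : cw (p - r) a = cw r a /\ sw (p - r) a = - sw r a.
  by rewrite !(mulnC (nth 0%N w a)); have [-> ->] := rot_opp rot (nth 0%N w a) rp.
have [a Ha [ei|ei]] := plane_of (ltn_ord i); have [c1 s1] := cs a;
have [b Hb [ej|ej]] := plane_of (ltn_ord j); rewrite ei ej ?rotf_even ?rotf_odd c1 s1 ?opprK.
- have -> : (2 * b == (2 * a).+1)%N = false by lia.
  have -> : (2 * a == (2 * b).+1)%N = false by lia.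
  by rewrite eq_sym; case: eqP => // e; have -> : a = b by lia.
- have -> : ((2 * b).+1 == (2 * a))%N = false by lia.
  have -> : ((2 * a)%N == (2 * b).+1)%N = false by lia.
  have -> : ((2 * a) == 2 * b)%N = ((2 * b).+1 == (2 * a).+1) by lia.
  by case: eqP => // e; have -> : a = b by lia.
- have -> : ((2 * a).+1 == (2 * b))%N = false by lia.
  have -> : ((2 * b)%N == (2 * a).+1)%N = false by lia.
  have -> : ((2 * b) == 2 * a)%N = ((2 * b).+1 == (2 * a).+1) by lia.
  by rewrite [in RHS]eq_sym; case: eqP => // e; have -> : a = b by lia.
- have -> : ((2 * b).+1 == (2 * a))%N = false by lia.
  have -> : ((2 * a).+1 == (2 * b))%N = false by lia.
  by rewrite eq_sym; case: eqP => // e; have -> : a = b by lia.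
Qed.

Lemma rotm_orth r : (r <= p)%N -> rotm r *m (rotm r)^T = 1%:M /\ (rotm r)^T *m rotm r = 1%:M.
Proof.
move=> rp; rewrite rotm_tr // !rotmM subnKC // subnK //.
by have := rotm_period 1; rewrite muln1.
Qed.

Local Notation dead_coord := (dead_coord w h).
Definition live_mx : 'M[R]_d := \matrix_(i, j) ((i == j) && ~~ dead_coord i)%:R.

Lemma mul_live (A : 'M[R]_d) i j : (A *m live_mx) i j = A i j * (~~ dead_coord j)%:R.
Proof.
rewrite mxE (bigD1 j) //= !mxE eqxx big1 ?addr0 // => l lj.
by rewrite !mxE (negbTE lj) mulr0.
Qed.

Lemma live_mul (A : 'M[R]_d) i j : (live_mx *m A) i j = (~~ dead_coord i)%:R * A i j.
Proof.
rewrite mxE (bigD1 i) //= !mxE eqxx big1 ?addr0 // => l lj.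
by rewrite !mxE eq_sym (negbTE lj) mul0r.
Qed.

Hypothesis w_half : all (fun x => (2 * x) %% p == 0)%N (drop (t - h) w).

Lemma rotm_live r : rotm r *m live_mx = live_mx *m rotm r.
Proof.
apply/matrixP => i j; rewrite mul_live live_mul mulrC !mxE.
case: (eqVneq (nat_of_ord j) i) => [-> //|ij].
rewrite /rotf (negbTE ij); case: eqP => [e|_]; last by rewrite !mulr0.
have Hi := ltn_ord i; case: (ltnP i./2 (t - h)) => hh.
  by rewrite /dead_coord e (leqNgt (t - h)%N) hh !andbF.
have H : (t - h <= i./2 < t)%N by lia.
by rewrite (half_si rot w_half r H) oppr0 if_same !mulr0.
Qed.

Variable n : nat.
Hypothesis n_live : (n + h = d)%N.
Hypothesis h_le : (h <= t)%N.

Lemma sum_live : \sum_(i < d) (~~ dead_coord i)%:R = n%:R :> R.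
Proof.
clear w_half; rewrite (sum_planes (fun i => (~~ dead_coord i)%:R)).
have E (a : nat) : (~~ dead_coord (2 * a))%:R + (~~ dead_coord (2 * a).+1)%:R =
    (1 + (a < t - h))%N%:R :> R.
  have [e1 e2 e3 e4] := plane_half a; rewrite /dead_coord e2 e3 e4 /= -ltnNge natrD //.
under eq_bigr => a _ do rewrite E.
rewrite -natr_sum; congr _%:R.
rewrite big_split /= sum_nat_const card_ord muln1.
have -> : (\sum_(i < t) (i < t - h))%N = (t - h)%N.
  rewrite -(big_mkord xpredT (fun i => nat_of_bool (i < t - h)%N)).
  rewrite (big_cat_nat (n := (t - h)%N)) //= ?leq_subr //.
  rewrite big_nat_cond (eq_bigr (fun=> 1%N)) => [|i /andP[/andP[_ ->]] //].
  rewrite -big_nat_cond sum_nat_const_nat subn0 muln1.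
  rewrite big_nat_cond big1 ?addn0 // => i /andP[/andP[]].
  by rewrite leqNgt => /negbTE ->.
by lia.
Qed.

(** This E forgets the dead coordinates; conjugation by it transports projections supported on live
    coordinates from size d to size n. *)
Lemma live_selection : exists E : 'M[R]_(n, d), E^T *m E = live_mx.
Proof.
have cardL : #|[pred i : 'I_d | ~~ dead_coord i]| = n.
  apply/eqP; rewrite -(eqr_nat R) -sum_live -sum1_card natr_sum big_mkcond /=.
  by apply/eqP; apply: eq_bigr => i _; rewrite inE; case: ifP.
pose f (r : 'I_n) : 'I_d := enum_val (cast_ord (esym cardL) r).
exists (\matrix_(r, i) (f r == i)%:R).
apply/matrixP => i j; rewrite !mxE; under eq_bigr => r _ do rewrite !mxE.
case: (boolP (dead_coord i)) => di; rewrite ?andbF ?andbT.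
  rewrite big1 // => r _; case: eqP => [e|_]; last by rewrite mul0r.
  by have := enum_valP (cast_ord (esym cardL) r); rewrite -/(f r) e inE di.
have Hi : i \in [pred i : 'I_d | ~~ dead_coord i] by rewrite inE.
pose r0 := cast_ord cardL (enum_rank_in Hi i).
have fr0 : f r0 = i by rewrite /f /r0 cast_ordK enum_rankK_in.
rewrite (bigD1 r0) //= fr0 eqxx mul1r big1 ?addr0 // => r rr0.
case: eqP => [e|_]; last by rewrite mul0r.
case/eqP: rr0; apply: (cast_ord_inj (eq_n := esym cardL)); apply: enum_val_inj.
by rewrite -/(f r) -/(f r0) e fr0.
Qed.
End RotationMatrices.

(** * From Fourier coefficients to simplices *)

Lemma orbits_gt1 p k nf : (1 < p)%N -> (0 < k)%N -> (1 < k * p + nf)%N.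
Proof.
by move=> p1 k0; apply: leq_trans (leq_addr _ _); apply: leq_trans p1 (leq_pmull _ k0).
Qed.

Section FourierSolution.
Variables (R : rcfType) (p : nat) (co si : nat -> R).
Hypothesis rot : rotation p co si.
Hypothesis p_gt1 : (1 < p)%N.
Variables (w : seq nat) (h : nat).
Local Notation t := (size w).
Local Notation d := (2 * size w)%N.
Hypothesis w_lt : all (fun x => (x < p)%N) w.
Hypothesis w_half : all (fun x => (2 * x) %% p == 0)%N (drop (t - h) w).
Variables (m n N k nf : nat).
Hypotheses (n_live : (n + h = d)%N) (h_le : (h <= t)%N).
Hypotheses (m_gt0 : (0 < m)%N) (m_lt : (m < n)%N).
Hypotheses (k_gt0 : (0 < k)%N) (NE : (N = k * p + nf)%N).

Local Notation tg := (tags p w h).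
Local Notation rotm := (rotm co si w).
Local Notation mxof := (mxof w).
Local Notation cf := (cf w h).
Local Notation cosC := (cosC p w h).
Local Notation sinC := (sinC p w h).
Local Notation good := (good w h).
Local Notation rtrace := (rtrace w co si).
Local Notation dead := (dead_coord w h).
Implicit Types Y : nat -> nat -> R.
Let p0 : (0 < p)%N := ltnW p_gt1.

Definition proj_of P := [/\ good P, (mxof P)^T = mxof P, mxof P *m mxof P = mxof P & \tr (mxof P) = m%:R :> R].

Variables (P Q : nat -> nat -> nat -> R).
Hypothesis P_proj : forall a, (a < k)%N -> proj_of (P a).
Hypothesis Q_proj : forall j, (j < nf)%N -> proj_of (Q j).

Definition simplex_trace : R := (m%:R * (N%:R * m%:R - n%:R)) / (n%:R * (N%:R - 1)).
Local Notation c := simplex_trace.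

Hypothesis self_eq : forall a f, (a < k)%N -> ((if a == 0 then 2 else 1) <= f)%N -> (2 * f <= p)%N ->
  cosC (P a) (P a) f = (if (2 * f == p)%N then 2 else 4) * (m%:R - c) / p%:R.
Hypothesis cos_eq : forall a b f, (a < b < k)%N -> (0 < f)%N -> (2 * f <= p)%N ->
  cosC (P a) (P b) f = 0.
Hypothesis sin_eq : forall a b f, (a < b < k)%N -> (0 < f)%N -> (2 * f < p)%N ->
  sinC (P a) (P b) f = 0.
Hypothesis cross_eq : forall a b, (0 < a)%N -> (a < b < k)%N -> cosC (P a) (P b) 0%N = 2 * c.
Hypothesis fix_eq : forall a j, (0 < a < k)%N -> (j < nf)%N -> cosC (P a) (Q j) 0%N = 2 * c.
Hypothesis Q_flat : forall j e, (j < nf)%N -> (e < size tg)%N -> tfreq (nth tag0 tg e) != 0%N ->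
  cf (Q j) (nth tag0 tg e) = (0, 0).
Hypothesis Q_pair : forall i j, (i < j < nf)%N -> cosC (Q i) (Q j) 0%N = 2 * c.

Definition weighted_sum (F : (nat -> nat -> R) -> R) : R :=
  \sum_(a < k) F (P a) + p%:R^-1 * \sum_(j < nf) F (Q j).
Let z : R := N%:R * m%:R / (n%:R * p%:R).

Hypothesis sum_eq : forall e, (e < size tg)%N -> let x := nth tag0 tg e in tfreq x = 0%N ->
  if (ta x == tb x) && ~~ tanti x then
    (ta x < t.-1)%N -> weighted_sum (fun Y => (cf Y x).1) = (if (tb x < t - h)%N then 2 else 1) * z
  else weighted_sum (fun Y => (cf Y x).1) = 0 /\ weighted_sum (fun Y => (cf Y x).2) = 0.

Lemma n0 : n%:R != 0 :> R. Proof. by rewrite pnatr_eq0; lia. Qed.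
Lemma pR0 : p%:R != 0 :> R. Proof. by rewrite pnatr_eq0; lia. Qed.
Lemma N_gt1 : (1 < N)%N. Proof. by rewrite NE; apply: orbits_gt1. Qed.
Lemma N1 : N%:R - 1 != 0 :> R. Proof. by rewrite subr_eq0 pnatr_eq1; lia. Qed.
Lemma NR : N%:R = k%:R * p%:R + nf%:R :> R. Proof. by rewrite NE natrD natrM. Qed.
Lemma cE : c * (N%:R - 1) = N%:R * m%:R ^+ 2 / n%:R - m%:R.
Proof. by rewrite /simplex_trace; field; rewrite n0 N1. Qed.

(** Not scalar in general: only its blocks of frequency 0 are prescribed, and averaging over the
    rotations removes the others. *)
Let total i j : R := weighted_sum (fun Y => Y i j).
Let uniform (i j : nat) : R := if (i == j) && ~~ dead i then z else 0.

Lemma uniform_good : good uniform.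
Proof.
split=> [i j _ _|i b _ hb]; rewrite /uniform.
  by rewrite eq_sym; case: eqP => // ->.
have [e1 e2 e3 e4] := plane_half b.
by case: eqP => // ->; rewrite /dead_coord e2 e4; case/andP: hb => ->.
Qed.

Lemma total_good : good total.
Proof.
split=> [i j Hi Hj|i b Hi Hb]; rewrite /total /weighted_sum.
  congr (_ + _ * _); apply: eq_bigr => a _.
    by have [[s _] _ _ _] := P_proj (ltn_ord a); apply: s.
  by have [[s _] _ _ _] := Q_proj (ltn_ord a); apply: s.
rewrite !big1 ?mulr0 ?addr0 // => a _.
  by have [[_ s] _ _ _] := Q_proj (ltn_ord a); apply: s.
by have [[_ s] _ _ _] := P_proj (ltn_ord a); apply: s.
Qed.

(** Indexing the orbits and the invariant subspaces by one sum type makes [total] a single linear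
    combination, through which any linear functional passes. *)
Lemma total_lin (F : (nat -> nat -> R) -> R) : 
  (forall (I : Type) (r : seq I) (c : I -> R) (G : I -> nat -> nat -> R),
     F (fun i j => \sum_(x <- r) c x * G x i j) = \sum_(x <- r) c x * F (G x)) ->
  (forall Y Y', (forall i j, Y i j = Y' i j) -> F Y = F Y') ->
  F total = weighted_sum F.
Proof.
move=> lin ext; pose G (x : 'I_k + 'I_nf) := match x with inl a => P a | inr j => Q j end.
pose cc (x : 'I_k + 'I_nf) : R := match x with inl a => 1 | inr j => p%:R^-1 end.
have E (H : (nat -> nat -> R) -> R) : \sum_x cc x * H (G x) = weighted_sum H.
  rewrite big_sumType /= /weighted_sum mulr_sumr; congr (_ + _).
  by apply: eq_bigr => a _; rewrite mul1r.
by rewrite -E -lin; apply: ext => i j; rewrite /total -E.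
Qed.

Lemma cf_ext Y Y' e : (forall i j, Y i j = Y' i j) -> cf Y e = cf Y' e.
Proof. by move=> H; rewrite /cf /coef !H. Qed.

Lemma total_cf1 e : (cf total e).1 = weighted_sum (fun Y => (cf Y e).1).
Proof. by apply: (@total_lin (fun Y => (cf Y e).1)) => [I r a G|Y Y' /cf_ext ->]; rewrite ?cf_lin. Qed.
Lemma total_cf2 e : (cf total e).2 = weighted_sum (fun Y => (cf Y e).2).
Proof. by apply: (@total_lin (fun Y => (cf Y e).2)) => [I r a G|Y Y' /cf_ext ->]; rewrite ?cf_lin. Qed.

Definition diag_part (Y : nat -> nat -> R) b : R :=
  Y (2 * b)%N (2 * b)%N + (if (b < t - h)%N then Y (2 * b).+1 (2 * b).+1 else 0).

Lemma cf_diag Y e : ta e = tb e -> ~~ tanti e -> cf Y e = (diag_part Y (tb e), 0).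
Proof.
rewrite /cf /coef /diag_part => -> /negbTE ->; rewrite eqxx.
by case: ifP => _; rewrite ?addr0.
Qed.

Lemma trace_diag Y : good Y -> \tr (mxof Y) = \sum_(b < t) diag_part Y b.
Proof.
move=> [_ dY]; rewrite /mxtrace; under eq_bigr => i _ do rewrite mxE.
rewrite (sum_planes (fun i => Y i i)); apply: eq_bigr => b _; rewrite /diag_part.
case: ltnP => // hb; congr (_ + _); apply: dY; last by rewrite hb ltn_ord.
by have := ltn_ord b; lia.
Qed.

Lemma diag_uniform b : (b < t)%N -> diag_part uniform b = (if (b < t - h)%N then 2 else 1) * z.
Proof.
move=> Hb; have [e1 e2 e3 e4] := plane_half b; rewrite /diag_part /uniform !eqxx /dead_coord e2 e3 e4 /=.
by rewrite -ltnNge; case: ltnP => _; ring.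
Qed.

Lemma trace_total : \tr (mxof total) = n%:R * z.
Proof.
rewrite trace_diag; last exact: total_good.
have -> : \sum_(b < t) diag_part total b = weighted_sum (fun Y => \sum_(b < t) diag_part Y b).
  apply: (@total_lin (fun Y => \sum_(b < t) diag_part Y b)) => [I r a G|Y Y' H].
    under [RHS]eq_bigr => x _ do rewrite mulr_sumr.
    rewrite exchange_big; apply: eq_bigr => b _; rewrite /diag_part.
    case: ifP => _; first by rewrite -big_split; apply: eq_bigr => x _ /=; ring.
    by rewrite addr0; apply: eq_bigr => x _; rewrite addr0.
  by apply: eq_bigr => b _; rewrite /diag_part !H.
rewrite /weighted_sum (eq_bigr (fun=> m%:R)) => [|a _]; last first.
  by have [g _ _ <-] := P_proj (ltn_ord a); rewrite trace_diag.
rewrite [in X in _ + X](eq_bigr (fun=> m%:R)) => [|a _]; last first.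
  by have [g _ _ <-] := Q_proj (ltn_ord a); rewrite trace_diag.
rewrite !sumr_const !card_ord -![m%:R *+ _]mulr_natl /z NR; field.
by rewrite n0 pR0.
Qed.

Lemma trace_uniform : \tr (mxof uniform) = n%:R * z.
Proof.
rewrite -(sum_live R n_live h_le) mulr_suml; apply: eq_bigr => i _.
by rewrite mxE /uniform eqxx; case: (dead i); rewrite /= ?mul0r ?mul1r.
Qed.

(** The equations settle every plane except the last, and the trace of [total] settles that one. *)
Lemma total_diag b : (b < t)%N -> diag_part total b = diag_part uniform b.
Proof.
have H b' : (b' < t.-1)%N -> diag_part total b' = diag_part uniform b'.
  move=> Hb; have Hb' : (b' < t)%N by lia.
  have [e He [h1 h2 h3]] := diag_tag p h Hb'.
  have [_ _ _ h4 _] := tag_ok (w := w) (h := h) p0 He.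
  have h5 : ta (nth tag0 tg e) = tb (nth tag0 tg e) by rewrite h1 h2.
  have := sum_eq He (h4 h5 h3); rewrite h1 h2 eqxx h3 => /(_ Hb).
  by rewrite -total_cf1 cf_diag //= h2 diag_uniform.
case: (ltnP b t.-1) => [/H //|h1 h2].
have split_last (F : nat -> R) : \sum_(i < t) F i = \sum_(i < t.-1) F i + F b.
  by rewrite (_ : t = b.+1) ?big_ord_recr //; lia.
have := trace_total; rewrite -trace_uniform (trace_diag total_good) (trace_diag uniform_good).
rewrite (split_last (diag_part total)) (split_last (diag_part uniform)).
rewrite (eq_bigr (fun i : 'I_t.-1 => diag_part uniform i)) => [|i _]; last exact: H.
exact: addrI.
Qed.

Lemma off_diag_uniform e : (ta e <= tb e)%N -> (tanti e -> (tb e < t - h)%N) ->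
  ~~ ((ta e == tb e) && ~~ tanti e) -> cf uniform e = (0, 0).
Proof.
move=> h1 h5; rewrite /cf /coef; case: eqP => [e1 /=|ne _].
  rewrite negbK => an; rewrite (h5 an) an e1 /uniform !eqxx /dead_coord.
  have [e2 e3 e4 e5] := plane_half (tb e); rewrite e3 e4 e5 /= -ltnNge (h5 an) subrr.
  have -> : (2 * tb e == (2 * tb e).+1)%N = false by lia.
  by rewrite /= addr0 /signed /= subr0 if_same.
have -> : uniform (2 * ta e)%N (2 * tb e)%N = 0 by rewrite /uniform ifF //; lia.
have -> : uniform (2 * ta e).+1 (2 * tb e).+1 = 0 by rewrite /uniform ifF //; lia.
have -> : uniform (2 * ta e)%N (2 * tb e).+1 = 0 by rewrite /uniform ifF //; lia.
have -> : uniform (2 * ta e).+1 (2 * tb e)%N = 0 by rewrite /uniform ifF //; lia.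
by case: (tb e < t - h)%N; case: (tanti e); case: (tsign e); rewrite /signed /= ?subr0 ?addr0 ?subr0.
Qed.

Lemma total_cf e : (e < size tg)%N -> tfreq (nth tag0 tg e) = 0%N ->
  cf total (nth tag0 tg e) = cf uniform (nth tag0 tg e).
Proof.
move=> He fe; have := sum_eq He fe; have [h1 h2 h3 h4 h5] := tag_ok (w := w) (h := h) p0 He.
move: (nth tag0 tg e) h1 h2 h3 h4 h5 fe => x h1 h2 h3 h4 h5 fe.
case: ifP => [/andP[/eqP e1 e2] _|ne]; first by rewrite !cf_diag // total_diag.
rewrite -total_cf1 -total_cf2 (off_diag_uniform h1 h5 (negbT ne)).
by case: (cf total x) => a b /= [-> ->].
Qed.

(** A coefficient at frequency 0 sees only blocks of frequency 0, on which [total] may be replaced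
    by [uniform]. As [uniform] has no other blocks, that coefficient is the full double trace of
    [uniform] times Y, namely 2 z tr Y. *)
Lemma weighted_cos Y : proj_of Y -> weighted_sum (fun X => cosC X Y 0%N) = 2 * (m%:R * z).
Proof.
move=> [gY _ _ trY]; have eT : cosC total Y 0%N = cosC uniform Y 0%N.
  rewrite /cosC !(big_nth tag0) !big_mkord; apply: eq_bigr => e /eqP fe.
  by rewrite total_cf.
have <- : cosC total Y 0%N = weighted_sum (fun X => cosC X Y 0%N).
  apply: (@total_lin (fun X => cosC X Y 0%N)) => [I r a G|X X' H]; first exact: cosC_lin.
  by apply: eq_bigr => e _; rewrite (cf_ext e H).
have uf f : (0 < f)%N -> forall e, (e < size tg)%N -> tfreq (nth tag0 tg e) = f ->
    cf uniform (nth tag0 tg e) = (0, 0).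
  move=> f0 e He fe; have [h1 h2 h3 h4 h5] := tag_ok (w := w) (h := h) p0 He.
  move: (nth tag0 tg e) h1 h2 h3 h4 h5 fe => x h1 h2 h3 h4 h5 fe.
  case: (boolP ((ta x == tb x) && ~~ tanti x)) => [/andP[/eqP e1 /(h4 e1)]|ne]; first by lia.
  exact: off_diag_uniform.
have := rtraceE rot p_gt1 w_lt w_half 0 uniform_good gY.
rewrite big_ord_recl /= big1 => [|f _]; last first.
  have z1 : cosC uniform Y (bump 0 f) = 0.
    rewrite /cosC (big_nth tag0) big_mkord big1 // => e /eqP fe.
    by rewrite (uf _ _ _ _ fe) //= !mul0r addr0 mulr0.
  have z2 : sinC uniform Y (bump 0 f) = 0.
    rewrite /sinC (big_nth tag0) big_mkord big1 // => e /eqP fe.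
    by rewrite (uf _ _ _ _ fe) //= !mul0r subr0 mulr0.
  by rewrite z1 z2 !mul0r subr0.
rewrite muln0 (rot_co0 rot) (rot_si0 rot) mulr1 mulr0 subr0 addr0 eT => <-; congr (_ * _).
rewrite /rtrace (rotm0 rot) mul1mx trmx1 mulmx1 -trY mulrC -mxtraceZ; congr (\tr _).
apply/matrixP => i j; rewrite !mxE (bigD1 i) //= big1 ?addr0 => [|l li]; last first.
  by rewrite !mxE /uniform -val_eqE eq_sym in li *; rewrite (negbTE li) mul0r.
rewrite !mxE /uniform eqxx /=; case: (boolP (dead i)) => //= di; rewrite mul0r.
have [sY dY] := gY; rewrite sY // ?ltn_ord //.
have e : nat_of_ord i = (2 * i./2).+1 by case/andP: di => o _; lia.
rewrite e dY ?mulr0 //; case/andP: di => _ ->; have := ltn_ord i; lia.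
Qed.

Lemma sum_delta (s i0 : nat) (x : R) : (i0 < s)%N ->
  \sum_(i < s) (if nat_of_ord i == i0 then x else 0) = x.
Proof.
by move=> H; rewrite -big_mkcond (big_pred1 (Ordinal H)) // => i; rewrite -val_eqE.
Qed.

Lemma cos_PQ_pos a j : (0 < a < k)%N -> (j < nf)%N -> cosC (Q j) (P a) 0%N = 2 * c.
Proof. by move=> ha hj; rewrite cosC_sym fix_eq. Qed.

(** The trivial rotation, together with idempotence: one relation between the coefficients of Y,
    from which a single missing frequency can be recovered. *)
Lemma trace_self Y : proj_of Y ->
  2 * m%:R = \sum_(f < p./2.+1) cosC Y Y f.
Proof.
move=> [gY _ idY <-]; have := rtraceE rot p_gt1 w_lt w_half 0 gY gY.
rewrite /rtrace (rotm0 rot) mul1mx trmx1 mulmx1 idY => ->; apply: eq_bigr => f _.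
by rewrite muln0 (rot_co0 rot) (rot_si0 rot) mulr1 mulr0 subr0.
Qed.

Lemma sum_wt : \sum_(f < p./2.+1) wt R p f = p%:R.
Proof.
transitivity (\sum_(f < p) (1 : R)); last by rewrite sumr_const card_ord.
rewrite -(sum_fold p_gt1 (g := fun=> 1)) //.
by apply: eq_bigr => f _; rewrite mulr1.
Qed.

Lemma self_wt a f : (a < k)%N -> ((if a == 0 then 2 else 1) <= f)%N -> (2 * f <= p)%N ->
  cosC (P a) (P a) f = 2 * (m%:R - c) / p%:R * wt R p f.
Proof.
move=> ha hf fp; rewrite self_eq // /wt.
have -> : (f == 0)%N = false by case: ifP hf => _; lia.
by case: eqP => _ /=; field; apply: pR0.
Qed.

Lemma sum_but (s i0 : nat) (F : nat -> R) (x : R) : (i0 < s)%N ->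
  (forall i, (i < s)%N -> i != i0 -> F i = x) -> \sum_(i < s) F i = F i0 + (s%:R - 1) * x.
Proof.
move=> H E; rewrite (bigD1 (Ordinal H)) //=; congr (_ + _).
rewrite (eq_bigr (fun=> x)) => [|i hi]; last by apply: E.
rewrite sumr_const cardC1 card_ord -[x *+ _]mulr_natl; congr (_ * _).
by rewrite -subn1 natrB // (leq_ltn_trans _ H).
Qed.

Lemma self_zero a : (0 < a < k)%N -> cosC (P a) (P a) 0%N = 2 * c + 2 * (m%:R - c) / p%:R.
Proof.
case/andP=> a0 ak; have := trace_self (P_proj ak).
have := sum_wt; rewrite !big_ord_recl /= {1}/wt eqxx /= => W.
under eq_bigr => f _.
  have Hf := ltn_ord f.
  rewrite self_wt ?gtn_eqF //; last by rewrite /bump /=; lia.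
  over.
rewrite -mulr_sumr => /esym E.
have {}W : \sum_(i < p./2) wt R p (bump 0 i) = p%:R - 1 by rewrite -W addrC addKr.
rewrite W in E; have {}E : cosC (P a) (P a) 0%N = 2 * m%:R - 2 * (m%:R - c) / p%:R * (p%:R - 1).
  by rewrite -E; ring.
by rewrite E; field; apply: pR0.
Qed.

(** The trace of one projection against the sum of all of them, counted in two ways: N m^2 / n
    because the sum is scalar, and c (N - 1) + m pair by pair. *)
Lemma relation : 2 * (m%:R * z) = 2 * c * (N%:R - 1) / p%:R + 2 * m%:R / p%:R.
Proof. by rewrite -[2 * c * _]mulrA cE /z; field; rewrite n0 pR0. Qed.

Lemma cross_all a b : (a < b < k)%N -> cosC (P a) (P b) 0%N = 2 * c.
Proof.
case/andP => ab bk; case: (posnP a) => [a0|a0]; last by apply: cross_eq; rewrite ?ab.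
rewrite {a}a0 in ab *; have := weighted_cos (P_proj bk); rewrite relation /weighted_sum.
rewrite (eq_bigr (fun j : 'I_nf => 2 * c)) => [|j _]; last first.
  by apply: cos_PQ_pos; rewrite ?ab.
rewrite sumr_const card_ord -[(2 * c) *+ _]mulr_natl.
(* Subtracting the excess of the self term makes all summands equal to 2 c except the unknown one of
   orbit 0, for which the relation is then solved. *)
pose F a := cosC (P a) (P b) 0%N - (if a == b then 2 * (m%:R - c) / p%:R else 0).
have -> : \sum_(a < k) cosC (P a) (P b) 0%N = \sum_(a < k) F a + 2 * (m%:R - c) / p%:R.
  rewrite -[X in _ = _ + X](sum_delta _ bk) -big_split.
  by apply: eq_bigr => i _ /=; rewrite subrK.
rewrite (@sum_but k 0 F (2 * c)) // => [|i ik i0]; last first.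
  rewrite /F; case: eqP => [->|/eqP ib]; first by rewrite self_zero ?ab //; ring.
  rewrite subr0; have [ltib|ltbi|/eqP] := ltngtP i b; last by rewrite (negbTE ib).
    by apply: cross_eq; rewrite ?lt0n // ltib.
  by rewrite cosC_sym; apply: cross_eq; rewrite ?ltbi.
rewrite /F (ltn_eqF ab) subr0 NR => E.
have {}E : cosC (P 0) (P b) 0%N = 2 * c * (k%:R * p%:R + nf%:R - 1) / p%:R + 2 * m%:R / p%:R -
  (k%:R - 1) * (2 * c) - 2 * (m%:R - c) / p%:R - p%:R^-1 * (nf%:R * (2 * c)) by rewrite -E; ring.
by rewrite E; field; apply: pR0.
Qed.

Lemma fix_self j : (j < nf)%N -> cosC (Q j) (Q j) 0%N = 2 * m%:R.
Proof.
move=> hj; rewrite (trace_self (Q_proj hj)) big_ord_recl big1 ?addr0 // => f _.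
rewrite /cosC (big_nth tag0) big_mkord big1 // => e /eqP fe.
by rewrite Q_flat ?fe //= !mul0r addr0 mulr0.
Qed.

(** For orbit 0 the sum relation against the j-th invariant subspace leaves a single unknown
    term. *)
Lemma fix_all a j : (a < k)%N -> (j < nf)%N -> cosC (P a) (Q j) 0%N = 2 * c.
Proof.
case: (posnP a) => [->|a0] ak hj; last by apply: fix_eq; rewrite ?a0.
have := weighted_cos (Q_proj hj); rewrite relation /weighted_sum.
rewrite (@sum_but k 0 (fun a => cosC (P a) (Q j) 0%N) (2 * c)) // => [|i ik i0]; last first.
  by apply: fix_eq; rewrite ?lt0n ?i0.
rewrite (@sum_but nf j (fun i => cosC (Q i) (Q j) 0%N) (2 * c)) // => [|i ik ij]; last first.
  have [ltij|ltji|/eqP] := ltngtP i j; last by rewrite (negbTE ij).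
    by apply: Q_pair; rewrite ltij.
  by rewrite cosC_sym; apply: Q_pair; rewrite ltji.
rewrite fix_self // NR => E.
have {}E : cosC (P 0) (Q j) 0%N = 2 * c * (k%:R * p%:R + nf%:R - 1) / p%:R + 2 * m%:R / p%:R -
  (k%:R - 1) * (2 * c) - p%:R^-1 * (2 * m%:R + (nf%:R - 1) * (2 * c)) by rewrite -E; ring.
by rewrite E; field; apply: pR0.
Qed.

(** The same relation against orbit 0 itself; it requires all cross terms, so it comes after
    [cross_all] and [fix_all]. *)
Lemma self_zero0 : cosC (P 0) (P 0) 0%N = 2 * c + 2 * (m%:R - c) / p%:R.
Proof.
have := weighted_cos (P_proj k_gt0); rewrite relation /weighted_sum.
rewrite (@sum_but k 0 (fun a => cosC (P a) (P 0) 0%N) (2 * c)) // => [|i ik i0]; last first.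
  by rewrite cosC_sym; apply: cross_all; rewrite lt0n i0.
rewrite (eq_bigr (fun j : 'I_nf => 2 * c)) => [|j _]; last first.
  by rewrite cosC_sym; apply: fix_all.
rewrite sumr_const card_ord -[(2 * c) *+ _]mulr_natl NR => E.
have {}E : cosC (P 0) (P 0) 0%N = 2 * c * (k%:R * p%:R + nf%:R - 1) / p%:R + 2 * m%:R / p%:R -
  (k%:R - 1) * (2 * c) - p%:R^-1 * (nf%:R * (2 * c)) by rewrite -E; ring.
by rewrite E; field; apply: pR0.
Qed.

Lemma self_all a f : (a < k)%N -> (2 * f <= p)%N ->
  cosC (P a) (P a) f = (if (f == 0)%N then 2 * c else 0) + 2 * (m%:R - c) / p%:R * wt R p f.
Proof.
move=> ak fp; case: (posnP f) => [->|f0].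
  rewrite /wt eqxx mulr1; case: (posnP a) => [->|a0]; first exact: self_zero0.
  by rewrite self_zero ?a0.
rewrite add0r; case: (posnP a) => [a0|a0]; last by rewrite self_wt // gtn_eqF.
case: (ltnP 1 f) => f1; first by rewrite self_wt // a0.
(* The last coefficient left out, frequency 1 of orbit 0, is what [trace_self] leaves once all other
   frequencies are known. *)
have -> : f = 1%N by lia.
rewrite a0; have := trace_self (P_proj k_gt0); have := sum_wt.
have -> : p./2 = (p./2).-1.+1 by lia.
rewrite !big_ord_recl /= {1}/wt eqxx /= => W.
under eq_bigr => i _.
  have Hi := ltn_ord i.
  rewrite self_wt //; last by rewrite /bump /=; lia.
  over.
rewrite -mulr_sumr self_zero0 => /esym E.
have {}W : \sum_(i < p./2.-1) wt R p (bump 0 (bump 0 i)) = p%:R - 1 - wt R p (bump 0 0).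
  by rewrite -W; ring.
rewrite W in E.
have {}E : cosC (P 0) (P 0) (bump 0 0) = 2 * m%:R - (2 * c + 2 * (m%:R - c) / p%:R) -
  2 * (m%:R - c) / p%:R * (p%:R - 1 - wt R p (bump 0 0)) by rewrite -E; ring.
by rewrite -[X in cosC _ _ X]/(bump 0 0) E -[X in wt _ _ X]/(bump 0 0); field; apply: pR0.
Qed.

(** The angle is a multiple of pi, which is why no sine equation is posed at the frequency p / 2. *)
Lemma half_sin f r : (2 * f = p)%N -> si (f * r)%N = 0.
Proof.
move=> fp; have fle : (f <= p)%N by lia.
have [_] := rot_opp rot r fle; have -> : (p - f = f)%N by lia.
by move=> E; lra.
Qed.

Lemma rtrace_flat Y Y' r : good Y -> good Y' -> cosC Y Y' 0 = 2 * c ->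
  (forall f, (0 < f)%N -> (2 * f <= p)%N -> cosC Y Y' f = 0) ->
  (forall f, (0 < f)%N -> (2 * f < p)%N -> sinC Y Y' f = 0) -> rtrace Y Y' r = c.
Proof.
move=> g g' C0 C S; have := rtraceE rot p_gt1 w_lt w_half r g g'.
rewrite big_ord_recl /= mul0n (rot_co0 rot) (rot_si0 rot) mulr1 mulr0 subr0 C0.
rewrite big1 ?addr0 => [|f _].
  by move/mulfI => -> //; rewrite pnatr_eq0.
have Hf := ltn_ord f; rewrite C ?mul0r ?sub0r; [|by []|by rewrite /bump /=; lia].
have [lt|eq] : (2 * bump 0 f < p)%N \/ (2 * bump 0 f = p)%N by rewrite /bump /=; lia.
  by rewrite S // mul0r oppr0.
by rewrite half_sin // mulr0 oppr0.
Qed.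

Lemma sinC_sym Y Y' f : sinC Y Y' f = - sinC Y' Y f.
Proof. by rewrite /sinC -sumrN; apply: eq_bigr => e _; ring. Qed.

Lemma rtrace_cross a b r : (a < k)%N -> (b < k)%N -> a != b -> rtrace (P a) (P b) r = c.
Proof.
move=> ak bk ab; have [ga _ _ _] := P_proj ak; have [gb _ _ _] := P_proj bk.
have {ab} [lt|lt] : (a < b < k)%N \/ (b < a < k)%N by lia.
  apply: rtrace_flat => // [|f f0 fp|f f0 fp]; [exact: cross_all|exact: cos_eq|exact: sin_eq].
apply: rtrace_flat => // [|f f0 fp|f f0 fp].
- by rewrite cosC_sym cross_all.
- by rewrite cosC_sym cos_eq.
- by rewrite sinC_sym sin_eq ?oppr0.
Qed.

Lemma cosC_fix Y j f : (j < nf)%N -> (0 < f)%N -> cosC Y (Q j) f = 0 /\ sinC Y (Q j) f = 0.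
Proof.
move=> hj f0; split; rewrite /cosC /sinC (big_nth tag0) big_mkord big1 // => e /eqP fe;
rewrite Q_flat ?fe -?lt0n //= !mulr0 ?addr0 ?subr0 ?mulr0 //.
Qed.

Lemma rtrace_fix a j r : (a < k)%N -> (j < nf)%N -> rtrace (P a) (Q j) r = c.
Proof.
move=> ak hj; have [ga _ _ _] := P_proj ak; have [gj _ _ _] := Q_proj hj.
apply: rtrace_flat => // [|f f0 fp|f f0 fp]; first exact: fix_all.
- by have [] := cosC_fix (P a) hj f0.
- by have [] := cosC_fix (P a) hj f0.
Qed.

Lemma rtrace_fix_sym a j r : (a < k)%N -> (j < nf)%N -> rtrace (Q j) (P a) r = c.
Proof.
move=> ak hj; have [ga _ _ _] := P_proj ak; have [gj _ _ _] := Q_proj hj.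
apply: rtrace_flat => // [|f f0 fp|f f0 fp]; first by rewrite cosC_sym fix_all.
- by rewrite cosC_sym; have [] := cosC_fix (P a) hj f0.
- by rewrite sinC_sym; have [_ ->] := cosC_fix (P a) hj f0; rewrite oppr0.
Qed.

Lemma rtrace_pair i j r : (i < nf)%N -> (j < nf)%N -> i != j -> rtrace (Q i) (Q j) r = c.
Proof.
move=> hi hj ij; have [gi _ _ _] := Q_proj hi; have [gj _ _ _] := Q_proj hj.
apply: rtrace_flat => // [|f f0 fp|f f0 fp].
- have {ij} [lt|lt] : (i < j < nf)%N \/ (j < i < nf)%N by lia.
    exact: Q_pair.
  by rewrite cosC_sym Q_pair.
- by have [] := cosC_fix (Q i) hj f0.
- by have [] := cosC_fix (Q i) hj f0.
Qed.

(** Apart from the constant 2 c, the coefficients are proportional to those of the indicator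
    function of the multiples of p, which vanishes at r. *)
Lemma rtrace_self a r : (a < k)%N -> ~~ (p %| r)%N -> rtrace (P a) (P a) r = c.
Proof.
move=> ak pr; have [ga _ _ _] := P_proj ak; have := rtraceE rot p_gt1 w_lt w_half r ga ga.
have S f : sinC (P a) (P a) f = 0 by rewrite /sinC big1 // => e _; rewrite [_.1 * _]mulrC subrr mulr0.
have E : \sum_(f < p./2.+1) wt R p f * co (f * r)%N = 0.
  rewrite (sum_fold p_gt1 (g := fun f => co (f * r)%N)) ?(rot_sum rot) // => f fp.
  by have [] := rot_opp rot r fp.
under eq_bigr => f _.
  rewrite S mul0r subr0 self_all //; last by have := ltn_ord f; lia.
  rewrite mulrDl -[_ * wt _ _ _ * _]mulrA.
  over.
rewrite big_split /= -mulr_sumr E mulr0 addr0 big_ord_recl /= mul0n (rot_co0 rot) mulr1.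
rewrite big1 ?addr0 => [|f _]; last by rewrite mul0r.
by move/mulfI => -> //; rewrite pnatr_eq0.
Qed.

(** Equality would amount to N m (n - m) = 0. This is what makes the subspaces distinct: equal ones
    would have product of trace m. *)
Lemma simplex_trace_neq : c != m%:R.
Proof.
apply/eqP => e; have := cE; rewrite e => E.
have {}E : N%:R * m%:R * (n%:R - m%:R) = 0 :> R.
  have <- : n%:R * (m%:R * (N%:R - 1) - (N%:R * m%:R ^+ 2 / n%:R - m%:R)) = N%:R * m%:R * (n%:R - m%:R) :> R.
    by field; apply: n0.
  by rewrite E subrr mulr0.
move/eqP: E; rewrite !mulf_eq0 subr_eq0 !pnatr_eq0 eqr_nat; have := N_gt1; lia.
Qed.

Definition base_proj (i : nat) := if (i < k * p)%N then P (i %/ p)%N else Q (i - k * p)%N.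
Definition shift (i : nat) : nat := if (i < k * p)%N then (i %% p)%N else 0%N.
Definition point (i : nat) : 'M[R]_d := rotm (shift i) *m mxof (base_proj i) *m (rotm (shift i))^T.

Lemma shift_lt i : (shift i < p)%N.
Proof. by rewrite /shift; case: ifP => _ //; rewrite ltn_mod. Qed.

Lemma div_lt i : (i < k * p)%N -> (i %/ p < k)%N.
Proof. by rewrite ltn_divLR. Qed.

Lemma base_projP i : (i < N)%N -> proj_of (base_proj i).
Proof.
move=> hi; rewrite /base_proj; case: ifP => h1; first exact: P_proj (div_lt h1).
by apply: Q_proj; move: hi h1; rewrite NE; lia.
Qed.

Lemma point_proj i : (i < N)%N ->
  [/\ (point i)^T = point i, point i *m point i = point i, \tr (point i) = m%:R &
    point i *m live_mx R w h = point i].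
Proof.
move=> hi; have [[gs gd] sP iP tP] := base_projP hi; rewrite /point.
have [o1 o2] := rotm_orth rot w (ltnW (shift_lt i)).
set r := rotm _ in o1 o2 *; split.
- by rewrite !trmx_mul trmxK sP mulmxA.
- by rewrite !mulmxA -(mulmxA _ r^T r) o2 mulmx1 -(mulmxA r _ (mxof _)) iP.
- by rewrite mxtrace_mulC mulmxA o2 mul1mx.
have rl : r^T *m live_mx R w h = live_mx R w h *m r^T.
  by rewrite /r (rotm_tr rot) ?(rotm_live rot w_half) // ltnW ?shift_lt.
rewrite -mulmxA rl !mulmxA; congr (_ *m _); rewrite -mulmxA; congr (_ *m _).
apply/matrixP => a b; rewrite mul_live mxE; case: (boolP (dead b)) => db; last by rewrite mulr1.
have e : nat_of_ord b = (2 * b./2).+1 by case/andP: db => o _; lia.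
rewrite mulr0 e gd //; case/andP: db => _ ->; have := ltn_ord b; lia.
Qed.

Lemma point_trace i j : (i < N)%N -> (j < N)%N -> i != j -> \tr (point i *m point j) = c.
Proof.
move=> hi hj ij; have si' := shift_lt i; have sj := shift_lt j.
have -> : \tr (point i *m point j) =
    rtrace (base_proj i) (base_proj j) (p - shift i + shift j).
  rewrite /rtrace /point -(rotmM rot) -(rotm_tr rot w (ltnW si')) !trmx_mul trmxK.
  by rewrite -!mulmxA mxtrace_mulC !mulmxA.
rewrite /base_proj /shift; case: ifP => h1; case: ifP => h2.
- have [e|ne] := eqVneq (i %/ p)%N (j %/ p)%N; last by apply: rtrace_cross => //; apply: div_lt.
  rewrite e; apply: rtrace_self; first exact: div_lt.
  apply/negP => /dvdnP[q E]; have hi' := divn_eq i p; have hj' := divn_eq j p.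
  have r1 := ltn_pmod i p0; have r2 := ltn_pmod j p0.
  (* The exponent lies strictly between 0 and 2 p, so a multiple of p must be p itself, which forces
     equal shifts. *)
  have q1 : q = 1%N by nia.
  move/eqP: ij; apply; rewrite hi' hj' e; congr (_ + _)%N; rewrite q1 in E; lia.
- by apply: rtrace_fix; [apply: div_lt|move: hj h2; rewrite NE; lia].
- by apply: rtrace_fix_sym; [apply: div_lt|move: hi h1; rewrite NE; lia].
- by apply: rtrace_pair; move: hi hj h1 h2 ij; rewrite NE; lia.
Qed.

Theorem tight_simplex_of_orbits : exists X : 'I_N -> 'M[R]_n, tight_simplex m X.
Proof.
have [E EE] := live_selection R n_live h_le.
pose X (i : 'I_N) := E *m point i *m E^T.
have trX i j : \tr (X i *m X j) = \tr (point i *m point j).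
  have [_ _ _ l1] := point_proj (ltn_ord i); have [_ _ _ l2] := point_proj (ltn_ord j).
  rewrite /X; move: (point i) (point j) l1 l2 => A B l1 l2.
  rewrite !mulmxA -(mulmxA _ E^T E) EE -(mulmxA E _ (live_mx _ _ _)) l1.
  by rewrite mxtrace_mulC !mulmxA EE mxtrace_mulC mulmxA l2 mxtrace_mulC.
have pX i : [/\ (X i)^T = X i, X i *m X i = X i & \tr (X i) = m%:R].
  have [s1 s2 s3 l1] := point_proj (ltn_ord i); rewrite /X.
  move: (point i) s1 s2 s3 l1 => A s1 s2 s3 l1; split.
  - by rewrite !trmx_mul trmxK s1 mulmxA.
  - by rewrite !mulmxA -(mulmxA _ E^T E) EE -(mulmxA E _ (live_mx _ _ _)) l1 -(mulmxA E) s2.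
  - by rewrite mxtrace_mulC mulmxA EE mxtrace_mulC l1.
exists X; split; [|split] => [i j e|i|i j ij].
- apply/eqP/negPn/negP => ij; move/eqP: simplex_trace_neq; apply.
  rewrite -(point_trace (ltn_ord i) (ltn_ord j) ij) -trX -e.
  by have [_ -> ->] := pX i.
- by have [s1 s2 s3] := pX i.
- by rewrite trX point_trace.
Qed.
End FourierSolution.

(** * Soundness of the check *)

Section Soundness.
Variables (R : realType) (m n N : nat) (D : case).
Local Notation arithR := (arithR R).
Local Notation zr := (zr R).
Local Notation p := (period D).
Local Notation w := (weights D).
Local Notation h := (halves D).
Local Notation t := (size (weights D)).
Local Notation d := (2 * size (weights D))%N.
Local Notation nf := (size (fixed D)).
Local Notation tg := (tags (period D) (weights D) (halves D)).
Local Notation k := ((N - size (fixed D)) %/ period D)%N.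

(** Needed because the program tabulates only a triangle of each projection. *)
Lemma coef_ext (Y Y' : nat -> nat -> R) e : (ta e <= tb e)%N -> (tb e < t)%N ->
  (forall i j, (i <= j < d)%N -> Y i j = Y' i j) -> cf w h Y e = cf w h Y' e.
Proof.
move=> ab bt H; rewrite /cf /coef; case: eqP => [->|ne].
  by rewrite !H //; lia.
by rewrite !H //; lia.
Qed.

Lemma coefs_ofE B e : (0 < p)%N -> (e < size tg)%N ->
  nth (0, 0) (coefs_of arithR m D B) e = cf w h (proj_entry arithR m B) (nth tag0 tg e).
Proof.
move=> p0 He; have [h1 h2 _ _ _] := tag_ok (w := w) (h := h) p0 He.
rewrite /coefs_of /coefs (nth_map tag0) //; apply: coef_ext => // i j /andP[ij jd].
by rewrite /proj_table !nth_mkseq.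
Qed.

Lemma mem_freqs lo f : (lo <= f)%N -> (2 * f <= p)%N -> f \in freqs p lo.
Proof. by move=> h1 h2; rewrite mem_filter h1 mem_iota /=; lia. Qed.

(** Since 0 is even, a zero entry is always a constant and never an unknown; dead coordinates
    therefore stay 0 at the exact solution. *)
Lemma load_zero (var : nat -> Z -> R) j zs i : nth Z0 zs i = Z0 -> nth 0 (load arithR var j zs) i = 0.
Proof.
elim: zs j i => [|x zs IH] j [|i] //=; first by move=> -> /=; rewrite zr0 mul0r.
by move=> H; case: ifP => _ /=; apply: IH.
Qed.

Lemma gram_schmidt_proj (x : nat -> nat -> R) : let g := gram_schmidt arithR d m x in
  (forall a, a \in g.2 -> a != 0) ->
  (forall c i, (c < m)%N -> (i < d)%N -> dead_coord w h i -> x c i = 0) ->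
  proj_of w h m (proj_entry arithR m g.1).
Proof.
move=> g /gram_schmidtP [_ sP iP tP dP] dx; split=> //; split=> [i j Hi Hj|i b Hi /andP[b1 b2]].
  by have := congr1 (fun A : 'M_d => A (Ordinal Hj) (Ordinal Hi)) sP; rewrite !mxE.
have [_ e1 _ e2] := plane_half b; have bd : ((2 * b).+1 < d)%N by lia.
by apply: dP => // c cm; apply: dx => //; rewrite /dead_coord e1 e2.
Qed.

Hypothesis chk : case_check m n N D.

Theorem case_check_sound : exists X : 'I_N -> 'M[R]_n, tight_simplex m X.
Proof.
case/and3P: chk => shape fixed_ok sys.
have [v /= [S0 Sw]] := system_check_sound R sys.
have [F1 F2 F3] := fixed_checkP R fixed_ok.
move: shape; rewrite /shape_check => /andP[p_gt1 /andP[/eqP NE /andP[k_gt0 /andP[/andP[/eqP nE h_le]]]]].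
move=> /andP[/andP[m_gt0 m_lt] /andP[w_lt /andP[w_half /andP[dead_e dead_f]]]].
have p0 : (0 < p)%N := ltnW p_gt1.
set xs := load arithR (fun j _ => v j) 0 (entries D).
pose P a := proj_entry arithR m (orbit_gs arithR m D xs a).1.
pose Q j := proj_entry arithR m (fixed_gs arithR m D j).1.
set X := orbit_coefs _ _ _ _ in S0; set QC := fixed_coefs _ _ _ in S0.
have XE a e : (a < k)%N -> (e < size tg)%N -> nth (0, 0) (nth [::] X a) e = cf w h (P a) (nth tag0 tg e).
  move=> ak He; rewrite /X /orbit_coefs (nth_map ([::], [::])) ?size_mkseq // nth_mkseq //.
  by rewrite coefs_ofE.
have QE j e : (j < nf)%N -> (e < size tg)%N -> nth (0, 0) (nth [::] QC j) e = cf w h (Q j) (nth tag0 tg e).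
  by move=> hj He; rewrite /QC /fixed_coefs nth_mkseq // coefs_ofE.
have P_proj a : (a < k)%N -> proj_of w h m (P a).
  move=> ak; apply: gram_schmidt_proj => [u Hu|c i cm id di].
    apply: Sw; apply/flattenP; exists (orbit_gs arithR m D xs a).2 => //.
    by apply/mapP; exists (orbit_gs arithR m D xs a) => //; apply/mapP; exists a; rewrite ?mem_iota.
  apply: load_zero; move/allP: dead_e => /(_ i); rewrite mem_iota id => /(_ isT).
  rewrite di /= => /allP /(_ (a * m + c)%N); rewrite mem_iota.
  have -> : (a * (m * d) + c * d + i = (a * m + c) * d + i)%N by rewrite mulnDl mulnA.
  have -> : (a * m + c < k * m)%N by apply: leq_trans (_ : (a.+1 * m <= _)%N); [rewrite mulSn addnC ltn_add2r|rewrite leq_mul2r ak orbT].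
  by move=> /(_ isT) /Z.eqb_eq.
have Q_proj j : (j < nf)%N -> proj_of w h m (Q j).
  move=> hj; apply: gram_schmidt_proj => [u Hu|c i cm id di]; first exact: F1 hj _ Hu.
  have /(allP dead_f)/allP/(_ i) : nth [::] (fixed D) j \in fixed D by apply: mem_nth.
  rewrite mem_iota id => /(_ isT); rewrite di /= => /allP /(_ c); rewrite mem_iota cm => /(_ isT).
  by move/Z.eqb_eq => -> /=; rewrite zr0 mul0r.
have cE : zr (cnum m n N) / zr (cden n N) = simplex_trace R m n N.
  by rewrite /cnum /cden /simplex_trace !(zrM, zrB, zr_nat, zr1).
have zr2 : zr 2%Z = 2 by exact: (zr_nat R 2).
have zr4 : zr 4%Z = 4 by exact: (zr_nat R 4).
have cross_targetE : zr (2 * cnum m n N)%Z / zr (cden n N) = 2 * simplex_trace R m n N.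
  by rewrite zrM -mulrA cE zr2.
have : all (fun q => eval_eqn arithR m n N D X QC q == 0) (case_eqs N D).
  apply/(all_nthP (ERe 0)) => i Hi; have := S0 i.
  by rewrite (nth_map (ERe 0)) // => ->.
rewrite /case_eqs /equations !all_cat !all_flatten_map => /and4P[/allP A1 /allP A2 /allP A3 /allP A4].
have pc := @cos_coefE R p w h; have ps := @sin_coefE R p w h.
have [co [si rot]] := rotation_exists R p_gt1.
have cden0 : zr (cden n N) != 0.
  rewrite /cden zrM zrB !zr_nat zr1 mulf_neq0 ?subr_eq0 ?pnatr_eq0 ?pnatr_eq1 //; first by rewrite -lt0n (leq_trans _ m_lt).
  by rewrite gtn_eqF // NE; apply: orbits_gt1.
have cr a b : (a < b < k)%N -> all (fun q => eval_eqn arithR m n N D X QC q == 0) (cross_eqs p a b).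
  case/andP => ab bk; have /A2 : a \in iota 0 k by rewrite mem_iota /=; apply: ltn_trans bk.
  by rewrite all_flatten_map => /allP; apply; rewrite mem_iota ab subnKC // (ltn_trans ab).
apply: (tight_simplex_of_orbits rot p_gt1 w_lt w_half nE h_le m_gt0 m_lt k_gt0 NE P_proj Q_proj).
- move=> a f ak af fp; have /A1 : a \in iota 0 k by rewrite mem_iota.
  rewrite all_map => /allP /(_ f (mem_freqs af fp)) /=.
  rewrite (pc _ _ (P a) (P a)) => [|e He|e He]; rewrite ?XE // subr_eq0 => /eqP ->.
  rewrite /self_target /= -cE; move: (cnum m n N) (cden n N) cden0 => cn cd cd0.
  have pR : p%:R != 0 :> R by rewrite pnatr_eq0 -lt0n.
  by rewrite !zrM zrB zrM !zr_nat; case: (_ == _); rewrite ?zr2 ?zr4; field; rewrite pR cd0.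
- move=> a b f /[dup] /andP[ab bk] /cr + f0 fp.
  rewrite all_cat all_flatten_map => /andP[_ /allP /(_ f (mem_freqs f0 fp)) /= /andP[]].
  by rewrite (gtn_eqF f0) (pc _ _ (P a) (P b)) => [/eqP|e He|e He]; rewrite ?XE // (ltn_trans ab).
- move=> a b f /[dup] /andP[ab bk] /cr + f0 fp.
  rewrite all_cat all_flatten_map => /andP[_ /allP /(_ f (mem_freqs f0 (ltnW fp))) /= /andP[_]].
  by rewrite fp /= (ps _ _ (P a) (P b)) => [/andP[/eqP]|e He|e He]; rewrite ?XE // (ltn_trans ab).
- move=> a b a0 /[dup] /andP[ab bk] /cr.
  rewrite all_cat a0 /= andbT => /andP[+ _].
  rewrite (pc _ _ (P a) (P b)) => [|e He|e He]; rewrite ?XE ?(ltn_trans ab) //.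
  by rewrite /cross_target /= cross_targetE subr_eq0 => /eqP.
- move=> a j /andP[a0 ak] hj; have /A3 : a \in iota 1 k.-1 by rewrite mem_iota a0 add1n prednK.
  rewrite all_map => /allP /(_ j); rewrite mem_iota hj => /(_ isT) /=.
  rewrite (pc _ _ (P a) (Q j)) => [|e He|e He]; rewrite ?XE ?QE //.
  by rewrite /cross_target /= cross_targetE subr_eq0 => /eqP.
- by move=> j e hj He fe; rewrite -QE // F2.
- move=> i j ij; rewrite -cross_targetE -(F3 i j ij); symmetry; case/andP: ij => ij hj.
  by apply: pc => e He; rewrite QE // (ltn_trans ij).
move=> e He x fe.
have ws (g : R * R -> R) : weighted_sum p k nf P Q (fun Y => g (cf w h Y x)) =
    asum arithR (iota 0 k) (fun a => g (nth (0, 0) (nth [::] X a) e)) +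
    inv_period arithR D * asum arithR (iota 0 nf) (fun j => g (nth (0, 0) (nth [::] QC j) e)).
  rewrite !asum_iota /inv_period /= zr1 zr_nat mul1r; congr (_ + _ * _); apply: eq_bigr => i _.
    by rewrite XE.
  by rewrite QE.
have /A4 : e \in with_freq tg 0 by rewrite mem_filter mem_iota -/x fe.
rewrite /sum_eqs -/x; case: ifP => hx.
  case: ifP => // ht /= /andP[+ _] _; rewrite (ws fst) subr_eq0 => /eqP ->.
  rewrite /sum_target hx /= zrM !zrM !zr_nat; case: ifP => _; rewrite ?zr2 ?zr1; ring.
rewrite /= /sum_target hx subr0 -(ws fst) -(ws snd) => /and3P[/eqP -> /eqP -> _] //.
Qed.
End Soundness.

(** * The solutions *)

Section Data.
Local Close Scope ring_scope.
Local Open Scope Z_scope.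
(* Found numerically, by Gauss-Newton iteration from random starting points. *)
Definition cases_2_4 : seq case := [::
Case 4 [:: 1; 0; 2]%N 2 16 8 [::] [:: 256; -128; 0; 0; 12953; 0; 0; 12953; 256; 0; 10093; 0];
Case 4 [:: 1; 0; 2]%N 2 16 8 [:: [:: 0; 0; 1; 0; 0; 0; 0; 0; 0; 0; 1; 0]] [:: 0; 256; 192; 0; 6145; 0; 256; 0; -10837; 0; -15189; 0];
Case 5 [:: 1; 2]%N 0 16 16 [:: [:: 0; 0; 1; 0; 0; 0; 0; 1]] [:: 256; 0; -1; 0; 0; -8191; 0; 256]].

Definition cases_2_5 : seq case := [::
Case 5 [:: 1; 2; 0]%N 1 16 8 [::] [:: 64; 0; 256; 0; 9145; 0; 0; 256; 0; -2953; -10173; 0];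
Case 5 [:: 1; 2; 0]%N 1 16 4 [:: [:: 0; 0; 1; 0; 0; 0; 0; 0; 0; 1; 0; 0]] [:: 128; 256; 0; 0; 11585; 0; -10033; 0; 256; 0; 10673; 0];
Case 7 [:: 1; 3; 0]%N 1 16 8 [::] [:: 0; -1; 256; 0; 10725; 0; 256; 0; 0; -4379; 8275; 0];
Case 7 [:: 2; 3; 0]%N 1 16 4 [:: [:: 0; 0; 1; 0; 0; 0; 0; 0; 0; 1; 0; 0]] [:: 256; 64; 2301; 0; -11217; 0; 0; 8675; 0; 256; 10409; 0];
Case 3 [:: 1; 1; 0]%N 1 18 2 [::] [:: 256; 3657; -11285; -27623; 0; 0; 0; 29145; 23761; 36547; 256; 0; -64; 20277; 0; 256; -28599; 0; -256; 64; 256; 0; -13605; 0; -128; 256; -28987; 0; -31491; 0; 29741; 0; -64; 256; 58183; 0];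
Case 5 [:: 1; 2; 0]%N 1 18 4 [::] [:: 0; 9075; 0; 256; -25435; 0; 256; -16161; 192; 0; -22943; 0; 256; 64; -35967; 20781; 0; 0; 0; 37593; -41593; 26109; 256; 0]].

Definition cases_2_6 : seq case := [::
Case 4 [:: 1; 1; 0; 2]%N 2 16 2 [:: [:: 1; 0; 0; 0; 0; 0; 0; 0; 0; 1; 0; 0; 0; 0; 0; 0]] [:: 4781; -5553; 0; 256; 0; 0; -12691; 0; -14693; 64; -9459; 0; 256; 0; 14655; 0];
Case 6 [:: 1; 2; 0; 3]%N 2 16 4 [::] [:: 256; 0; 11243; 0; -64; 0; -3093; 0; 0; 3981; 64; 256; -15435; 0; 14777; 0];
Case 7 [:: 1; 2; 3]%N 0 16 4 [::] [:: -2143; 0; 128; 256; -64; -15319; -64; 256; -6005; 0; 11471; 128];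
Case 7 [:: 1; 2; 3]%N 0 16 4 [:: [:: 0; 0; 1; 0; 0; 0; 0; 0; 0; 1; 0; 0]] [:: 64; 256; 64; -3717; 8629; 0; 4091; 0; 13769; 64; -64; 256];
Case 8 [:: 1; 2; 3]%N 0 16 2 [:: [:: 0; 0; 0; 0; 1; 0; 0; 0; 0; 0; 0; 1]] [:: 64; 256; -8355; 0; -6353; -321; 3411; 0; -64; 256; 11961; -128];
Case 9 [:: 2; 3; 4]%N 0 16 4 [:: [:: 0; 0; 0; 0; 1; 0; 0; 0; 0; 0; 0; 1]] [:: -1793; 0; -128; 256; 13677; 64; 64; 256; 5403; 0; -12243; 1143];
Case 5 [:: 0; 1; 2]%N 0 20 4 [:: [:: 0; 0; 1; 0; 0; 0; 0; 0; 0; 1; 0; 0]] [:: 256; 31009; -68761; 0; 184677; 64; 0; -164635; -34969; 256; -146847; -214591; 44371; -204237; 0; -73591; 128; 256; 64; 228579; 256; 0; 138933; 0];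
Case 6 [:: 1; 2; 0; 3]%N 2 18 2 [::] [:: 0; 256; -8793; 0; 34139; 0; 2807; 0; -42159; 0; -64; 256; 128; 0; 30311; 0; 30863; -18101; 256; -893; -39315; 0; 0; 0; -10635; -29433; 0; -28981; -47193; 0; 256; 0];
Case 6 [:: 1; 2; 0; 3]%N 2 20 4 [:: [:: 0; 0; 0; 0; 1; 0; 0; 0; 0; 0; 0; 0; 0; 0; 1; 0]] [:: 256; -64; -43981; -112189; -35683; 0; 0; 0; 0; 63735; -243569; -24425; -80383; 0; 256; 0; -47729; 110645; 64; 256; 0; 0; -35683; 0; 249715; -28877; -63735; 0; 256; 0; 84465; 0];
Case 7 [:: 1; 2; 3]%N 0 20 4 [::] [:: 0; 256; 0; 29845; -139191; -86517; 182807; 0; 256; 22149; -166267; -101695; 96245; -47075; 256; -128; 177243; 0; 139805; -146553; 0; -152429; -256; 256]].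

Definition cases_3_6 : seq case := [::
Case 5 [:: 0; 1; 2]%N 0 16 4 [::] [:: -10603; 0; 0; 0; 0; 256; -12875; 0; 256; -64; 0; 0; -2381; 256; 0; -12875; 10603; 0];
Case 5 [:: 0; 1; 2]%N 0 16 4 [:: [:: 1; 0; 0; 0; 0; 0; 0; 0; 1; 0; 0; 0; 0; 0; 0; 1; 0; 0]] [:: -6489; 0; 0; 0; 256; 0; -12407; 0; -64; 256; 0; 64; 3303; 256; 7843; 0; 0; -11783];
Case 7 [:: 1; 2; 3]%N 0 16 8 [::] [:: 128; 256; 64; 0; 0; 3975; 3975; 0; 3975; 0; 256; 64; 64; 0; 0; 256; 0; 3975];
Case 8 [:: 1; 2; 3]%N 0 16 4 [::] [:: 8403; 0; 256; 64; -7937; 0; 64; 256; 0; 8649; 64; 0; 5955; 0; 0; 8835; 0; 256];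
Case 9 [:: 1; 2; 3]%N 0 16 4 [::] [:: 0; 4517; 0; -5813; 256; -64; 256; -64; 0; -64; 0; 2851; 0; -3675; 256; 64; 0; 6773];
Case 10 [:: 2; 3; 4]%N 0 16 4 [::] [:: 0; -253; 11035; 0; 256; 0; 256; 0; 1039; 0; 0; 10239; 0; 10507; 64; 256; 0; -4109];
Case 11 [:: 2; 3; 5]%N 0 16 4 [::] [:: 0; 256; 0; -159; 0; 8927; -8883; 0; 256; 0; 0; -3323; 1011; 0; 0; 9351; 256; 0];
Case 6 [:: 1; 2; 0; 3]%N 2 20 4 [::] [:: 64; 256; 175611; 0; 0; 0; 64; 0; -111039; 0; 128; 0; 256; 0; -77519; 0; 37573; 0; 62109; 256; 0; 0; 124615; 0; 256; -18937; 0; -24671; -93899; 0; 0; 0; 0; 39281; 0; -76937; 128659; 0; 256; 0; 0; 172649; 256; 128; 128; 0; 0; 0];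
Case 6 [:: 1; 2; 0; 3]%N 2 20 4 [:: [:: 0; 0; 1; 0; 0; 0; 0; 0; 0; 0; 0; 1; 0; 0; 0; 0; 0; 0; 0; 0; 0; 0; 1; 0]] [:: -139295; 0; 0; 112035; 256; 0; 35665; 0; -61335; 0; 256; -41521; 0; 0; 97873; 0; 64; 256; 0; 159869; 0; 0; 89319; 0; 256; -128; 0; -64; 125165; 0; 0; 0; 0; 112121; 0; 59871; 107035; 0; 256; 0; 0; 218855; 256; 128; -181933; 0; 0; 0];
Case 7 [:: 1; 2; 3]%N 0 20 4 [::] [:: 0; 0; -128; -166479; 256; -128; 0; 256; -71457; 10927; 0; -108571; 256; 0; 178393; 53325; 0; -241209; -18817; 0; 128423; 0; 14165; 256; 21575; 0; -64; 256; 32273; 0; 64; 256; 184759; 0; -64; 0];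
Case 5 [:: 0; 1; 2]%N 0 22 4 [::] [:: 0; -444749; 10303; 0; 128; 256; 0; -280463; 612609; 256; 192; 0; 256; -263451; -733923; 0; -684973; 0; 259229; 0; 39183; 256; 0; 558531; -400379; 0; -272635; 0; 256; 64; -101593; 256; -514727; 0; 0; -50751; 256; 192; 507741; 0; 0; 191055; 0; -915003; -537439; 0; 256; 238177; 0; -337523; -128; 256; 0; -312781];
Case 5 [:: 0; 1; 2]%N 0 24 4 [:: [:: 1; 0; 0; 0; 0; 0; 0; 0; 1; 0; 0; 0; 0; 0; 0; 1; 0; 0]] [:: 0; 256; 1280379; 0; 377149; -17163; 0; 0; -1173257; 256; 128; -1769445; 256; 0; 1919001; 0; -4130721; -1016707; 0; -2232557; -1059935; 0; 192; 256; 0; 3472159; 128; 256; -4722323; 0; 256; -3954065; -2819693; 0; 3361047; 0; -1560573; 0; 664311; 256; -222669; 0; 62049; 0; -1154391; 0; 1767279; 256; 3154579; 256; 2413553; 0; 4005823; 0]].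

Definition cases_2_7 : seq case := [::
Case 6 [:: 1; 2; 3; 0]%N 1 16 2 [::] [:: 256; 128; 192; -192; 0; -16523; -6707; 0; 0; 13063; -15661; 8447; 256; 2301; -14039; 0];
Case 7 [:: 1; 2; 3; 0]%N 1 16 4 [::] [:: -8013; 192; -6449; 0; 64; 256; -4437; 0; 0; 16211; -192; 256; 0; 0; 11725; 0];
Case 7 [:: 1; 2; 3; 0]%N 1 16 4 [:: [:: 1; 0; 0; 0; 0; 0; 0; 0; 0; 1; 0; 0; 0; 0; 0; 0]] [:: -64; 8381; 7417; 0; 256; 0; 4931; 0; 64; -11733; -128; 256; 0; 0; 11171; 0];
Case 9 [:: 1; 2; 3; 0]%N 1 16 4 [::] [:: -64; 11433; 64; 256; 0; 1667; 10259; 0; -9117; -128; -4699; 0; 256; 64; 6789; 0];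
Case 9 [:: 2; 3; 4; 0]%N 1 16 2 [:: [:: 1; 0; 0; 0; 0; 0; 0; 0; 0; 1; 0; 0; 0; 0; 0; 0]] [:: 8987; -64; -64; 256; 0; -4983; 7051; 0; 64; 9035; -873; 0; 256; -64; -11053; 0];
Case 10 [:: 1; 2; 3; 0]%N 1 16 4 [:: [:: 1; 0; 0; 0; 0; 0; 0; 0; 0; 1; 0; 0; 0; 0; 0; 0]] [:: -1821; -6055; -8311; 0; 64; 256; 8625; 0; -64; 13311; 0; 256; -3395; 0; 9169; 0];
Case 11 [:: 1; 2; 5; 0]%N 1 18 4 [:: [:: 1; 0; 0; 0; 0; 0; 0; 0; 0; 1; 0; 0; 0; 0; 0; 0]] [:: -64; -58343; 256; -64; -40935; 0; 21241; 0; -37417; -53155; 0; -39921; -256; 256; -46743; 0];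
Case 6 [:: 0; 1; 2; 3]%N 1 20 4 [:: [:: 0; 0; 1; 0; 0; 0; 0; 0; 0; 0; 0; 1; 0; 0; 0; 0]] [:: 274279; 132625; 0; 58525; -183545; -121943; 256; 0; -195963; -243553; 256; 64; -24009; 248285; 0; 0; -192; 256; -199701; -36833; 0; 128711; 185633; 0; -129247; 0; 0; 180379; 256; 192; -25549; 0];
Case 7 [:: 1; 2; 3; 0]%N 1 20 4 [::] [:: 0; 256; 0; -96871; -123655; 129867; -1827; 0; -207341; 0; 256; 192; 107331; 0; -151319; 0; 0; -70069; -193073; -149491; 64; 256; 0; 0; -68281; -177633; -128; 11895; -194549; 0; 256; 0];
Case 7 [:: 1; 2; 3; 0]%N 1 20 4 [:: [:: 1; 0; 0; 0; 0; 0; 0; 0; 0; 1; 0; 0; 0; 0; 0; 0]] [:: 179217; 64; -62717; 141793; -3537; 256; 0; 0; 64; 138473; 12037; -125333; 118169; 0; 256; 0; 190279; 128; 64; 256; 31841; 0; -63949; 0; -60751; 58023; 216403; 0; -64; 256; -53461; 0];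
Case 8 [:: 1; 2; 3; 4]%N 1 22 4 [::] [:: 256; -185195; -761743; -165689; 466823; 482867; 0; 0; 0; -463437; -834299; 334365; 112233; 739863; 256; 0; 447475; 291837; 714185; 0; -128; 256; -247875; 0; -64; -1068357; -192; 256; -450223; 0; 410897; 0];
Case 3 [:: 1; 1; 1; 0]%N 1 26 8 [:: [:: 1; 0; 2; 0; 4; 0; 0; 0; 0; 1; 0; 2; 0; 4; 0; 0];  [:: 3; 3; -1; 3; 2; 0; 0; 0; -3; 3; -3; -1; 0; 2; 0; 0]] [:: 4224491; 0; -9501803; -696499; 256; 64; 415665; 0; -15977931; 256; 15236057; -64; 0; 1084357; -8264383; 0; -7033103; -11841225; 256; -64; 2324099; 10729351; 0; 0; -2118197; -9115809; 0; -919749; -10508267; 10046293; 256; 0; 0; 904585; -6553305; 256; 6944981; 3202829; 7906813; 0; 256; 3546539; -5342535; 0; -9761137; 9226843; 5674597; 0; 256; 219391; 0; -16213749; 7839651; -7106561; 9355693; 0; 0; -43501; 256; 4536317; -5549719; -984489; -13571857; 0; 256; 2509111; 4135727; 3285001; 0; 2079017; -11966929; 0; 0; -9665207; -7077661; -3884635; 256; -5884577; -8458279; 0]].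

Definition cases_3_7 : seq case := [::
Case 5 [:: 1; 2; 2; 0]%N 1 16 4 [::] [:: 0; 0; 128; 256; 0; 0; -12527; 0; 256; 64; -7959; 0; 0; -64; -6551; 0; 0; -8339; 539; 0; 256; -128; 4591; 0];
Case 5 [:: 1; 1; 2; 0]%N 1 16 4 [:: [:: 0; 0; 1; 0; 0; 0; 0; 0; 0; 0; 0; 1; 0; 0; 0; 0; 0; 0; 0; 0; 0; 0; 1; 0]] [:: 0; 12821; 1999; 0; 128; 256; 64; 0; 256; 0; 351; 0; -1063; 0; 10605; 0; 0; 64; 128; 256; 15695; 0; 0; 0];
Case 7 [:: 1; 2; 3; 0]%N 1 16 4 [::] [:: -5387; 0; 0; 256; -64; 0; -5103; 0; 64; 0; -3727; 0; 0; 256; 8847; 0; -64; 256; 0; 0; -64; 0; 10193; 0];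
Case 7 [:: 1; 2; 3; 0]%N 1 16 4 [:: [:: 0; 0; 0; 0; 1; 0; 0; 0; 0; 0; 0; 0; 0; 1; 0; 0; 0; 0; 0; 0; 0; 0; 1; 0]] [:: 256; 0; 5517; 0; -64; 0; 0; 0; 0; 5745; -64; 256; 0; 0; 6435; 0; 0; 0; 7259; 0; -128; 256; 11663; 0];
Case 9 [:: 1; 2; 4; 0]%N 1 16 2 [::] [:: 0; -64; 64; 0; -64; 256; -8913; 0; 256; -64; -6271; 0; -4975; 0; 7107; 0; 0; 7247; 128; 256; 64; 0; 9549; 0];
Case 9 [:: 2; 3; 4; 0]%N 1 16 2 [:: [:: 0; 0; 1; 0; 0; 0; 0; 0; 0; 0; 0; 1; 0; 0; 0; 0; 0; 0; 0; 0; 0; 0; 1; 0]] [:: -5381; 0; -64; 0; 256; 64; -3829; 0; 0; 256; 64; 0; 0; -5259; 6665; 0; 7477; 0; 128; 256; 0; -64; -10411; 0];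
Case 11 [:: 1; 2; 3; 0]%N 1 16 2 [::] [:: 5451; 0; 256; 64; 0; -2731; -5951; 0; 0; 0; 0; 2157; 256; 0; 8099; 0; 64; 256; 0; -2773; 0; 0; 10285; 0];
Case 11 [:: 1; 2; 3; 0]%N 1 16 2 [:: [:: 1; 0; 0; 0; 0; 0; 0; 0; 0; 1; 0; 0; 0; 0; 0; 0; 0; 0; 0; 0; 0; 0; 1; 0]] [:: 1265; 0; 0; -243; 0; 256; -10387; 0; 2487; 0; 256; -64; 7015; 0; 64; 0; 64; 256; 0; 7109; 64; 0; -7317; 0];
Case 13 [:: 1; 2; 5; 0]%N 1 18 4 [::] [:: -25705; 0; -64; 256; 19753; 0; 31131; 0; -64; 0; -24045; 0; 64; 256; -40113; 0; 64; 256; 8043; 0; -36125; 0; -29723; 0];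
Case 13 [:: 1; 3; 4; 0]%N 1 18 4 [:: [:: 0; 0; 1; 0; 0; 0; 0; 0; 0; 0; 0; 1; 0; 0; 0; 0; 0; 0; 0; 0; 0; 0; 1; 0]] [:: 0; 17489; -10753; 0; 0; 256; 31385; 0; 256; 0; -7647; 0; 20691; 0; 33333; 0; 0; 24829; 0; 256; 64; 0; 36449; 0];
Case 14 [:: 3; 4; 6; 7]%N 1 18 2 [:: [:: 1; 0; 0; 0; 0; 0; 0; 0; 0; 1; 0; 0; 0; 0; 0; 0; 0; 0; 0; 0; 0; 0; 1; 0]] [:: -25249; 0; -45621; 0; -64; 256; 19039; 0; -35607; 0; -192; 256; 2787; 0; -36747; 0; -128; 256; -23583; 0; -42395; 0; 42567; 0];
Case 15 [:: 1; 3; 4; 0]%N 1 18 4 [:: [:: 1; 0; 0; 0; 0; 0; 0; 0; 0; 1; 0; 0; 0; 0; 0; 0; 0; 0; 0; 0; 0; 0; 1; 0]] [:: 0; 256; -1039; 0; 0; -37145; 27719; 0; 9741; 0; 34179; 0; 256; 64; 27359; 0; 24469; 0; -192; 256; 0; -8223; 42441; 0];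
Case 8 [:: 1; 2; 3; 4]%N 1 22 4 [:: [:: 0; 0; 0; 0; 1; 0; 0; 0; 0; 0; 0; 0; 0; 1; 0; 0; 0; 0; 0; 0; 0; 0; 1; 0]] [:: 0; 256; 0; 776729; 0; 224095; 320687; 0; -232857; 0; 0; -364811; 256; 64; -554089; 0; 27869; 0; 256; 138525; 0; -514449; 167205; 0; -996753; 0; 0; 256; -116935; -301561; 0; 0; -256; 256; -102477; 0; 667655; 128; 0; 0; -192; 0; -448501; 0; -94077; 692853; 256; 0];
Case 9 [:: 1; 2; 4; 0]%N 1 22 4 [::] [:: 64; 733989; 0; -297171; 0; 99857; 256; 0; -716475; -508067; 0; -53179; 256; -128; 0; 0; 128; 170543; 256; -198247; 0; 729215; 0; 0; -128; 256; -178585; 0; 463057; 0; 165883; 0; 682215; 0; 0; 256; 100213; 0; 275283; 0; 64; 0; 733525; 0; 279885; 256; -472743; 0];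
Case 9 [:: 1; 2; 4; 0]%N 1 22 4 [:: [:: 1; 0; 0; 0; 0; 0; 0; 0; 0; 1; 0; 0; 0; 0; 0; 0; 0; 0; 0; 0; 0; 0; 1; 0]] [:: 0; 0; 546077; -223847; 0; 256; 249847; 0; -357677; 256; 64; 884029; 0; 0; -410729; 0; -928021; 0; -156619; -176601; 256; 0; 679785; 0; 0; 2851; 0; 256; 176645; 0; 630769; 0; 256; 64; 295539; 0; 384043; 0; 937523; 0; 0; -411121; 730559; 0; -128; 256; -681151; 0];
Case 10 [:: 1; 3; 4; 0]%N 1 22 4 [::] [:: 0; 0; 256; -116237; -675047; 275503; 47799; 0; 0; 256; 0; -411515; 637327; 669359; 464237; 0; 256; 0; 0; -593905; -581559; -452055; -567211; 0; -946549; -64; -218135; 0; 0; -255403; 256; 0; 745007; 487313; -128; 256; 0; 744089; 0; 0; 758461; 506339; 67173; 0; 256; 64; 0; 0];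
Case 7 [:: 1; 2; 3; 0]%N 1 24 4 [::] [:: -74017; 0; 2874125; 0; 1283065; -2007275; 256; 0; -429055; 0; 192; 256; 496603; 2750381; 0; 0; -128; 256; 3665357; 0; 31523; 1154627; 0; 0; -3335211; 0; 1596759; 64; 256; -128; 0; 0; 4001577; 0; 999305; -1893151; 0; -1275795; 256; 0; -128; 256; -1589783; 2013955; 0; -1853363; 0; 0; -69469; -2817603; -320; 256; 0; 0; -3034793; 0; 4127013; 92667; -1038301; 0; 256; 0; 763959; 0; 1027483; -1800263; -3841597; 0; 0; 256; -1721805; 0];
Case 7 [:: 1; 2; 3; 0]%N 1 24 4 [:: [:: 0; 0; 0; 0; 1; 0; 0; 0; 0; 0; 0; 0; 0; 1; 0; 0; 0; 0; 0; 0; 0; 0; 1; 0]] [:: 0; -2459849; 0; -107685; 942785; -409095; 256; 0; 256; -64; 0; 2253601; 313793; -1497197; 0; 0; 0; 1359517; 256; 192; 3651755; 1089211; 0; 0; 0; -761505; 0; 132457; -645641; 256; -1365087; 0; 256; -90499; 0; 342695; -1563873; 0; -34085; 0; 0; -3273613; 256; 2504213; -1673177; 0; 1465469; 0; -2312797; -1158459; 0; 0; 64; 256; 0; 0; 838575; -55681; 256; 0; 14727; 0; -2288875; 0; -1319773; 2170177; 0; 256; -2189271; 0; -2149663; 0]].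

Definition cases_2_8 : seq case := [::
Case 3 [:: 0; 1; 1; 1]%N 0 20 4 [::] [:: 51511; 202435; 64; 36873; -50909; 0; 0; 256; 239999; -64; -128; 128; -42469; -64; 256; 0; -42903; -101111; 74905; 0; 0; 256; 13177; 27007; 112447; -64; 128; 256; 128; 0; 4485; 50363];
Case 7 [:: 0; 1; 2; 3]%N 0 16 4 [::] [:: -10883; -4237; 0; 256; 0; -5945; 9411; -64; -64; 11733; 2121; 0; 256; 0; 64; 13175];
Case 7 [:: 0; 1; 2; 3]%N 0 16 4 [:: [:: 1; 0; 0; 0; 0; 0; 0; 0; 0; 1; 0; 0; 0; 0; 0; 0]] [:: 1373; 8553; -64; 256; 0; -6259; 10441; 64; 9051; 0; 2233; 0; 256; -64; 0; 14191];
Case 9 [:: 1; 2; 3; 4]%N 0 16 4 [::] [:: 7517; 9827; 6095; 0; 64; 12245; 0; 256; -64; -16659; 192; 256; -192; 128; 8171; 0];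
Case 9 [:: 1; 2; 3; 4]%N 0 16 2 [:: [:: 1; 0; 0; 0; 0; 0; 0; 0; 0; 1; 0; 0; 0; 0; 0; 0]] [:: 128; 5357; 256; 64; 0; 7115; -11455; 128; 13543; 64; 0; -979; 256; 64; 0; 14129];
Case 10 [:: 1; 2; 3; 4]%N 0 16 2 [:: [:: 1; 0; 0; 0; 0; 0; 0; 0; 0; 1; 0; 0; 0; 0; 0; 0]] [:: -4811; 3717; 0; -6487; 256; -64; 0; 12659; 12095; 64; 256; -64; 0; 1469; -11639; 64];
Case 11 [:: 1; 2; 4; 5]%N 0 16 2 [:: [:: 0; 0; 0; 0; 1; 0; 0; 0; 0; 0; 0; 0; 0; 1; 0; 0]] [:: 64; 14543; 128; 256; 0; -11371; 0; -2441; -13819; -3471; 8687; 0; -128; -11567; 256; 256];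
Case 12 [:: 2; 3; 4; 5]%N 0 18 4 [:: [:: 0; 0; 1; 0; 0; 0; 0; 0; 0; 0; 0; 1; 0; 0; 0; 0]] [:: -128; -61249; 64; -62579; 0; -7481; 64; 256; 7535; -61691; -765; -51635; 256; 64; -22433; 0];
Case 13 [:: 1; 3; 4; 6]%N 0 18 4 [:: [:: 1; 0; 0; 0; 0; 0; 0; 0; 0; 1; 0; 0; 0; 0; 0; 0]] [:: 0; 256; -64; -71967; 35777; 0; 26525; 34663; 9335; 0; 38511; 47265; -192; 256; 60705; -64];
Case 7 [:: 0; 1; 2; 3]%N 0 22 8 [:: [:: 1; 0; 0; 0; 0; 0; 0; 0; 0; 1; 0; 0; 0; 0; 0; 0]] [:: -716443; 390439; -64; 256; 0; 128; -119117; 302909; 635367; 0; -323107; 0; 256; -64; 503191; -490477; -309659; 0; 644349; 206659; -16793; -428897; 128; 256; 128; 256; -128; -914567; -956399; 529895; -784019; 0];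
Case 8 [:: 1; 2; 3; 0; 4]%N 2 20 4 [::] [:: -88735; 0; 69061; 23345; 0; 256; -125823; 0; -231529; 0; -160; 256; 165227; -48333; -89387; 0; 12259; 0; -168185; 0; 10143; -148921; -268187; 0; 119221; 32; 256; 0; -145815; 0; 173655; -96; -96; 256; 32; -220103; 0; 0; -29477; 0];
Case 8 [:: 1; 2; 3; 0; 4]%N 2 20 4 [:: [:: 0; 0; 0; 0; 1; 0; 0; 0; 0; 0; 0; 0; 0; 0; 0; 1; 0; 0; 0; 0]] [:: 256; 0; -120421; 163111; -18681; 0; -122601; 0; -104247; 0; 0; 200803; -113451; 14297; 0; 256; -257367; 0; -47717; 0; -96435; -3495; 0; 256; 80071; -64; 127279; 0; 0; 0; -117103; -108189; 99387; 0; -64; 208059; 29451; 0; 256; 0];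
Case 9 [:: 1; 2; 3; 4]%N 0 20 4 [::] [:: 64; 248541; 0; -41065; -2395; -75609; 0; 256; 28611; 64; -244721; -14261; -224839; 76713; 256; 0; 167991; 0; -64; 256; 0; -64013; -121399; 35919; 67161; 194217; -77783; 0; 256; -128; -66779; 46461];
Case 9 [:: 1; 2; 3; 4]%N 0 20 4 [:: [:: 1; 0; 0; 0; 0; 0; 0; 0; 0; 1; 0; 0; 0; 0; 0; 0]] [:: 198491; -64; 183707; 0; -10887; -34403; 64; 256; -172141; -6623; 0; 256; 154431; -43265; -70467; 0; 0; -163543; -42405; 102455; 256; 64; 0; 55209; -57391; -158743; -65753; -116275; 0; -163681; 256; -13427];
Case 5 [:: 0; 1; 2; 2]%N 0 26 8 [::] [:: 5114079; 0; -6150115; 2317663; -2367741; -2497359; -64; 256; -6436823; 256; 5209503; -3754211; -14980557; 6954191; -8876449; 0; 0; -9415813; 10649113; 3818263; -128; 256; 14256359; -4610491; 256; 6266257; -14239573; -13054893; -6174379; 0; -3941233; 10098007; 13067359; 13784595; 0; 7723091; 15526945; 2224769; -7885711; 256; -128; -18884187; 256; 2681079; -10358171; -8691861; 6222723; 0; 10921775; -6370677; 256; 0; -3149145; 0; -4386617; -4273123; 13597161; 333263; 0; 128; -256; 256; -192; 1544845];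
Case 7 [:: 0; 1; 2; 3]%N 0 24 4 [::] [:: 0; 1506465; 872793; 2559979; -2562311; -407339; -128; 256; 256; 0; -559153; -202137; -3079341; -3172671; -3924993; 0; 977751; 948921; 0; 1602277; -64; 256; -865829; -247575; -888411; 1623953; 256; -64; 1325245; 0; 1097233; 2625979; 70577; 256; 0; 972619; -2188103; -354803; 2004205; 2343649; 3188243; 0; 256; -447597; 1590571; -253463; 1171237; -1284623]].

Definition cases_3_8 : seq case := [::
Case 5 [:: 0; 1; 1; 2]%N 0 16 2 [::] [:: -12111; 3937; 0; 0; 256; 64; 0; 0; 64; 10561; 0; -64; 0; 7205; 0; 256; -41; -9251; 256; 0; 0; -1989; 7057; 0];
Case 6 [:: 1; 2; 2; 0; 3]%N 2 16 2 [::] [:: 256; 64; 0; 9769; 0; 64; 13295; 0; 0; 0; 0; 3481; 256; -64; 0; 0; -64; 0; 13235; 0; 0; 8389; 0; 3659; 256; 128; 10269; 0; 3287; 0];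
Case 7 [:: 0; 1; 2; 3]%N 0 16 2 [::] [:: 0; 5553; -9487; 0; -64; -128; 256; 64; 0; 14661; 0; 256; 0; 256; 0; 0; 256; -467; 12595; 0; -13341; 0; 0; 10577];
Case 7 [:: 0; 1; 2; 3]%N 0 16 2 [:: [:: 1; 0; 0; 0; 0; 0; 0; 0; 0; 0; 1; 0; 0; 0; 0; 0; 0; 0; 0; 1; 0; 0; 0; 0]] [:: -3051; -10289; 64; 0; 256; 64; 0; 0; 7895; 64; 0; 0; 0; 6363; 256; -64; 8859; -11071; 64; 256; 0; 64; 0; -8739];
Case 9 [:: 1; 2; 3; 4]%N 0 16 2 [::] [:: 0; 64; 128; 256; 0; 7609; -8881; 0; 0; -11481; 0; 0; 128; 4311; 64; 256; 256; 0; -4693; 0; -15555; 128; -64; 0];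
Case 10 [:: 1; 2; 3; 4]%N 0 16 2 [::] [:: -64; -64; 4325; 0; 8119; 0; 0; 256; 0; -192; -7871; 0; 0; 256; -1807; 0; 11781; -128; 0; 256; 1195; 0; 4425; 0];
Case 11 [:: 1; 2; 4; 5]%N 0 16 2 [::] [:: 128; 11871; 0; 601; -6617; 0; 0; 256; 7527; -128; 256; 0; -443; 0; -64; 0; -64; -64; 0; -7195; -192; 256; -11509; 0];
Case 12 [:: 1; 2; 3; 4]%N 0 18 4 [::] [:: 0; 256; 0; -21885; 0; 22665; 0; -128; 19791; 0; 256; 64; 0; -29633; -64; -41867; -21523; 0; 0; 3107; 256; 128; 60509; 64];
Case 13 [:: 2; 3; 4; 6]%N 0 18 4 [::] [:: 64; 0; 64; 256; 42859; 64; -21023; 0; 11519; 0; 11045; 0; -64; -61205; 64; 256; 192; 256; 28925; 0; 24717; -128; 29507; 0];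
Case 14 [:: 2; 3; 5; 6]%N 0 18 4 [::] [:: 45731; -64; 0; 256; 0; -7621; 0; 2475; -64; 32771; 21009; 0; 0; -15717; 256; 0; 0; 46417; -5245; 0; 256; 64; 0; 13961];
Case 15 [:: 1; 2; 4; 7]%N 0 18 2 [::] [:: 0; 21555; 23831; 0; -64; 256; -20779; 39231; 256; 0; -32743; 0; 26401; 0; -28723; -64; 0; -13679; -128; 256; 64; 0; -128; 57249];
Case 16 [:: 4; 5; 6; 7]%N 0 18 2 [::] [:: -21757; 0; 48209; 43215; 256; 128; -33065; 0; -128; 256; -55777; -64; 0; 32001; -17413; 0; -40863; 0; 128; 43879; 0; -523; -64; 256];
Case 17 [:: 4; 5; 6; 8]%N 0 18 4 [::] [:: 0; -14307; 0; 256; 40575; 0; 0; 25487; 256; -128; 26771; 0; -64; 57019; 0; 15197; 0; 32881; -8337; 0; -21517; 35931; 256; 0];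
Case 18 [:: 2; 5; 7; 8]%N 0 20 4 [::] [:: -94107; -128567; 0; -121587; 118923; 0; -64; 256; 113731; 97683; 0; -132283; 192; 256; -120697; 0; -64; 261447; 256; 192; -25347; 0; 45993; 0];
Case 19 [:: 1; 2; 5; 7]%N 0 20 4 [::] [:: -64; 256; 0; -143181; 170679; -84771; 0; 80943; -132367; 0; 0; -8773; 192; -221361; 256; 0; -44173; 0; 256; -192; -66041; 245285; 0; -172037];
Case 10 [:: 1; 2; 3; 4]%N 0 22 4 [::] [:: 0; -63849; 256; 228643; -294523; 432305; 0; 227875; 0; 401823; 0; 555253; 128; 0; 256; 64; 256; 64; 0; 332069; -246573; -246995; 0; -573515; -192; -142595; 392711; 0; 698895; 0; -192; 256; 320; 156407; -107053; 0; 179407; 256; 406423; 0; -256; -564607; 64; 256; -1045207; 0; -5103; 0];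
Case 10 [:: 1; 2; 3; 0; 5]%N 2 22 4 [:: [:: 0; 0; 0; 0; 1; 0; 0; 0; 0; 0; 0; 0; 0; 0; 0; 1; 0; 0; 0; 0; 0; 0; 0; 0; 0; 0; 0; 0; 1; 0]] [:: 0; 256; -235189; 0; 733017; -385261; 341051; 0; -277741; 0; 0; 0; -275417; 256; 64; 1241689; -533005; 0; -211367; 0; 256; 0; -256; 0; 0; 128; 487271; 0; -613875; 0; -64; 671847; -378867; 0; 486841; -225135; 256; 0; 0; 0; 500643; -310613; -64; 256; 495567; -134157; 0; 0; 0; 0; 365869; 473209; 369969; 0; 128; 445449; 0; 0; 256; 0];
Case 11 [:: 1; 3; 4; 5]%N 0 22 4 [::] [:: 0; -51581; 0; -339597; 256; -32; 672643; 215317; 0; -828433; 256; 96; 0; 582943; -682705; -66417; 256; -192; 0; -57905; 0; 224; -796577; -32; 0; -50139; 0; 429357; 32; 37835; -32; 256; 256; -48589; 0; 423771; 303459; -447311; 544321; 0; 0; -323165; 256; -64; 853725; 240497; -475181; 0];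
Case 11 [:: 0; 1; 3; 5]%N 0 24 4 [:: [:: 1; 0; 0; 0; 0; 0; 0; 0; 0; 0; 0; 0; 0; 0; 1; 0; 0; 0; 0; 0; 0; 0; 0; 1]] [:: -2865895; 1137279; 1874813; 0; 256; 64; 397257; 0; -794069; 2246965; 1155647; 0; 0; -1471189; -449413; 256; 1784437; -1641367; 128; 256; 0; -2279515; -1212075; 0; 2344331; 0; -1624765; 0; 1784927; -192; -64; 256; 1452861; 256; -1401187; 0; -3017345; 2497491; 115741; 0; -2758255; 0; -175299; 256; -1009501; -64; 2332697; 0];
Case 12 [:: 2; 3; 4; 5]%N 0 24 4 [::] [:: 256; 64; -908057; -380467; 1878861; 0; 0; 1238921; 0; -64125; 3826969; -1971703; -64; 256; 0; 440477; 0; -3522207; 4085707; 131115; 1781777; 0; 256; 782129; 858065; 2075951; 0; -2571091; 256; -1627091; 0; -2325951; 1665903; 384963; 0; -1852501; 0; -1178241; 256; -128; -3023215; -1490479; 256; 128; 0; -530047; 0; -64];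
Case 12 [:: 1; 3; 4; 0; 6]%N 2 24 4 [:: [:: 0; 0; 0; 0; 1; 0; 0; 0; 0; 0; 0; 0; 0; 0; 0; 1; 0; 0; 0; 0; 0; 0; 0; 0; 0; 0; 0; 0; 1; 0]] [:: 128; 256; -486261; -2590007; -323825; 0; -1934307; 0; 0; 0; 1459367; 0; 3386695; 128; 1261419; 0; 20641; 0; 256; 0; -2245061; 0; 3138161; 3275627; 672027; 256; -1874751; 0; 0; 0; 1683011; 0; 659267; 0; 256; -64; 1595793; 0; 1536739; 0; 320651; 0; -803151; 256; 0; 1462507; 3295177; 0; 224081; 0; -984253; 256; -2408283; 0; 0; -1428679; 3444435; 0; 1950115; 0];
Case 13 [:: 1; 2; 4; 6]%N 0 24 4 [::] [:: 666657; 924711; -1404905; 256; 2639349; 0; 1643413; 0; 2072933; -205347; 111621; 0; 134135; 0; -1015659; 256; -2231969; 2421759; -335893; 0; 192; 256; 1980131; 0; 0; 256; -672505; -2362791; -73437; 0; 0; -22659; -824231; 0; -1087519; 2553113; -538019; 256; 0; 2184587; -3482371; 0; 4127727; 192; -1620321; 0; 256; -128];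
Case 9 [:: 1; 2; 3; 4]%N 0 26 8 [::] [:: 0; 3448689; -133991; 7501703; 4635917; 0; -192; 256; 256; 64; -1521171; 4820253; 6188733; 0; -12786985; 0; 0; 846333; -10062143; -548195; -128; 256; 4503897; 0; 0; 10046599; -32; 256; 5503805; 2268937; 0; -980121; 256; -9056699; 862815; 0; -1871467; 10853955; 0; 1926169; 0; -12897163; 7851377; 0; 9919921; 16897695; 256; 3392243; 3997927; 3688295; 256; 0; 0; 3417375; -192; -12789075; 10000991; 3631173; 0; 256; 0; 10842007; -5697465; -7219987; -7933671; -32; 0; 0; 256; 10937543; -15616145; -280257];
Case 7 [:: 0; 1; 2; 3]%N 0 26 4 [::] [:: 6772563; -1645085; -709141; 0; 0; 256; -10172151; -4544307; 6186231; 6599369; 8334423; 0; 256; 0; -192; -2682205; 10997199; -11022215; -1663667; 256; 0; 0; 2062805; -11113527; 256; -7200963; -3480313; 0; 11050833; -1887803; 0; 904625; 0; -4213337; -978979; 256; 11080645; 3383547; 0; 7318491; 0; -11936299; -774377; 0; 208685; -3181581; 256; -192; 119355; 256; 1373461; 0; -1906367; 10771309; 0; 6143351; -10289981; 0; -256; 256; -1419375; 20653731; 0; -5914029; -27189; 0; -11816609; 0; 991121; 15826529; 256; 7582165; -9281123; -4622611; -1291559; 256; 0; -2560153; 0; 9638263; 2561141; 418007; -12480163; 0; 0; -13088187; 256; 9643443; -17289543; -192; 8259023; 0; 256; -128; 0; 3257859]].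

Definition cases_4_8 : seq case := [::
Case 5 [:: 0; 1; 1; 2]%N 0 18 4 [::] [:: -2775; -25255; 0; 0; 64; 256; 15035; 0; -58091; 64; 256; 0; 64; 0; 128; 0; 128; 64; 0; 256; 0; 0; 57253; 0; -1115; -63589; 0; 0; -31341; 0; -64; 256];
Case 5 [:: 1; 1; 2; 2]%N 0 18 4 [:: [:: 0; 0; 1; 0; 0; 0; 0; 0; 0; 0; 0; 1; 0; 0; 0; 0; 0; 0; 0; 0; 0; 0; 1; 0; 0; 0; 0; 0; 0; 0; 0; 1]] [:: 0; 0; -42287; 14001; 256; 64; 0; -1197; 0; 256; 7081; 128; 0; 64; 0; -33013; 256; 0; -192; 0; 0; 68431; 0; 17893; 0; 0; -128; -52983; 0; 0; 256; 128];
Case 7 [:: 1; 2; 2; 3]%N 0 16 4 [::] [:: 0; 0; 0; 6135; -1; 0; 256; 128; 0; 4095; 256; 0; -1; 0; 0; 6135; 0; 3815; 0; 0; 0; 256; 0; 0; 256; 0; 0; -64; 3815; 0; 0; 0];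
Case 7 [:: 0; 1; 2; 3]%N 0 16 2 [:: [:: 1; 0; 0; 0; 0; 0; 0; 0; 0; 1; 0; 0; 0; 0; 0; 0; 0; 0; 0; 0; 1; 0; 0; 0; 0; 0; 0; 0; 0; 1; 0; 0]] [:: -8243; 0; 0; 0; 0; -4195; 256; 0; -8727; 0; 0; 0; 256; -64; 0; -64; 8841; 0; 256; -64; 0; 0; 0; -64; 2001; 256; 0; -15015; 0; 0; 0; -13647];
Case 9 [:: 1; 2; 3; 4]%N 0 16 2 [::] [:: 0; -4655; 0; -64; -128; 0; 128; 256; 0; 0; 0; -8527; 0; 256; -4545; 0; 256; -64; 0; -4139; 64; 0; 8859; 0; 0; -9985; 256; 64; -64; 0; 0; 0];
Case 9 [:: 1; 2; 3; 4]%N 0 16 2 [:: [:: 1; 0; 0; 0; 0; 0; 0; 0; 0; 1; 0; 0; 0; 0; 0; 0; 0; 0; 0; 0; 1; 0; 0; 0; 0; 0; 0; 0; 0; 1; 0; 0]] [:: 0; -5571; 5853; 0; -64; 256; 0; 0; 0; 0; 64; 256; -2061; 0; 0; -4087; 256; 0; 64; 0; 0; 0; 0; -7801; 0; 1211; -64; 0; 64; 0; 256; -64];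
Case 10 [:: 1; 2; 3; 4]%N 0 18 8 [:: [:: 0; 0; 1; 0; 0; 0; 0; 0; 0; 0; 0; 1; 0; 0; 0; 0; 0; 0; 0; 0; 0; 0; 1; 0; 0; 0; 0; 0; 0; 0; 0; 1]] [:: 0; -64; 0; 0; 0; 256; 20571; 0; 0; -21951; 0; -64; -26087; 0; -64; 256; 256; 128; 0; -29683; 0; 0; 17909; 0; 0; -39533; 256; -64; 25509; 0; 0; 0];
Case 11 [:: 2; 3; 4; 5]%N 0 18 4 [:: [:: 1; 0; 0; 0; 0; 0; 0; 0; 0; 1; 0; 0; 0; 0; 0; 0; 0; 0; 1; 0; 0; 0; 0; 0; 0; 0; 0; 1; 0; 0; 0; 0]] [:: 256; 0; 0; 20581; 0; 34579; 0; 0; 0; -12179; 256; -64; 0; -64; 33547; 0; 0; 16527; 0; 17265; 0; 0; 64; 256; 0; 8115; 0; -64; 256; -192; 64; 0];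
Case 12 [:: 1; 2; 4; 5]%N 0 18 4 [:: [:: 0; 0; 1; 0; 0; 0; 0; 0; 0; 0; 0; 1; 0; 0; 0; 0; 0; 0; 0; 0; 1; 0; 0; 0; 0; 0; 0; 0; 0; 1; 0; 0]] [:: 0; 0; 0; 0; 30917; 0; 256; 0; -128; 256; 28431; 0; 7189; 0; 0; 16149; 38963; 0; -33005; 0; -64; 256; 0; 1231; -64; 0; -128; 256; -64; 0; 0; 40393];
Case 13 [:: 2; 4; 5; 6]%N 0 18 4 [:: [:: 1; 0; 0; 0; 0; 0; 0; 0; 0; 1; 0; 0; 0; 0; 0; 0; 0; 0; 1; 0; 0; 0; 0; 0; 0; 0; 0; 1; 0; 0; 0; 0]] [:: -64; 0; -7777; 0; 256; 0; 17933; 0; 22159; 0; 0; 256; 0; 35525; 31721; 0; 34613; 0; 0; 0; 0; 0; 64; 256; 192; 256; 47023; 0; 0; 0; 22543; 0];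
Case 15 [:: 2; 4; 5; 7]%N 0 18 4 [::] [:: -24275; 0; 256; -64; 0; 0; 0; -16907; -15051; 0; 0; 21695; 23829; 0; 256; 0; 0; 0; 0; -22939; -64; 256; 0; 16325; -128; 256; 0; 0; 19749; 0; 0; 20733];
Case 15 [:: 2; 4; 5; 7]%N 0 18 4 [:: [:: 1; 0; 0; 0; 0; 0; 0; 0; 0; 1; 0; 0; 0; 0; 0; 0; 0; 0; 1; 0; 0; 0; 0; 0; 0; 0; 0; 1; 0; 0; 0; 0]] [:: 0; -16317; 0; -18749; 0; -20663; 64; 256; 0; 19381; 256; 0; 0; -64; -27721; 0; 0; 0; 0; 16165; 256; 0; -19449; 0; 256; -128; 0; 0; 0; 18381; 30325; 0];
Case 17 [:: 2; 3; 5; 6]%N 0 18 2 [::] [:: 0; 24559; -64; 0; 0; -16057; 64; 256; 0; 27605; 192; 256; 0; 25857; 24081; 0; 256; 128; 0; 0; 0; 33373; -10439; 0; 0; -461; 38045; 0; 256; -64; -21131; 0];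
Case 17 [:: 1; 2; 4; 6]%N 0 20 4 [:: [:: 0; 0; 1; 0; 0; 0; 0; 0; 0; 0; 0; 1; 0; 0; 0; 0; 0; 0; 0; 0; 1; 0; 0; 0; 0; 0; 0; 0; 0; 1; 0; 0]] [:: 130933; 0; 0; -124401; 64; 256; 0; 86903; 0; 256; 0; 108681; -74195; 0; 0; -145417; 69231; 0; 0; 64; 68387; 0; 256; -64; 166277; 0; 256; -128; 110889; 0; 0; 64];
Case 18 [:: 1; 2; 7; 8]%N 0 20 4 [:: [:: 0; 0; 1; 0; 0; 0; 0; 0; 0; 0; 0; 1; 0; 0; 0; 0; 0; 0; 0; 0; 1; 0; 0; 0; 0; 0; 0; 0; 0; 1; 0; 0]] [:: 64; 256; -7119; 0; 0; 0; 0; 155365; 122223; 0; -160909; 0; 0; -105889; 256; -128; 85271; 0; 0; 256; 0; -144311; 0; 58167; 152565; 0; -113055; 0; 256; 0; 0; -142879];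
Case 19 [:: 1; 2; 3; 6]%N 0 20 4 [:: [:: 0; 0; 1; 0; 0; 0; 0; 0; 0; 0; 0; 1; 0; 0; 0; 0; 0; 0; 0; 0; 1; 0; 0; 0; 0; 0; 0; 0; 0; 1; 0; 0]] [:: 256; 0; 0; -112909; 0; -19665; 15839; 0; 0; 127571; 0; -77403; 0; -88293; -128; 256; 0; -81987; 256; 64; 0; -82231; 184775; 0; 0; -124025; 0; 64; 256; -128; 160969; 0];
Case 20 [:: 5; 6; 7; 8]%N 0 20 4 [:: [:: 0; 0; 1; 0; 0; 0; 0; 0; 0; 0; 0; 1; 0; 0; 0; 0; 0; 0; 0; 0; 1; 0; 0; 0; 0; 0; 0; 0; 0; 1; 0; 0]] [:: 192; 256; -88845; 0; -177907; 0; 0; 80591; 130367; 0; -8623; 0; -139433; 0; 256; -64; 63001; 0; 143727; 0; 64; 256; 0; 117783; -178699; 0; 64; 256; 121351; 0; 0; -129083];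
Case 21 [:: 1; 7; 8; 9]%N 0 20 4 [:: [:: 1; 0; 0; 0; 0; 0; 0; 0; 0; 1; 0; 0; 0; 0; 0; 0; 0; 0; 0; 0; 0; 0; 1; 0; 0; 0; 0; 0; 0; 0; 0; 1]] [:: 37853; 0; -128; 256; -133385; 0; 0; 16647; 116259; 0; 108433; 0; -5377; 0; 256; 64; 100845; 0; 54861; 0; 64; 256; 0; 105067; 64; 256; 134121; 0; 131941; 0; 0; -58653];
Case 11 [:: 1; 2; 4; 5]%N 0 24 4 [:: [:: 1; 0; 0; 0; 0; 0; 0; 0; 0; 1; 0; 0; 0; 0; 0; 0; 0; 0; 1; 0; 0; 0; 0; 0; 0; 0; 0; 1; 0; 0; 0; 0]] [:: -1093983; 0; 0; 1236209; 958041; 0; 256; -64; 1402435; 0; 0; 1504181; 0; 256; 0; 3378531; 256; 256; 0; 0; -94639; 0; 0; 2704075; 3004405; 0; 256; -1448817; -1618401; 0; 0; 192; 0; 873325; 2738415; 0; 256; 0; 1121893; 0; 0; -903755; 3263543; 192; 0; 0; -1497287; 256; 256; 0; -64; -4448087; 0; 0; -1603909; 0; 0; 2682283; 1101001; 2465755; 0; 256; 1056005; 0];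
Case 12 [:: 1; 2; 4; 5]%N 0 24 4 [::] [:: 1205077; 256; 2042635; -1578113; -801555; 0; 0; 0; -1249437; 0; 900041; 525441; -192; 256; 0; 0; 1834937; 0; 992833; -2167481; 3179653; 0; 256; 0; 655159; 0; 128; -3950887; -756449; 0; 0; 256; -2281581; 0; 0; 0; 256; -250643; 64; 4171809; 128; 256; 0; 0; 0; 1314149; -2143421; -192; -1210961; 0; 256; 0; 0; -1687601; 864129; -64; -2693277; 0; 0; 256; 0; 64; 1258099; -2641201];
Case 12 [:: 1; 2; 3; 4]%N 0 24 4 [:: [:: 1; 0; 0; 0; 0; 0; 0; 0; 0; 1; 0; 0; 0; 0; 0; 0; 0; 0; 0; 0; 1; 0; 0; 0; 0; 0; 0; 0; 0; 1; 0; 0]] [:: 256; 0; 0; 0; -486929; 332569; 0; 908113; 0; -1068417; 256; 0; 1606667; -2923271; 0; 357731; 0; -1900817; 0; 0; -1715959; -314951; 256; 333607; 0; -64; 0; 256; -128; 3739203; 0; 1258099; 2008649; -2200677; -583741; 0; 0; 0; 256; 128; 786637; 1926249; 346513; 0; 0; 256; 0; 128; 332843; 2784829; 2252463; 0; 256; 0; 0; -3763439; 2613729; -1745389; -128; 256; 0; 0; 0; 2091067];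
Case 13 [:: 1; 2; 5; 6]%N 0 24 4 [::] [:: -808933; 0; 256; -331679; 0; 0; 2822147; 246005; -64; 256; 0; 1302091; 0; 0; -518979; 1649891; 1017821; 0; 0; 1129041; 0; 256; 589735; 1548317; -1457997; 0; 0; 2517955; 256; 0; 1083887; -2769161; 256; 893509; 0; 2726437; 1767155; 1246015; 0; 0; 0; -2056693; 256; -192; 64; 3324333; 0; 0; 0; 0; 0; 956985; -2227903; -2318069; 0; 256; 0; -3886011; 0; -192; 13551; -64; 256; 0];
Case 13 [:: 1; 2; 3; 4]%N 0 24 4 [:: [:: 0; 0; 0; 0; 1; 0; 0; 0; 0; 0; 0; 0; 0; 1; 0; 0; 0; 0; 0; 0; 0; 0; 1; 0; 0; 0; 0; 0; 0; 0; 0; 1]] [:: 0; -2053315; 0; 2570741; 184139; 0; 256; 64; 0; -3964015; 256; -2497471; -2218387; 0; 0; 1068209; 0; -1902855; 0; -1632877; 0; 256; 0; 1319167; 256; -2275215; 0; -1588149; 2499909; 0; 0; 262081; -1335849; 1613299; 0; 256; 192367; 0; 0; 0; 256; -256; 2949363; 0; -347057; 256; 0; 0; 3119561; 937935; 642171; 0; -1635551; 0; 256; 0; -1689607; 2047385; -2818019; 0; 2822143; 0; 0; 256];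
Case 9 [:: 1; 2; 3; 4]%N 0 26 8 [:: [:: 1; 0; 0; 0; 0; 0; 0; 0; 0; 1; 0; 0; 0; 0; 0; 0; 0; 0; 0; 0; 1; 0; 0; 0; 0; 0; 0; 0; 0; 1; 0; 0]] [:: 128; 256; 0; 0; 1272665; 2048603; 0; -800167; 64; 0; 0; 256; -2410829; 128; 0; 7233421; -11819267; 0; 0; 0; -5465299; -605529; 256; 2778577; -3720729; 0; 256; 0; 128; -16550961; 0; -1280811; 0; -7742489; 6205087; 0; 256; 954223; 0; 0; 0; 10722709; -2024991; -4836277; 0; -64; 256; 0; 0; -2844049; 9418235; -2644661; 0; 4610311; 0; 256; 256; 2587533; 243267; 11950591; 0; -4132269; 0; 0; 2699833; 5807757; 0; 8716845; 0; 0; 0; 256; -2027703; -13233295; 0; 6964725; 0; 256; -2007621; 0; -5361615; 3356673; 256; 2745751; 0; 0; -3987145; 0; -766775; 7539313; 0; 6458303; 256; 0; 4731877; 0];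
Case 7 [:: 1; 2; 3; 3]%N 0 28 8 [:: [:: 0; 0; 1; 0; 0; 0; 0; 0; 0; 0; 0; 1; 0; 0; 0; 0; 0; 0; 0; 0; 1; 0; 0; 0; 0; 0; 0; 0; 0; 1; 0; 0]] [:: 0; 0; 0; -28382277; 256; 3394719; 3258301; -23686371; 256; 0; 0; -11645831; 0; 12330213; 50803459; 24957579; 0; 256; 0; 32813193; 0; 12637097; 7334255; 303819; 0; 0; 256; 192; 0; -38464721; -18980411; 192; 0; 15328509; 0; 10205849; -8852201; 0; 256; 32437731; 0; 14753777; 0; 5309005; 64; 256; 0; -10069219; 256; 64; 0; 7471901; -47103257; 0; 0; -35361845; 0; 7680747; 256; -2964201; 14670105; 0; 0; 55779485; 8299581; -5319569; 0; -33122717; 0; 50529029; 0; 256; -37682699; 52489611; 0; -1248229; 0; -8577047; 256; 0; 12055935; 128; 0; -66668287; 256; 19698981; 0; 0; 53695749; -23317061; 256; 17366807; 0; 10990701; 0; 0; 0; 0; 11716583; 0; 7398813; -40001899; 256; 0; 0; 0; 21380131; 256; -4804377; -23407411; 0; -275065; 256; 0; 8917059; 0; -53069475; 12508305; 0; -10857913; 0; 256; 44225571; 0; 10130593; -41305683; 0; -12669021];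
Case 5 [:: 0; 1; 1; 2]%N 0 30 8 [::] [:: 108943681; 0; -220372983; 256; 0; -132501181; 0; 56209479; 163768493; 256; -184471559; 0; 0; -1150641; 0; 131566755; -118925283; 0; 128; 0; 0; 2750161; 256; -41212743; 154786105; 0; -128; 0; 256; -192; 0; -34641259; 0; -108943013; 0; 0; -15573169; 63582651; 256; -9442151; 256; 42163119; 0; 0; 57801105; 159601835; 0; -27223875; 0; 5419051; 256; 0; 88937279; -165357975; 0; 161903991; 0; 136992613; 0; 256; 48067341; -192; 0; 98483931; 256; 0; 72148911; 116309541; 0; -58442555; 0; 153397607; 0; 256; -36685187; -6455793; 0; -109444925; 0; 120767913; 0; 0; 28627833; 65322447; 256; -39775669; 0; 252938621; 0; 0; 165818901; 176081493; 0; 46525303; 256; -8933283; -46707709; 106104263; 75122865; 0; 256; -41005433; 0; 0; 17788033; -21972147; 10612551; 0; 0; 64; 256; 0; -135999497; 9844423; -78205699; 256; 0; 126649143; 0; 0; -128; -231764159; -44576427; 0; 0; 249987317; 0; 256; -124275805; 0; 256; 128; 0; -159479527; 35513257; 0; -140599237; 256; 0; 240625557; 0; -38106711; -89084545; 0; -13734703; 0; 0; -32755619; 256; -45711685; 122848979; 0; 21795149; 0; 0; 207850469; 0; -57737133; 17588183; 256; 0; -83267289; 88567165; 0; 256; 0; 53726683; -77473953; 0; 154193411; 137440199; 0; 0; 256; 67394133; 41701159; 0; 126409319; 64; 256; 0; 0; -91339103; 88746699; 256; -19248279; 93225749; 0; 0; 0; 172234245; 3888705]].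
End Data.

(** N is given by the position in the list, and [shape_check] confirms that the orbits and invariant
    subspaces of the case number N in all. *)
Lemma simplices_of_cases (R : realType) m n a (cs : seq case) :
  all (fun x => case_check m n x.1 x.2) (zip (iota a (size cs)) cs) ->
  forall N, (a <= N < a + size cs)%N -> exists P : 'I_N -> 'M[R]_n, tight_simplex m P.
Proof.
move=> H N /andP[aN Ns].
have lt : (N - a < size cs)%N by lia.
have sz : size (iota a (size cs)) = size cs by rewrite size_iota.
pose D0 := Case 0 [::] 0 0 Z0 [::] [::].
move: H => /(all_nthP (0%N, D0)) /(_ (N - a)%N).
rewrite size_zip sz minnn nth_zip // nth_iota // subnKC // => /(_ lt).
exact: case_check_sound.
Qed.

Lemma cases_2_4_ok :
  all (fun x => case_check 2 4 x.1 x.2) (zip (iota 4 (size cases_2_4)) cases_2_4).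
Proof. by vm_cast_no_check (erefl true). Qed.

Lemma cases_2_5_ok :
  all (fun x => case_check 2 5 x.1 x.2) (zip (iota 5 (size cases_2_5)) cases_2_5).
Proof. by vm_cast_no_check (erefl true). Qed.

Lemma cases_2_6_ok :
  all (fun x => case_check 2 6 x.1 x.2) (zip (iota 5 (size cases_2_6)) cases_2_6).
Proof. by vm_cast_no_check (erefl true). Qed.

Lemma cases_3_6_ok :
  all (fun x => case_check 3 6 x.1 x.2) (zip (iota 5 (size cases_3_6)) cases_3_6).
Proof. by vm_cast_no_check (erefl true). Qed.

Lemma cases_2_7_ok :
  all (fun x => case_check 2 7 x.1 x.2) (zip (iota 6 (size cases_2_7)) cases_2_7).
Proof. by vm_cast_no_check (erefl true). Qed.

Lemma cases_3_7_ok :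
  all (fun x => case_check 3 7 x.1 x.2) (zip (iota 5 (size cases_3_7)) cases_3_7).
Proof. by vm_cast_no_check (erefl true). Qed.

Lemma cases_2_8_ok :
  all (fun x => case_check 2 8 x.1 x.2) (zip (iota 6 (size cases_2_8)) cases_2_8).
Proof. by vm_cast_no_check (erefl true). Qed.

Lemma cases_3_8_ok :
  all (fun x => case_check 3 8 x.1 x.2) (zip (iota 5 (size cases_3_8)) cases_3_8).
Proof. by vm_cast_no_check (erefl true). Qed.

Lemma cases_4_8_ok :
  all (fun x => case_check 4 8 x.1 x.2) (zip (iota 5 (size cases_4_8)) cases_4_8).
Proof. by vm_cast_no_check (erefl true). Qed.

Theorem theorem6p4 (R : realType) (m n N : nat) :
  ([/\ (m = 2)%N, (n = 4)%N & (4 <= N <= 6)%N] \/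
   [/\ (m = 2)%N, (n = 5)%N & (5 <= N <= 10)%N] \/
   [/\ (m = 2)%N, (n = 6)%N & (5 <= N <= 14)%N] \/
   [/\ (m = 3)%N, (n = 6)%N & (5 <= N <= 16)%N] \/
   [/\ (m = 2)%N, (n = 7)%N & (6 <= N <= 17)%N] \/
   [/\ (m = 3)%N, (n = 7)%N & (5 <= N <= 22)%N] \/
   [/\ (m = 2)%N, (n = 8)%N & (6 <= N <= 21)%N] \/
   [/\ (m = 3)%N, (n = 8)%N & (5 <= N <= 28)%N] \/
   [/\ (m = 4)%N, (n = 8)%N & (5 <= N <= 30)%N]) ->
  exists P : 'I_N -> 'M[R]_n, @tight_simplex R m n N P.
Proof.
case=> [|[|[|[|[|[|[|[|]]]]]]]] [-> -> NP].
- exact: (simplices_of_cases R cases_2_4_ok NP).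
- exact: (simplices_of_cases R cases_2_5_ok NP).
- exact: (simplices_of_cases R cases_2_6_ok NP).
- exact: (simplices_of_cases R cases_3_6_ok NP).
- exact: (simplices_of_cases R cases_2_7_ok NP).
- exact: (simplices_of_cases R cases_3_7_ok NP).
- exact: (simplices_of_cases R cases_2_8_ok NP).
- exact: (simplices_of_cases R cases_3_8_ok NP).
- exact: (simplices_of_cases R cases_4_8_ok NP).
Qed.
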